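(* Let $(M,L)$ be a Finsler manifold of dimension $n\geq3$ and let $q\neq1$ be an arbitrary real number. Suppose that the $h$-curvature tensor $R$ of the Cartan connection satisfies, for all $\pi$-vector fields $\overline{X},\overline{Y},\overline{Z}$, $$R(\overline{X},\overline{Y})\overline{Z}=k\,\mathfrak{A}_{\overline{X},\overline{Y}}\Big\{q\,g(\overline{X},\overline{Z})\overline{Y}+(q-2)\big(L^{-1}g(\overline{X},\overline{Z})\ell(\overline{Y})\overline{\eta}-\ell(\overline{Y})\ell(\overline{Z})\overline{X}\big)\Big\},$$ where $k(x,y)$ is a smooth function on $\mathcal{T}M$ positively homogeneous of degree $0$ in $y$. Then: (a) $k$ is a constant. (b) If $k\neq0$, then for all $\pi$-vector fields $\overline{X},\overline{Y},\overline{Z}$: 1) $P(\overline{X},\overline{Y})\overline{Z}=P(\overline{Y},\overline{X})\overline{Z}$ (i.e. $(M,L)$ is symmetric); 2) $S(\overline{X},\overline{Y})\overline{Z}=\dfrac{2-q}{2(q-1)L^2}\big\{\hbar(\overline{X},\overline{Z})\phi(\overline{Y})-\hbar(\overline{Y},\overline{Z})\phi(\overline{X})\big\}$.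
   Context: $M$ is a connected smooth manifold, $\mathcal{T}M=TM\setminus 0$ is the bundle of nonzero tangent vectors, $\pi:\mathcal{T}M\to M$ the projection, and $\pi^{-1}(TM)\to\mathcal{T}M$ the pullback bundle. Sections of $\pi^{-1}(TM)$ are called $\pi$-vector fields (written $\overline{X},\overline{Y},\dots$); tensor fields on $\pi^{-1}(TM)$ are called $\pi$-tensor fields. The fundamental $\pi$-vector field is $\overline{\eta}(u)=(u,u)$. There is an exact sequence $0\to\pi^{-1}(TM)\xrightarrow{\gamma}T(\mathcal{T}M)\xrightarrow{\rho}\pi^{-1}(TM)\to0$, where $\gamma(u,v)=\frac{d}{dt}|_{t=0}(u+tv)$ and $\rho(X)=(u,d\pi(X))$ for $X\in T_u(\mathcal{T}M)$. $L$ is the Finsler function and $g$ the Finsler metric on $\pi^{-1}(TM)$ defined by $L$ (in coordinates $g_{ij}=\frac12\partial^2L^2/\partial y^i\partial y^j$), so $g(\overline{\eta},\overline{\eta})=L^2$; $\ell:=L^{-1}g(\overline{\eta},\cdot)$; the angular metric tensor is $\hbar:=g-\ell\otimes\ell$; $\phi$ is the vector $\pi$-form defined by $g(\phi(\overline{X}),\overline{Y})=\hbar(\overline{X},\overline{Y})$. A connection $\nabla$ on $\pi^{-1}(TM)$ has connection map $K(X)=\nabla_X\overline{\eta}$, $X\in T(\mathcal{T}M)$; it is regular if $T(\mathcal{T}M)=\ker d\pi\oplus\ker K$, and then its horizontal map is $\beta:=(\rho|_{\ker K})^{-1}$. Its torsion is $\mathbf{T}(X,Y)=\nabla_X\rho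 Y-\nabla_Y\rho X-\rho[X,Y]$ and its curvature is, with the sign convention $\mathbf{K}(X,Y)\overline{Z}=-\nabla_X\nabla_Y\overline{Z}+\nabla_Y\nabla_X\overline{Z}+\nabla_{[X,Y]}\overline{Z}$. Put $Q(\overline{X},\overline{Y})=\mathbf{T}(\beta\overline{X},\beta\overline{Y})$ and $T(\overline{X},\overline{Y})=\mathbf{T}(\gamma\overline{X},\beta\overline{Y})$. The Cartan connection of $(M,L)$ is the unique regular connection $\nabla$ on $\pi^{-1}(TM)$ with $\nabla g=0$, $Q=0$ and $g(T(\overline{X},\overline{Y}),\overline{Z})=g(T(\overline{X},\overline{Z}),\overline{Y})$. All objects refer to it. The $h$-, $hv$- and $v$-curvature tensors are $R(\overline{X},\overline{Y})\overline{Z}=\mathbf{K}(\beta\overline{X},\beta\overline{Y})\overline{Z}$, $P(\overline{X},\overline{Y})\overline{Z}=\mathbf{K}(\beta\overline{X},\gamma\overline{Y})\overline{Z}$, $S(\overline{X},\overline{Y})\overline{Z}=\mathbf{K}(\gamma\overline{X},\gamma\overline{Y})\overline{Z}$. $\mathfrak{A}_{\overline{X},\overline{Y}}\{F(\overline{X},\overline{Y})\}:=F(\overline{X},\overline{Y})-F(\overline{Y},\overline{X})$. *)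

(* Defs.v *)
From HB Require Import structures.
From mathcomp Require Import all_boot all_order all_algebra.
From mathcomp Require Import all_classical all_reals all_analysis.

Set Implicit Arguments.
Unset Strict Implicit.
Unset Printing Implicit Defensive.

Import Order.TTheory GRing.Theory Num.Theory.
Import numFieldNormedType.Exports.

Local Open Scope classical_set_scope.
Local Open Scope ring_scope.

(* C^k on a set U, meant for U open: f is differentiable on U and each of its
   directional derivatives is C^(k-1) on U.  In finite dimension this is the
   usual C^k.  Values of f outside U are irrelevant. *)
Fixpoint Ck (R : realType) (V W : normedModType R) (k : nat) (U : set V)
    (f : V -> W) : Prop :=
  match k with
  | 0 => forall x, U x -> {for x, continuous f}
  | k'.+1 => (forall x, U x -> differentiable f x) /\
             (forall v : V, Ck k' U (fun x => 'd f x v))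
  end.

Definition smooth_on (R : realType) (V W : normedModType R) (U : set V)
    (f : V -> W) : Prop := forall k, Ck k U f.

(* An n-dimensional smooth manifold, given by an atlas (not necessarily
   maximal).  [param i] is the inverse of the chart [chart i]; it is meaningful
   only on the image [chart i @` dom i].  [chart_at x] selects one chart of the
   atlas around x; it is used to identify the tangent space at x with R^n, and
   nothing is assumed about the way it depends on x. *)
Record manifold (R : realType) (n : nat) := Manifold {
  carrier :> topologicalType ;
  chart_index : Type ;
  dom : chart_index -> set carrier ;
  chart : chart_index -> carrier -> 'rV[R]_n ;
  param : chart_index -> 'rV[R]_n -> carrier ;
  chart_at : carrier -> chart_index ;
  dom_chart_at : forall x, dom (chart_at x) x ;
  open_dom : forall i, open (dom i) ;
  open_image_chart : forall i, open (chart i @` dom i) ;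
  chartK : forall i x, dom i x -> param i (chart i x) = x ;
  continuous_chart : forall i x, dom i x -> {for x, continuous (chart i)} ;
  continuous_param : forall i z, (chart i @` dom i) z ->
    {for z, continuous (param i)} ;
  smooth_transition : forall i j,
    smooth_on (chart i @` (dom i `&` dom j)) (chart j \o param i) ;
  manifold_hausdorff : hausdorff_space carrier ;
  manifold_second_countable : @second_countable carrier }.

Arguments dom {R n} M i : rename.
Arguments chart {R n} M i x : rename.
Arguments param {R n} M i z : rename.
Arguments chart_at {R n} M x : rename.

Section TangentBundle.
Variables (R : realType) (n : nat) (M : manifold R n).
Local Notation E := 'rV[R]_n.

(* T_x M is identified with R^n by means of the chart [chart_at M x], so that
   TM is, as a set, M * R^n; the smooth structure of TM is not the product one,
   but the one given by the charts [tchart i] below.  A point u : tbundle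
   belongs to the slit bundle iff u.2 != 0.  In the same way, the
   fibre at u of the pullback bundle pi^-1(TM) is T_(u.1) M = R^n, and the
   tangent space of the slit bundle at u is identified with R^n * R^n by means
   of the chart [tchart (chart_at M u.1)].  Fields are total functions on TM;
   their values on the zero section are irrelevant. *)
Definition tbundle : Type := (M * E)%type.

Definition transition (i j : chart_index M) : E -> E := chart M j \o param M i.

Definition tchart (i : chart_index M) (u : tbundle) : E * E :=
  (chart M i u.1,
   'd (transition (chart_at M u.1) i) (chart M (chart_at M u.1) u.1) u.2).

Definition tparam (i : chart_index M) (z : E * E) : tbundle :=
  (param M i z.1, 'd (transition i (chart_at M (param M i z.1))) (z.1) z.2).

Definition slit_chart (i : chart_index M) : set (E * E) :=
  [set z | (chart M i @` dom M i) z.1 /\ z.2 != 0].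

Definition here (u : tbundle) : chart_index M := chart_at M u.1.

(* Functions on the slit bundle. *)
Definition smooth_fun (f : tbundle -> R) : Prop :=
  forall i, smooth_on (slit_chart i) (f \o tparam i).

(* Differential of f at u, applied to a tangent vector A of the slit bundle. *)
Definition dfun (f : tbundle -> R) (u : tbundle) (A : E * E) : R :=
  'd (f \o tparam (here u)) (tchart (here u) u) A.

(* pi-vector fields, with their components in the chart i. *)
Definition pi_comp (i : chart_index M) (X : tbundle -> E) (z : E * E) : E :=
  (tchart i ((tparam i z).1, X (tparam i z))).2.

Definition pi_field (X : tbundle -> E) : Prop :=
  forall i, smooth_on (slit_chart i) (pi_comp i X).

(* Vector fields on the slit bundle, with their components in the chart i. *)
Definition vf_comp (i : chart_index M) (A : tbundle -> E * E) (z : E * E)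
    : E * E :=
  let u := tparam i z in
  'd (tchart i \o tparam (here u)) (tchart (here u) u) (A u).

Definition vfield (A : tbundle -> E * E) : Prop :=
  forall i, smooth_on (slit_chart i) (vf_comp i A).

Definition lie_bracket (A B : tbundle -> E * E) (u : tbundle) : E * E :=
  let z := tchart (here u) u in
  'd (vf_comp (here u) B) z (A u) - 'd (vf_comp (here u) A) z (B u).

(* The fundamental pi-vector field. *)
Definition eta (u : tbundle) : E := u.2.

Definition gamma (u : tbundle) (v : E) : E * E :=
  derive1 (fun t : R => tchart (here u) (u.1, u.2 + t *: v)) 0.

(* The differential of the projection u |-> u.1. *)
Definition rho (u : tbundle) (A : E * E) : E :=
  'd (chart M (here u) \o fst \o tparam (here u)) (tchart (here u) u) A.

Definition alternate (F : E -> E -> E) (v w : E) : E := F v w - F w v.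

Section FinslerMetric.
Variable L : tbundle -> R.

(* Second derivative of L^2/2 along the fibre. *)
Definition fmetric (u : tbundle) (v w : E) : R :=
  2^-1 * 'D_v (fun y' : E => 'D_w (fun y : E => L (u.1, y) ^+ 2) y') u.2.

(* Continuity of L on all of TM is implied by these conditions. *)
Record finsler : Prop := Finsler {
  finsler0 : forall x, L (x, 0) = 0 ;
  finsler_gt0 : forall u : tbundle, u.2 != 0 -> 0 < L u ;
  finsler_smooth : smooth_fun L ;
  finsler_homogeneous : forall (u : tbundle) (t : R), 0 < t ->
    L (u.1, t *: u.2) = t * L u ;
  finsler_definite : forall (u : tbundle) (v : E), u.2 != 0 -> v != 0 ->
    0 < fmetric u v v }.

Definition ell (u : tbundle) (v : E) : R := (L u)^-1 * fmetric u (eta u) v.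

Definition hbar (u : tbundle) (v w : E) : R :=
  fmetric u v w - ell u v * ell u w.

(* The vector phi(v) determined by g(phi(v), w) = hbar(v, w) for all w. *)
Definition phi (u : tbundle) (v : E) : E :=
  xget 0 [set z | forall w, fmetric u z w = hbar u v w].

End FinslerMetric.

Section Connection.
(* [nabla u A Z] is the covariant derivative of the pi-vector field Z in the
   direction of the vector A, tangent to the slit bundle at u. *)
Variable nabla : tbundle -> E * E -> (tbundle -> E) -> E.

Record connection : Prop := Connection {
  nabla_linear : forall (u : tbundle) (a : R) (A B : E * E) (Z : tbundle -> E),
    u.2 != 0 -> pi_field Z ->
    nabla u (a *: A + B) Z = a *: nabla u A Z + nabla u B Z ;
  nabla_add : forall (u : tbundle) (A : E * E) (Y Z : tbundle -> E),
    u.2 != 0 -> pi_field Y -> pi_field Z ->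
    nabla u A (fun u' => Y u' + Z u') = nabla u A Y + nabla u A Z ;
  nabla_leibniz : forall (u : tbundle) (A : E * E) (f : tbundle -> R)
      (Z : tbundle -> E),
    u.2 != 0 -> smooth_fun f -> pi_field Z ->
    nabla u A (fun u' => f u' *: Z u') =
      dfun f u A *: Z u + f u *: nabla u A Z ;
  nabla_smooth : forall (A : tbundle -> E * E) (Z : tbundle -> E),
    vfield A -> pi_field Z -> pi_field (fun u => nabla u (A u) Z) }.

Definition connection_map (u : tbundle) (A : E * E) : E := nabla u A eta.

Definition vertical (u : tbundle) : set (E * E) := [set A | rho u A = 0].
Definition horizontal (u : tbundle) : set (E * E) :=
  [set A | connection_map u A = 0].

(* At every point the tangent space is the direct sum of the vertical and the
   horizontal subspaces. *)
Definition regular : Prop := forall u : tbundle, u.2 != 0 ->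
  (forall A, exists B C, [/\ vertical u B, horizontal u C & A = B + C]) /\
  vertical u `&` horizontal u = [set 0].

(* The inverse of rho restricted to the horizontal subspace. *)
Definition beta (u : tbundle) (v : E) : E * E :=
  xget 0 [set A | horizontal u A /\ rho u A = v].

Definition gammaf (X : tbundle -> E) (u : tbundle) : E * E := gamma u (X u).
Definition betaf (X : tbundle -> E) (u : tbundle) : E * E := beta u (X u).
Definition rhof (A : tbundle -> E * E) (u : tbundle) : E := rho u (A u).

Definition torsion (A B : tbundle -> E * E) (u : tbundle) : E :=
  nabla u (A u) (rhof B) - nabla u (B u) (rhof A) - rho u (lie_bracket A B u).

Definition curvature (A B : tbundle -> E * E) (Z : tbundle -> E) (u : tbundle)
    : E :=
  - nabla u (A u) (fun u' => nabla u' (B u') Z)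
  + nabla u (B u) (fun u' => nabla u' (A u') Z)
  + nabla u (lie_bracket A B u) Z.

Definition Qtorsion (X Y : tbundle -> E) := torsion (betaf X) (betaf Y).
Definition Ttorsion (X Y : tbundle -> E) := torsion (gammaf X) (betaf Y).

Definition h_curvature (X Y Z : tbundle -> E) :=
  curvature (betaf X) (betaf Y) Z.
Definition hv_curvature (X Y Z : tbundle -> E) :=
  curvature (betaf X) (gammaf Y) Z.
Definition v_curvature (X Y Z : tbundle -> E) :=
  curvature (gammaf X) (gammaf Y) Z.

Record cartan_connection (L : tbundle -> R) : Prop := CartanConnection {
  cartan_is_connection : connection ;
  cartan_regular : regular ;
  cartan_metric : forall (u : tbundle) (A : E * E) (Y Z : tbundle -> E),
    u.2 != 0 -> pi_field Y -> pi_field Z ->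
    dfun (fun u' => fmetric L u' (Y u') (Z u')) u A =
      fmetric L u (nabla u A Y) (Z u) + fmetric L u (Y u) (nabla u A Z) ;
  cartan_Q : forall (X Y : tbundle -> E) (u : tbundle),
    pi_field X -> pi_field Y -> u.2 != 0 -> Qtorsion X Y u = 0 ;
  cartan_T : forall (X Y Z : tbundle -> E) (u : tbundle),
    pi_field X -> pi_field Y -> pi_field Z -> u.2 != 0 ->
    fmetric L u (Ttorsion X Y u) (Z u) = fmetric L u (Ttorsion X Z u) (Y u) }.

End Connection.

End TangentBundle.

Arguments tbundle {R n} M.

(* Main.v *)
(* Smooth functions on the slit bundle form a ring, pi-vector fields and vector
   fields form modules over it, and the Bianchi identities are the two components
   of the Jacobi identity for horizontal and vertical lifts.  Written as
     g(R(X,Y)Z,W) = kap (g(X,Z) g(Y,W) - g(Y,Z) g(X,W))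
                    + mu (h(X,Z) h(Y,W) - h(Y,Z) h(X,W)),
   with kap = 2(q-1)k, mu = (2-q)k and h the angular metric, the hypothesis
   determines R(X,Y)eta in terms of kap alone.
   Differentiating R(X,Y)eta horizontally, respectively differentiating it
   vertically and summing cyclically, gives, for D either lift and y = g(eta,.),
     D_X kap (y(Y) Z - y(Z) Y) + D_Y kap (y(Z) X - y(X) Z)
     + D_Z kap (y(X) Y - y(Y) X) = 0.
   Choosing Y outside the span of X and Z (here n >= 3 enters) one gets
   D_Z kap y(X) = D_X kap y(Z).  For the vertical lift and X = eta, homogeneity
   shows that k is constant on the fibres.  Then k is a function on M and the
   horizontal identity at eta = v reads dk(Z) L(v)^2 = dk(v) y(Z); a nonzero v in
   the kernel of dk gives dk = 0.
   If k is a nonzero constant, the vertical derivative of R(X,Y)eta gives R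
   itself; comparing with the hypothesis, and then differentiating twice along
   the horizontal lift of eta, expresses the v-curvature through mu. *)

(* Over the ring of functions the geometry becomes polynomial, so it is proved there by [ring] after
   pairing with the metric; the absence of 2-torsion replaces division by 2. Two debts remain. The
   definition of a Cartan connection contains neither the symmetry of the torsion [T], nor its
   vanishing on [eta], nor [Dv X eta = X]. They come from the metric being half the fibre Hessian of
   [L ^ 2]: twice the lowered [T] is the flat fibre derivative of the metric, hence totally
   symmetric. The objects of the statement are pointwise and total on [TM]. One therefore needs
   smoothness of horizontal lifts, which are given by a choice operator, independence of [nabla]
   from values on the zero section, and cut-off functions extending a vector to a global field. The
   final step is a harmonic oscillator along the horizontal lift of [eta]: the derivative of [C] is
   [Phat], that of [Phat] is [- kap L^2 C]. The commutator of [Phat] is a multiple of the angular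
   product, which is constant along this lift. Its first derivative makes a mixed commutator vanish,
   whence the symmetry of [P]; the second one identifies the commutator of [C], which is [S]. *)
From HB Require Import structures.
Require Import Defs.
From mathcomp Require Import all_boot all_order all_algebra.
From mathcomp Require Import all_classical all_reals all_analysis.
From mathcomp Require Import ring.
Set Implicit Arguments.
Unset Strict Implicit.
Unset Printing Implicit Defensive.
Import Order.TTheory GRing.Theory Num.Theory.
Import numFieldNormedType.Exports.
Local Open Scope classical_set_scope.
Local Open Scope ring_scope.

(** * Cartan connections over a commutative ring *)

Section CartanAlgebra.
Variables (F : comPzRingType) (V T : lmodType F).
Variables (act : T -> F -> F) (nab : T -> V -> V) (br : T -> T -> T).
Variables (rho : {linear T -> V}) (gam bet : {linear V -> T}).
Variables (g : V -> V -> F) (eta : V).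

Hypothesis add_eq0 : forall a : F, a + a = 0 -> a = 0.
Hypothesis act_linear : forall f a A B, act (a *: A + B) f = a * act A f + act B f.
Hypothesis actD : forall A f h, act A (f + h) = act A f + act A h.
Hypothesis actM : forall A f h, act A (f * h) = act A f * h + f * act A h.
Hypothesis act_br : forall A B f,
  act (br A B) f = act A (act B f) - act B (act A f).
Hypothesis brC : forall A B, br A B = - br B A.
Hypothesis brD : forall A B C, br A (B + C) = br A B + br A C.
Hypothesis brZ : forall A f B, br A (f *: B) = act A f *: B + f *: br A B.
Hypothesis jacobi : forall A B C,
  br A (br B C) + br B (br C A) + br C (br A B) = 0.
Hypothesis nab_linear : forall X a A B, nab (a *: A + B) X = a *: nab A X + nab B X.
Hypothesis nabD : forall A X Y, nab A (X + Y) = nab A X + nab A Y.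
Hypothesis nabZ : forall A f X, nab A (f *: X) = act A f *: X + f *: nab A X.
Hypothesis rho_bet : forall X, rho (bet X) = X.
Hypothesis nab_bet_eta : forall X, nab (bet X) eta = 0.
Hypothesis rho_gam : forall X, rho (gam X) = 0.
Hypothesis nab_gam_eta : forall X, nab (gam X) eta = X.
Hypothesis splitting : forall A, A = bet (rho A) + gam (nab A eta).
Hypothesis g_linear : forall Z a X Y, g (a *: X + Y) Z = a * g X Z + g Y Z.
Hypothesis gC : forall X Y, g X Y = g Y X.
Hypothesis g_def : forall X, g X X = 0 -> X = 0.
Hypothesis metric : forall A X Y, act A (g X Y) = g (nab A X) Y + g X (nab A Y).

Local Notation D X := (nab (bet X)).
Local Notation Dv X := (nab (gam X)).

(* The tensors [T(X, Y)], [R(X, Y) eta] and [P(X, Y) eta]. *)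
Variables C Omega Phat : V -> V -> V.
Hypothesis rho_br_gam_bet : forall X Y,
  rho (br (gam X) (bet Y)) = Dv X Y - C X Y.
Hypothesis nab_br_bet_eta : forall X Y,
  nab (br (bet X) (bet Y)) eta = Omega X Y.
Hypothesis nab_br_bet_gam_eta : forall X Y,
  nab (br (bet X) (gam Y)) eta = D X Y + Phat X Y.
Variable cur : T -> T -> V -> V.
Hypothesis curE : forall A B Z,
  cur A B Z = - nab A (nab B Z) + nab B (nab A Z) + nab (br A B) Z.
Hypothesis rho_br_bet : forall X Y, rho (br (bet X) (bet Y)) = D X Y - D Y X.
Hypothesis br_gam : forall X Y, br (gam X) (gam Y) = gam (Dv X Y - Dv Y X).
Hypothesis cartanC : forall X Y, C X Y = C Y X.
Hypothesis cartan_sym : forall X Y Z, g (C X Y) Z = g (C X Z) Y.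
Hypothesis cartan_eta : forall X, C X eta = 0.

Lemma gDl X Y Z : g (X + Y) Z = g X Z + g Y Z.
Proof. by rewrite -[X]scale1r g_linear mul1r scale1r. Qed.
Lemma g0l X : g 0 X = 0.
Proof. by apply: (@addrI _ (g 0 X)); rewrite -gDl !addr0. Qed.
Lemma gZl a X Y : g (a *: X) Y = a * g X Y.
Proof. by rewrite -[_ *: X]addr0 g_linear g0l addr0. Qed.
Lemma gNl X Y : g (- X) Y = - g X Y.
Proof. by rewrite -scaleN1r gZl mulN1r. Qed.
Lemma gDr X Y Z : g Z (X + Y) = g Z X + g Z Y.
Proof. by rewrite gC gDl !(gC _ Z). Qed.
Lemma g0r X : g X 0 = 0.
Proof. by rewrite gC g0l. Qed.
Lemma gZr a X Y : g Y (a *: X) = a * g Y X.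
Proof. by rewrite gC gZl gC. Qed.
Lemma gNr X Y : g Y (- X) = - g Y X.
Proof. by rewrite gC gNl gC. Qed.
Definition gE := (gDl, gDr, gNl, gNr, gZl, gZr, g0l, g0r).

(** Nondegeneracy: identities between fields are checked as scalar identities, paired with an
    arbitrary [W]. *)
Lemma g_inj X Y : (forall W, g X W = g Y W) -> X = Y.
Proof.
move=> h; apply/eqP; rewrite -subr_eq0; apply/eqP/g_def.
by rewrite gDl gNl h subrr.
Qed.

Lemma act0 A : act A 0 = 0.
Proof. by apply: (@addrI _ (act A 0)); rewrite -actD !addr0. Qed.
Lemma actN A f : act A (- f) = - act A f.
Proof. by apply/eqP; rewrite -addr_eq0 -actD addNr act0. Qed.
Lemma act1 A : act A 1 = 0.
Proof. by apply: (@addrI _ (act A 1)); rewrite -[in RHS](mulr1 1) actM mulr1 mul1r addr0. Qed.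
Definition actE := (actD, actN, actM, act0, act1).

Lemma nabDl X A B : nab (A + B) X = nab A X + nab B X.
Proof. by rewrite -[A]scale1r nab_linear !scale1r. Qed.
Lemma nab0l X : nab 0 X = 0.
Proof. by apply: (@addrI _ (nab 0 X)); rewrite -nabDl !addr0. Qed.
Lemma nabZl a X A : nab (a *: A) X = a *: nab A X.
Proof. by rewrite -[_ *: A]addr0 nab_linear nab0l addr0. Qed.
Lemma nabNl X A : nab (- A) X = - nab A X.
Proof. by rewrite -scaleN1r nabZl scaleN1r. Qed.
Lemma nab0 A : nab A 0 = 0.
Proof. by apply: (@addrI _ (nab A 0)); rewrite -nabD !addr0. Qed.
Lemma nabN A X : nab A (- X) = - nab A X.
Proof. by apply/eqP; rewrite -addr_eq0 -nabD addNr nab0. Qed.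
Lemma gamD X Y : gam (X + Y) = gam X + gam Y. Proof. exact: linearD. Qed.
Lemma gamN X : gam (- X) = - gam X. Proof. exact: linearN. Qed.
Lemma gamZ a X : gam (a *: X) = a *: gam X. Proof. exact: linearZ. Qed.
Lemma betD X Y : bet (X + Y) = bet X + bet Y. Proof. exact: linearD. Qed.
Lemma betN X : bet (- X) = - bet X. Proof. exact: linearN. Qed.
Definition nabE :=
  (gamD, gamN, betD, betN, nabDl, nabD, nabNl, nabN, nab0l, nab0).

Lemma CE X Y : C X Y = Dv X Y - rho (br (gam X) (bet Y)).
Proof. by rewrite rho_br_gam_bet subKr. Qed.

Lemma cartanDr X Y Z : C X (Y + Z) = C X Y + C X Z.
Proof. by rewrite !CE nabD linearD brD linearD opprD addrACA. Qed.
Lemma cartanDl X Y Z : C (Y + Z) X = C Y X + C Z X.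
Proof. by rewrite cartanC cartanDr !(cartanC X). Qed.
(** The derivative of [f] produced by [nabZ] cancels the one produced by [brZ]. *)
Lemma cartanZr X f Y : C X (f *: Y) = f *: C X Y.
Proof.
rewrite !CE nabZ linearZ /= brZ linearD !linearZ /= rho_bet scalerBr.
by rewrite opprD addrACA subrr add0r.
Qed.
Lemma cartanZl X f Y : C (f *: Y) X = f *: C Y X.
Proof. by rewrite cartanC cartanZr cartanC. Qed.
Lemma cartanNr X Y : C X (- Y) = - C X Y.
Proof. by rewrite -!scaleN1r cartanZr. Qed.
Lemma cartanNl X Y : C (- Y) X = - C Y X.
Proof. by rewrite -!scaleN1r cartanZl. Qed.
Definition cartanE :=
  (cartanDr, cartanDl, cartanZr, cartanZl, cartanNr, cartanNl).

(** On the function [g Z W] the commutator of two derivations is the derivation along the bracket;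
    expanding both sides by [metric] leaves only curvature terms. *)
Lemma cur_skew A B Z W : g (cur A B Z) W = - g (cur A B W) Z.
Proof.
have := act_br A B (g Z W); rewrite !metric !actD !metric !curE !gE.
rewrite ![g Z _]gC => /eqP; rewrite -subr_eq0 => /eqP h.
by apply/eqP; rewrite -subr_eq0 -h; apply/eqP; ring.
Qed.

(** By [splitting] a bracket is known from its [rho] component and its connection component. These
    formulas are the input of every Jacobi identity below. *)
Lemma br_bet X Y :
  br (bet X) (bet Y) = bet (D X Y - D Y X) + gam (Omega X Y).
Proof. by rewrite [LHS]splitting rho_br_bet nab_br_bet_eta. Qed.

Lemma br_bet_gam X Y :
  br (bet X) (gam Y) = bet (C Y X - Dv Y X) + gam (D X Y + Phat X Y).
Proof.
rewrite [LHS]splitting nab_br_bet_gam_eta; congr (bet _ + gam _).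
by rewrite brC linearN rho_br_gam_bet opprB.
Qed.

Lemma br_gam_bet X Y :
  br (gam X) (bet Y) = bet (Dv X Y - C X Y) + gam (- (D Y X + Phat Y X)).
Proof. by rewrite brC br_bet_gam opprD -!linearN opprB. Qed.

(** The inner bracket of a Jacobi identity is already split as [bet U + gam W]; this lemma and the
    next three compute both components of the outer bracket. *)
Lemma rho_br_betE X U W : rho (br (bet X) (bet U + gam W)) =
  D X U - D U X + (C W X - Dv W X).
Proof.
rewrite brD linearD rho_br_bet br_bet_gam linearD /= rho_bet rho_gam.
by rewrite addr0.
Qed.

Lemma K_br_betE X U W : nab (br (bet X) (bet U + gam W)) eta =
  Omega X U + (D X W + Phat X W).
Proof. by rewrite brD nabDl nab_br_bet_eta nab_br_bet_gam_eta. Qed.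

Lemma rho_br_gamE X U W : rho (br (gam X) (bet U + gam W)) = Dv X U - C X U.
Proof.
by rewrite brD br_gam linearD /= rho_gam addr0 rho_br_gam_bet.
Qed.

Lemma K_br_gamE X U W : nab (br (gam X) (bet U + gam W)) eta =
  - (D U X + Phat U X) + (Dv X W - Dv W X).
Proof.
rewrite brD nabDl br_gam nab_gam_eta; congr (_ + _).
by rewrite br_gam_bet nabDl nab_bet_eta nab_gam_eta add0r.
Qed.

(** The horizontal covariant derivative of the lowered Cartan torsion, [(D_X C)(Y, Z, W)]. *)
Definition dC X Y Z W := act (bet X) (g (C Y Z) W) - g (C (D X Y) Z) W
  - g (C Y (D X Z)) W - g (C Y Z) (D X W).

Local Notation c X Y Z := (g (C X Y) Z).

Lemma dCE X Y Z W : g (D X (C Y Z)) W =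
  dC X Y Z W + c (D X Y) Z W + c Y (D X Z) W.
Proof. by rewrite /dC metric; ring. Qed.

Lemma dC_sym1 X Y Z W : dC X Y Z W = dC X Z Y W.
Proof.
rewrite /dC (cartanC Z Y) (cartanC Z (D X Y)) (cartanC (D X Z) Y); ring.
Qed.

Lemma dC_sym2 X Y Z W : dC X Y Z W = dC X Y W Z.
Proof.
rewrite /dC (cartan_sym Y W Z) (cartan_sym (D X Y) W Z).
rewrite (cartan_sym Y (D X W) Z) (cartan_sym Y W (D X Z)); ring.
Qed.

Lemma c_eta X Y :
  (c X Y eta = 0) * (c X eta Y = 0) * (c eta X Y = 0).
Proof.
by rewrite (cartanC eta) !cartan_eta (cartan_sym _ Y) cartan_eta !g0l.
Qed.

Lemma dC_eta X Y Z :
  (dC X Y Z eta = 0) * (dC X Y eta Z = 0) * (dC X eta Y Z = 0).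
Proof.
suff h : dC X Y Z eta = 0 by rewrite (dC_sym1 X eta) (dC_sym2 X Y eta) h.
by rewrite /dC !c_eta nab_bet_eta g0r act0; ring.
Qed.

(** The horizontal component of the Jacobi identity for [bet X], [gam Y], [bet Z]: the second
    derivatives assemble into hv-curvatures. *)
Lemma bianchi_hv X Y Z :
  cur (bet X) (gam Y) Z - cur (bet Z) (gam Y) X =
  C (Phat X Y) Z - (D X (C Y Z) - C Y (D X Z) - C (D X Y) Z) -
  (C (Phat Z Y) X - (D Z (C Y X) - C Y (D Z X) - C (D Z Y) X)).
Proof.
have := congr1 rho (jacobi (bet X) (gam Y) (bet Z)).
rewrite br_gam_bet br_bet_gam br_bet !(raddfD rho) /= !rho_br_betE rho_br_gamE.
rewrite linear0 => J; apply: g_inj => W.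
move/(congr1 (g^~ W)): J; rewrite !curE !br_bet_gam.
rewrite !(nabE, cartanE, gE) /= => J.
apply/eqP; rewrite -subr_eq0 -oppr_eq0 -J; apply/eqP; ring.
Qed.

Definition hvC X Y Z W :=
  dC Z Y X W - dC W Y X Z - c (Phat Z Y) X W + c (Phat W Y) X Z.

(** As in the Koszul formula, two exchange rules determine the tensor: [bianchi_hv] exchanges [X]
    and [Z] up to known terms, [skew] exchanges [Z] and [W] up to sign. Applying them alternately,
    three times each, leads from [p X Y Z W] to its opposite, so its double is known. *)
Lemma g_hv X Y Z W : g (cur (bet X) (gam Y) Z) W = hvC X Y Z W.
Proof.
pose p X Y Z W := g (cur (bet X) (gam Y) Z) W.
have skew A B A' B' : p A B A' B' = - p A B B' A' by exact: cur_skew.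
have pB A B A' B' : p A B A' B' = p A' B A B' +
    (- dC A B A' B' + dC A' B A B' + c (Phat A B) A' B' - c (Phat A' B) A B').
  have := congr1 (g^~ B') (bianchi_hv A B A').
  rewrite !(gE, dCE) -/(p A B A' B') -/(p A' B A B') => /eqP.
  rewrite -subr_eq0 => /eqP J; apply/eqP; rewrite -subr_eq0 -J; apply/eqP.
  ring.
suff h : p X Y Z W + p X Y Z W = hvC X Y Z W + hvC X Y Z W.
  apply/eqP; rewrite -subr_eq0; apply/eqP/add_eq0.
  by rewrite addrACA h -opprD subrr.
rewrite {1}(pB X Y Z W) (skew Z Y X W) (pB Z Y W X) (skew W Y Z X).
rewrite (pB W Y X Z) (skew X Y W Z) /hvC (dC_sym2 X Y W Z) (dC_sym2 Z Y W X).
rewrite (dC_sym2 W Y Z X) !(cartan_sym _ W Z) (cartan_sym _ W X).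
rewrite (cartan_sym _ Z X); ring.
Qed.

Lemma Phat_cur X Y : Phat X Y = cur (bet X) (gam Y) eta.
Proof.
by rewrite curE nab_bet_eta nab_gam_eta nab0 addr0 nab_br_bet_gam_eta addKr.
Qed.

(** Every term of [hvC eta Y eta W] has [eta] in one of the last three slots of [dC] or in a slot of
    the lowered [C]. *)
Lemma Phat_etal Y : Phat eta Y = 0.
Proof.
apply: g_inj => W; rewrite Phat_cur g_hv /hvC !dC_eta !c_eta g0l; ring.
Qed.

(** [P(X, Y) eta] is the derivative of the Cartan torsion along the horizontal lift of [eta]. Total
    symmetry and tensoriality of [Phat] are inherited from [dC]. *)
Lemma g_Phat X Y W : g (Phat X Y) W = dC eta X Y W.
Proof.
rewrite Phat_cur g_hv /hvC Phat_etal !dC_eta !c_eta (dC_sym1 eta Y X).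
rewrite -(scale0r 0) cartanZl scale0r g0l; ring.
Qed.

Lemma PhatC X Y : Phat X Y = Phat Y X.
Proof. by apply: g_inj => W; rewrite !g_Phat dC_sym1. Qed.
Lemma Phat_sym X Y Z : g (Phat X Y) Z = g (Phat X Z) Y.
Proof. by rewrite !g_Phat dC_sym2. Qed.
Lemma PhatDr X Y Z : Phat X (Y + Z) = Phat X Y + Phat X Z.
Proof.
apply: g_inj => W; rewrite gDl !g_Phat /dC !(nabE, cartanE, gE, actE); ring.
Qed.
Lemma PhatDl X Y Z : Phat (Y + Z) X = Phat Y X + Phat Z X.
Proof. by rewrite PhatC PhatDr !(PhatC X). Qed.
Lemma PhatZr f X Y : Phat X (f *: Y) = f *: Phat X Y.
Proof.
apply: g_inj => W.
by rewrite gZl !g_Phat /dC !(nabE, nabZ, cartanE, gE, actE); ring.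
Qed.
Lemma Phat0l X : Phat 0 X = 0.
Proof. by rewrite PhatC -(scale0r 0) PhatZr !scale0r. Qed.
Lemma PhatNr X Y : Phat X (- Y) = - Phat X Y.
Proof. by rewrite -scaleN1r PhatZr scaleN1r. Qed.
Lemma PhatNl X Y : Phat (- Y) X = - Phat Y X.
Proof. by rewrite PhatC PhatNr PhatC. Qed.
Definition PhatE := (PhatDr, PhatDl, PhatZr, PhatNr, PhatNl).

(** The vertical component, read off by applying the connection to [eta], of the Jacobi identity for
    three horizontal lifts. *)
Lemma bianchi_hh X Y Z :
  Omega X (D Y Z - D Z Y) + (D X (Omega Y Z) + Phat X (Omega Y Z)) +
  (Omega Y (D Z X - D X Z) + (D Y (Omega Z X) + Phat Y (Omega Z X))) +
  (Omega Z (D X Y - D Y X) + (D Z (Omega X Y) + Phat Z (Omega X Y))) = 0.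
Proof.
have := congr1 (nab^~ eta) (jacobi (bet X) (bet Y) (bet Z)).
by rewrite !br_bet !nabDl !K_br_betE nab0l.
Qed.

(** The vertical component for one vertical and two horizontal lifts; it contains the vertical
    derivative of [Omega]. *)
Lemma bianchi_vhh X Y Z :
  - (D (D X Y - D Y X) Z + Phat (D X Y - D Y X) Z) +
    (Dv Z (Omega X Y) - Dv (Omega X Y) Z) +
  (Omega X (C Z Y - Dv Z Y) +
    (D X (D Y Z + Phat Y Z) + Phat X (D Y Z + Phat Y Z))) +
  (Omega Y (Dv Z X - C Z X) +
    (D Y (- (D X Z + Phat X Z)) + Phat Y (- (D X Z + Phat X Z)))) = 0.
Proof.
have := congr1 (nab^~ eta) (jacobi (gam Z) (bet X) (bet Y)).
by rewrite br_bet br_bet_gam br_gam_bet !nabDl !K_br_betE K_br_gamE nab0l.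
Qed.

(** The horizontal component for two vertical lifts and a horizontal one. *)
Lemma bianchi_vvh X Y Z :
  Dv X (Dv Y Z - C Y Z) - C X (Dv Y Z - C Y Z) +
  (Dv Y (C X Z - Dv X Z) - C Y (C X Z - Dv X Z)) +
  (C (Dv X Y - Dv Y X) Z - Dv (Dv X Y - Dv Y X) Z) = 0.
Proof.
have := congr1 rho (jacobi (gam X) (gam Y) (bet Z)).
rewrite br_gam br_gam_bet br_bet_gam br_bet_gam !(raddfD rho) /=.
by rewrite !rho_br_gamE rho_bet rho_gam addr0 linear0.
Qed.

(** [bianchi_vvh] gives [S] as a commutator of [C] plus vertical derivatives [dv] of [C]. The latter
    are symmetric in [Z] and [W] while [S] is skew, so they drop out of the difference of the two
    formulas, which is twice [S]. *)
Lemma g_v X Y Z W : g (cur (gam X) (gam Y) Z) W =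
  g (C Y Z) (C X W) - g (C X Z) (C Y W).
Proof.
have cc A B Z' W' : g (C A (C B Z')) W' = g (C B Z') (C A W').
  by rewrite cartan_sym gC.
pose dv X Y Z W := g (Dv X (C Y Z)) W - c (Dv X Y) Z W - c Y (Dv X Z) W.
have dvC A B A' B' : dv A B A' B' = dv A B B' A'.
  have := congr1 (act (gam A)) (cartan_sym B A' B').
  rewrite !metric /dv (cartan_sym _ A' B') (cartan_sym B (Dv A A') B').
  rewrite (cartan_sym B (Dv A B') A') => /eqP; rewrite -subr_eq0 => /eqP J.
  by apply/eqP; rewrite -subr_eq0 -J; apply/eqP; ring.
have E Z' W' : g (cur (gam X) (gam Y) Z') W' =
   g (C X (C Y Z')) W' - g (C Y (C X Z')) W' + dv Y X Z' W' - dv X Y Z' W'.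
  have := congr1 (g^~ W') (bianchi_vvh X Y Z').
  rewrite curE br_gam /dv !(nabE, cartanE, gE) => J.
  by apply/eqP; rewrite -subr_eq0 -oppr_eq0 -J; apply/eqP; ring.
suff h : g (cur (gam X) (gam Y) Z) W + g (cur (gam X) (gam Y) Z) W =
   (g (C Y Z) (C X W) - g (C X Z) (C Y W)) +
   (g (C Y Z) (C X W) - g (C X Z) (C Y W)).
  apply/eqP; rewrite -subr_eq0; apply/eqP/add_eq0.
  by rewrite addrACA h -opprD subrr.
rewrite {1}E cur_skew E (dvC _ _ W) (dvC X _ W).
rewrite !cc (gC (C Y W)) (gC (C X W)); ring.
Qed.

(** * Consequences of the prescribed h-curvature *)

Section HCurvature.
Variables (kap mu e : F).
Local Notation y X := (g eta X).
(** With [e] the inverse of [g eta eta], which is [L^2], this is the angular metric [hbar]. *)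
Definition angular X Y := g X Y - e * y X * y Y.
Local Notation h := angular.
Hypothesis eE : e * g eta eta = 1.
Hypothesis hcur : forall X Y Z W, g (cur (bet X) (bet Y) Z) W =
  kap * (g X Z * g Y W - g Y Z * g X W) +
  mu * (h X Z * h Y W - h Y Z * h X W).

Lemma angular_eta X : h X eta = 0.
Proof.
rewrite /h (gC X); transitivity ((1 - e * g eta eta) * y X); first by ring.
by rewrite eE subrr mul0r.
Qed.

Lemma OmegaE X Y : Omega X Y = (kap * y X) *: Y - (kap * y Y) *: X.
Proof.
have -> : Omega X Y = cur (bet X) (bet Y) eta.
  by rewrite curE !nab_bet_eta !nab0 oppr0 !add0r nab_br_bet_eta.
apply: g_inj => W; rewrite hcur !angular_eta !gE (gC X eta) (gC Y eta); ring.
Qed.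

Lemma y_bet X Y : act (bet X) (y Y) = y (D X Y).
Proof. by rewrite metric nab_bet_eta g0l add0r. Qed.

Lemma y_gam X Y : act (gam X) (y Y) = g X Y + y (Dv X Y).
Proof. by rewrite metric nab_gam_eta. Qed.

(** Once [OmegaE] is inserted in [bianchi_hh], derivatives of the fields cancel, and so do the
    [Phat] terms because [Phat] is symmetric; only derivatives of [kap] survive. *)
Lemma cyclic_bet X Y Z W :
  act (bet X) kap * (y Y * g Z W - y Z * g Y W) +
  act (bet Y) kap * (y Z * g X W - y X * g Z W) +
  act (bet Z) kap * (y X * g Y W - y Y * g X W) = 0.
Proof.
have := congr1 (g^~ W) (bianchi_hh X Y Z).
rewrite !OmegaE !(nabE, nabZ, PhatE, gE, actE) !y_bet => J.
rewrite -J (PhatC Y X) (PhatC Z X) (PhatC Z Y); ring.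
Qed.

Definition dPhat X Y Z W := act (bet X) (g (Phat Y Z) W)
  - g (Phat (D X Y) Z) W - g (Phat Y (D X Z)) W - g (Phat Y Z) (D X W).

Lemma dPhat_sym1 X Y Z W : dPhat X Y Z W = dPhat X Z Y W.
Proof.
by rewrite /dPhat (PhatC Y Z) (PhatC (D X Y)) (PhatC Y (D X Z)); ring.
Qed.

Lemma dPhat_sym2 X Y Z W : dPhat X Y Z W = dPhat X Y W Z.
Proof.
rewrite /dPhat (Phat_sym Y W Z) (Phat_sym (D X Y) W Z).
by rewrite (Phat_sym Y (D X W) Z) (Phat_sym Y W (D X Z)); ring.
Qed.

(** A second expression of [R], obtained from [bianchi_vhh]: [R(X, Y) Z] is the vertical derivative
    of [R(X, Y) eta] in the direction [Z], corrected by terms in [C] and [Phat]. *)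
Lemma hcur_gam X Y Z W : g (cur (bet X) (bet Y) Z) W =
  act (gam Z) kap * (y X * g Y W - y Y * g X W) +
  kap * (g Z X * g Y W - g Z Y * g X W + y X * c Z Y W - y Y * c Z X W) +
  dPhat X Y Z W - dPhat Y X Z W +
  (g (Phat Y Z) (Phat X W) - g (Phat X Z) (Phat Y W)).
Proof.
have pp A B Z' W' : g (Phat A (Phat B Z')) W' = g (Phat B Z') (Phat A W').
  by rewrite Phat_sym gC.
have := congr1 (g^~ W) (bianchi_vhh X Y Z).
rewrite curE br_bet /dPhat !metric !OmegaE.
rewrite !(nabE, nabZ, nabZl, gamZ, PhatE, gE, actE) !y_gam !pp => J.
apply/eqP; rewrite -subr_eq0 -oppr_eq0 -J; apply/eqP.
rewrite (gC Z X) !(gC eta (C _ _)) !c_eta; ring.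
Qed.

Lemma angularC X Y : h X Y = h Y X.
Proof. by rewrite /h gC; ring. Qed.

Lemma cyclic_gam X Y Z W :
  act (gam X) kap * (y Y * g Z W - y Z * g Y W) +
  act (gam Y) kap * (y Z * g X W - y X * g Z W) +
  act (gam Z) kap * (y X * g Y W - y Y * g X W) = 0.
Proof.
pose q A B C := g (cur (bet A) (bet B) C) W.
have : q X Y Z + q Y Z X + q Z X Y - (q X Y Z + q Y Z X + q Z X Y) = 0.
  exact: subrr.
rewrite {1 2 3}/q !hcur_gam /q !hcur (gC Y X) (gC Z X) (gC Z Y).
rewrite (angularC Y X) (angularC Z X) (angularC Z Y).
rewrite (dPhat_sym1 _ Y X) (dPhat_sym1 _ Z X) (dPhat_sym1 _ Z Y).
rewrite (cartanC Y X) (cartanC Z X) (cartanC Z Y).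
by rewrite (PhatC Y X) (PhatC Z X) (PhatC Z Y) => <-; ring.
Qed.

Hypothesis dkap : forall A, act A kap = 0.
Hypothesis dmu : forall A, act A mu = 0.
Hypothesis kap_reg : forall f, kap * f = 0 -> f = 0.

Let E := g eta eta.
(** Lowered commutators of the self-adjoint endomorphisms [C X] and [Phat X]: [pp] is
    [[Phat X, Phat Y]], [cc] is [[C X, C Y]] and [cp] is [[Phat X, C Y] + [C X, Phat Y]]. *)
Let pp X Y Z W := g (Phat Y Z) (Phat X W) - g (Phat X Z) (Phat Y W).
Let cp X Y Z W := g (C Y Z) (Phat X W) + g (Phat Y Z) (C X W)
  - (g (C X Z) (Phat Y W) + g (Phat X Z) (C Y W)).
Let cc X Y Z W := g (C Y Z) (C X W) - g (C X Z) (C Y W).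
Let hh X Y Z W := h X Z * h Y W - h Y Z * h X W.

(* For constant [kap], [hcur] and [hcur_gam] together equate an expression that is
   skew in [Z, W] to one that is symmetric, so both vanish. *)
Lemma hcur_split X Y Z W :
  (mu * hh X Y Z W = pp X Y Z W) *
  (kap * (y X * c Y Z W - y Y * c X Z W) + dPhat X Y Z W - dPhat Y X Z W = 0).
Proof.
pose a Z W := mu * hh X Y Z W - pp X Y Z W.
pose b Z W := kap * (y X * c Y Z W - y Y * c X Z W)
  + dPhat X Y Z W - dPhat Y X Z W.
have ab Z' W' : a Z' W' = b Z' W'.
  have := hcur_gam X Y Z' W'; rewrite hcur dkap (cartanC Z' X) (cartanC Z' Y).
  rewrite (gC Z' X) (gC Z' Y) => /eqP; rewrite -subr_eq0 => /eqP J.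
  apply/eqP; rewrite -subr_eq0 -J /a /b /pp /hh; apply/eqP; ring.
have aN : a W Z = - a Z W.
  rewrite /a /hh /pp (gC (Phat Y W)) (gC (Phat X W)); ring.
have bS : b W Z = b Z W.
  rewrite /b (cartan_sym Y W) (cartan_sym X W).
  by rewrite (dPhat_sym2 X Y W) (dPhat_sym2 Y X W).
have b0 : b Z W = 0 by apply: add_eq0; rewrite -{1}bS -ab aN ab addNr.
by split; last exact: b0; apply/eqP; rewrite -subr_eq0; apply/eqP; rewrite -b0 -ab.
Qed.

(** The second identity of [hcur_split] at [X = eta], where [C] and [Phat] vanish and [y eta = E].
    Together with [nab_bet_C] it closes the system satisfied by [C] and [Phat] along [bet eta]. *)
Lemma nab_bet_Phat X Y : D eta (Phat X Y) =
  Phat (D eta X) Y + Phat X (D eta Y) - (kap * E) *: C X Y.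
Proof.
have dP W : dPhat eta X Y W = - (kap * E) * c X Y W.
  have [_] := hcur_split eta X Y W.
  have -> : dPhat X eta Y W = 0.
    by rewrite /dPhat nab_bet_eta !Phat_etal Phat0l !g0l act0; ring.
  rewrite c_eta -/E => /eqP; rewrite -subr_eq0 => /eqP J.
  by apply/eqP; rewrite -subr_eq0 -J; apply/eqP; ring.
apply: g_inj => W; have := dP W; rewrite /dPhat metric !gE => /eqP.
rewrite -subr_eq0 => /eqP J.
by apply/eqP; rewrite -subr_eq0 -J; apply/eqP; ring.
Qed.

Lemma nab_bet_C X Y : D eta (C X Y) =
  C (D eta X) Y + C X (D eta Y) + Phat X Y.
Proof. by apply: g_inj => W; rewrite dCE !gE g_Phat; ring. Qed.

Lemma act_bet_angular X Y :
  act (bet eta) (h X Y) = h (D eta X) Y + h X (D eta Y).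
Proof.
have dE : act (bet eta) E = 0 by rewrite metric nab_bet_eta g0l g0r addr0.
(* Differentiating [e * E = 1] gives [act (bet eta) e * E = 0]; a further factor [e] removes [E]. *)
have de : act (bet eta) e = 0.
  have := congr1 ( *%R e) (congr1 (act (bet eta)) eE).
  by rewrite actM dE act1 !mulr0 addr0 mulrCA eE mulr1.
by rewrite /h !actE de !y_bet metric; ring.
Qed.

(* The derivative of the first identity of [hcur_split] along [bet eta]: it turns
   [Phat] into [- kap E C] by [nab_bet_Phat].  One more derivative gives
   [v_curvature_eq]. *)
Lemma cp_eq0 X Y Z W : cp X Y Z W = 0.
Proof.
have := congr1 (act (bet eta)) (hcur_split X Y Z W).1.
rewrite actM dmu mul0r add0r /hh actD actN !actM !act_bet_angular.
rewrite /pp actD actN !metric !nab_bet_Phat !gE.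
(* These four instances absorb the terms in which the derivative falls on an argument. *)
have := (hcur_split (D eta X) Y Z W).1.
have := (hcur_split X (D eta Y) Z W).1.
have := (hcur_split X Y (D eta Z) W).1.
have := (hcur_split X Y Z (D eta W)).1.
rewrite /pp /hh => /eqP; rewrite -subr_eq0 => /eqP J1.
move=> /eqP; rewrite -subr_eq0 => /eqP J2.
move=> /eqP; rewrite -subr_eq0 => /eqP J3.
move=> /eqP; rewrite -subr_eq0 => /eqP J4.
move=> /eqP; rewrite -subr_eq0 => /eqP J.
have {}J : (kap * E) * cp X Y Z W = 0.
  transitivity (0 - (0 + 0 + 0 + 0) : F); last by rewrite !addr0 subr0.
  by rewrite -{1}J -{1}J1 -{1}J2 -{1}J3 -J4 /cp; ring.
rewrite -[cp _ _ _ _]mul1r -eE -mulrA.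
by rewrite (kap_reg (f := E * cp X Y Z W)) ?mulr0 // mulrA.
Qed.

(** The derivative of [cp] along [bet eta] is [2 (pp - kap E cc)] up to values of [cp], and [cc] is
    the v-curvature by [g_v]. *)
Lemma v_curvature_eq X Y Z W :
  kap * E * g (cur (gam X) (gam Y) Z) W = mu * hh X Y Z W.
Proof.
rewrite g_v (hcur_split X Y Z W).1 -/(cc X Y Z W).
have := congr1 (act (bet eta)) (cp_eq0 X Y Z W).
rewrite /cp !actE !metric !nab_bet_Phat !nab_bet_C !gE.
have := cp_eq0 (D eta X) Y Z W; have := cp_eq0 X (D eta Y) Z W.
have := cp_eq0 X Y (D eta Z) W; have := cp_eq0 X Y Z (D eta W).
rewrite /cp => J1 J2 J3 J4 J; apply/eqP; rewrite -subr_eq0; apply/eqP.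
apply: add_eq0; transitivity (- 0 + (0 + 0 + 0 + 0) : F).
  by rewrite -{1}J -{1}J1 -{1}J2 -{1}J3 -J4 /cc /pp; ring.
by rewrite !addr0 oppr0.
Qed.

(** In [hvC] the [dC] terms are symmetric in [X] and [Y]; the difference of the remaining ones is
    [cp] up to sign. *)
Lemma hv_curvature_sym X Y Z :
  cur (bet X) (gam Y) Z = cur (bet Y) (gam X) Z.
Proof.
apply: g_inj => W; rewrite !g_hv /hvC (dC_sym1 Z Y X) (dC_sym1 W Y X).
have := cp_eq0 X Y Z W; rewrite /cp => J.
have cP A B Z' W' : c (Phat Z' A) B W' = g (Phat A Z') (C B W').
  by rewrite cartanC cartan_sym gC PhatC.
rewrite !cP; apply/eqP; rewrite -subr_eq0 -oppr_eq0 -J; apply/eqP.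
rewrite (gC (Phat Y W)) (gC (Phat X W)); ring.
Qed.

End HCurvature.
End CartanAlgebra.

(** * The metric as fibre Hessian of the energy, and the resulting symmetries of the torsion *)

Section Energy.
Variables (F : comPzRingType) (V T : lmodType F).
Variables (act : T -> F -> F) (nab : T -> V -> V) (br : T -> T -> T).
Variables (rho : {linear T -> V}) (gam bet : {linear V -> T}).
Variables (g : V -> V -> F) (eta : V) (f : F).
Hypothesis add_eq0 : forall a : F, a + a = 0 -> a = 0.
Hypothesis act_linear : forall h a A B, act (a *: A + B) h = a * act A h + act B h.
Hypothesis actD : forall A p h, act A (p + h) = act A p + act A h.
Hypothesis actM : forall A p h, act A (p * h) = act A p * h + p * act A h.
Hypothesis act_br : forall A B p,
  act (br A B) p = act A (act B p) - act B (act A p).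
Hypothesis brC : forall A B, br A B = - br B A.
Hypothesis brD : forall A B A', br A (B + A') = br A B + br A A'.
Hypothesis brZ : forall A p B, br A (p *: B) = act A p *: B + p *: br A B.
Hypothesis jacobi : forall A B C,
  br A (br B C) + br B (br C A) + br C (br A B) = 0.
Hypothesis nab_linear : forall X a A B, nab (a *: A + B) X = a *: nab A X + nab B X.
Hypothesis rho_bet : forall X, rho (bet X) = X.
Hypothesis nab_bet_eta : forall X, nab (bet X) eta = 0.
Hypothesis rho_gam : forall X, rho (gam X) = 0.
Hypothesis rho_eq0 : forall A, rho A = 0 -> exists X, A = gam X.
Hypothesis g_def : forall X, g X X = 0 -> X = 0.
Hypothesis metric : forall A X Y, act A (g X Y) = g (nab A X) Y + g X (nab A Y).

Local Notation D X := (nab (bet X)).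
Local Notation Dv X := (nab (gam X)).

(* The flat connection of the fibres, in the direction [gam X]. *)
Variable d : V -> V -> V.
Hypothesis fibreE : forall X Y, rho (br (gam X) (bet Y)) = d X Y.

Hypothesis br_gam : forall X Y, br (gam X) (gam Y) = gam (d X Y - d Y X).
Hypothesis fibre_eta : forall X, d X eta = X.
(** Twice [g], because the metric is half the Hessian of [f = L^2]; the last term removes the
    derivatives of [Y]. *)
Hypothesis g_energy : forall X Y,
  g X Y + g X Y = act (gam X) (act (gam Y) f) - act (gam (d X Y)) f.
Hypothesis euler : act (gam eta) f = f + f.
Hypothesis torsion_sym : forall X Y Z,
  g (Dv X Y - d X Y) Z = g (Dv X Z - d X Z) Y.

Lemma add_inj (a b : F) : a + a = b + b -> a = b.
Proof.
move=> E; apply/eqP; rewrite -subr_eq0; apply/eqP/add_eq0.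
by rewrite addrACA E -opprD subrr.
Qed.

Lemma eact_Dl h A B : act (A + B) h = act A h + act B h.
Proof. by rewrite -[A]scale1r act_linear mul1r scale1r. Qed.
Lemma eact_0l h : act 0 h = 0.
Proof. by apply: (@addrI _ (act 0 h)); rewrite -eact_Dl !addr0. Qed.
Lemma eact_Zl h a A : act (a *: A) h = a * act A h.
Proof. by rewrite -[_ *: A]addr0 act_linear eact_0l addr0. Qed.
Lemma eact_Nl h A : act (- A) h = - act A h.
Proof. by rewrite -scaleN1r eact_Zl mulN1r. Qed.
Lemma eact_0 A : act A 0 = 0.
Proof. by apply: (@addrI _ (act A 0)); rewrite -actD !addr0. Qed.
Lemma eact_N A h : act A (- h) = - act A h.
Proof. by apply/eqP; rewrite -addr_eq0 -actD addNr eact_0. Qed.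
Lemma enab_Dl X A B : nab (A + B) X = nab A X + nab B X.
Proof. by rewrite -[A]scale1r nab_linear !scale1r. Qed.

Lemma egam_lin a X Y : gam (a *: X + Y) = a *: gam X + gam Y.
Proof. exact: linearP. Qed.

(** In the bracket the derivative of [a] multiplies a vertical field, which [rho] kills. *)
Lemma fibre_linear a X Y Z : d (a *: X + Y) Z = a *: d X Z + d Y Z.
Proof.
rewrite -!fibreE egam_lin !(brC _ (bet Z)) brD brZ !linearN !linearD !linearZ /=.
by rewrite rho_gam oppr0 scaler0 add0r scalerN.
Qed.

(** A Hessian is symmetric when its connection is torsion-free, which is [br_gam] for [d]. *)
Lemma g_sym X Y : g X Y = g Y X.
Proof.
apply: add_inj; rewrite !g_energy.
have E : gam (d X Y) - gam (d Y X) = br (gam X) (gam Y).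
  by rewrite br_gam linearB.
have := congr1 (act^~ f) E; rewrite eact_Dl eact_Nl act_br => J.
apply/eqP; rewrite -subr_eq0; apply/eqP.
transitivity (act (gam X) (act (gam Y) f) - act (gam Y) (act (gam X) f) -
  (act (gam (d X Y)) f - act (gam (d Y X)) f)); first by ring.
by rewrite J subrr.
Qed.

Lemma g_lin Z a X Y : g (a *: X + Y) Z = a * g X Z + g Y Z.
Proof.
apply: add_inj; rewrite g_energy egam_lin fibre_linear egam_lin !act_linear.
transitivity (a * (g X Z + g X Z) + (g Y Z + g Y Z)); last by ring.
by rewrite !g_energy; ring.
Qed.

Lemma br_0 A : br A 0 = 0.
Proof. by apply: (@addrI _ (br A 0)); rewrite -brD !addr0. Qed.
Lemma br_N A B : br A (- B) = - br A B.
Proof. by apply/eqP; rewrite -addr_eq0 -brD addNr br_0. Qed.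
Lemma rho_br_gam X Y W : rho (br (gam X) (bet Y + gam W)) = d X Y.
Proof. by rewrite brD br_gam linearD /= rho_gam addr0 fibreE. Qed.

(** The [rho] component of the Jacobi identity for [gam X], [gam Y], [bet Z]. The vertical
    remainders [W1] and [W2] need no description: their brackets with vertical fields stay
    vertical. *)
Lemma fibre_flat X Y Z : d X (d Y Z) - d Y (d X Z) = d (d X Y - d Y X) Z.
Proof.
have dE A B : exists W, br (gam A) (bet B) = bet (d A B) + gam W.
  have [|W E] := @rho_eq0 (br (gam A) (bet B) - bet (d A B)).
    by rewrite linearB /= rho_bet fibreE subrr.
  by exists W; rewrite -E addrC subrK.
have [W1 E1] := dE Y Z; have [W2 E2] := dE X Z.
have := congr1 rho (jacobi (gam X) (gam Y) (bet Z)).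
rewrite (brC (bet Z) (gam X)) E1 E2 br_gam (brC (bet Z)) br_N.
rewrite !(raddfD rho) !(raddfN rho) /= !rho_br_gam linear0 fibreE.
by move=> /eqP; rewrite subr_eq0 => /eqP.
Qed.

Local Notation C X Y := (Dv X Y - d X Y).
Local Notation t X Y Z :=
  (act (gam X) (g Y Z) - g (d X Y) Z - g Y (d X Z)).

Lemma gD_l X Y Z : g (X + Y) Z = g X Z + g Y Z.
Proof. by rewrite -[X]scale1r g_lin mul1r scale1r. Qed.
Lemma g_0l X : g 0 X = 0.
Proof. by apply: (@addrI _ (g 0 X)); rewrite -gD_l !addr0. Qed.
Lemma gN_l X Y : g (- X) Y = - g X Y.
Proof. by apply/eqP; rewrite -addr_eq0 -gD_l addNr g_0l. Qed.

(** By [metric], [t X Y Z] is [g (C X Y) Z + g Y (C X Z)], and [torsion_sym] makes the two summands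
    equal. *)
Lemma cartan_third X Y Z : g (C X Y) Z + g (C X Y) Z = t X Y Z.
Proof.
rewrite {2}torsion_sym metric (g_sym Y (Dv X Z)) (g_sym Y (d X Z)).
by rewrite !gD_l !gN_l; ring.
Qed.

(* Third derivatives of the energy commute. *)
Lemma third_sym X Y Z : t X Y Z = t Y X Z.
Proof.
apply: add_inj.
have E A B C' : t A B C' + t A B C' =
    act (gam A) (act (gam B) (act (gam C') f)) - act (gam A) (act (gam (d B C')) f)
    - (act (gam (d A B)) (act (gam C') f) - act (gam (d (d A B) C')) f)
    - (act (gam B) (act (gam (d A C')) f) - act (gam (d B (d A C'))) f).
  rewrite -!g_energy; transitivity (act (gam A) (g B C' + g B C') -
    (g (d A B) C' + g (d A B) C') - (g B (d A C') + g B (d A C'))).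
    by rewrite actD; ring.
  by rewrite (g_energy B C') actD eact_N.
rewrite !E.
have J1 h : act (gam (d X Y)) h - act (gam (d Y X)) h =
    act (gam X) (act (gam Y) h) - act (gam Y) (act (gam X) h).
  by rewrite -act_br br_gam linearB /= eact_Dl eact_Nl.
have J2 : act (gam (d X (d Y Z))) f - act (gam (d Y (d X Z))) f =
    act (gam (d (d X Y) Z)) f - act (gam (d (d Y X) Z)) f.
  have := congr1 (fun A => act (gam A) f) (fibre_flat X Y Z).
  have -> : d (d X Y - d Y X) Z = d (d X Y) Z - d (d Y X) Z.
    by rewrite addrC -scaleN1r fibre_linear scaleN1r addrC.
  by rewrite !linearB /= !eact_Dl !eact_Nl.
have := J1 (act (gam Z) f) => /eqP; rewrite -subr_eq0 => /eqP K1.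
move: J2 => /eqP; rewrite -subr_eq0 => /eqP K2.
apply/eqP; rewrite -subr_eq0; apply/eqP; transitivity (- (0 + 0) : F).
  by rewrite -{1}K1 -K2; ring.
by rewrite addr0 oppr0.
Qed.

Lemma g_ext X Y : (forall W, g X W = g Y W) -> X = Y.
Proof.
move=> h; apply/eqP; rewrite -subr_eq0; apply/eqP/g_def.
by rewrite gD_l gN_l h subrr.
Qed.

Lemma torsionC X Y : C X Y = C Y X.
Proof. by apply: g_ext => W; apply: add_inj; rewrite !cartan_third third_sym. Qed.

Lemma act_radial X : act (gam X) f = g X eta + g X eta.
Proof.
rewrite g_energy euler actD fibre_eta; ring.
Qed.

(** Differentiating [act_radial] along [gam X], with [d X eta = X], shows that [t X W eta] vanishes.
    One halving is due to [cartan_third], the other to the factor 2 in [act_radial]. *)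
Lemma torsion_eta X : C X eta = 0.
Proof.
apply: g_ext => W; rewrite torsion_sym g_0l; apply: add_inj.
rewrite cartan_third addr0 fibre_eta; apply: add_inj; rewrite addr0.
have := congr1 (act (gam X)) (act_radial W); rewrite actD => h1.
transitivity (act (gam X) (g W eta) + act (gam X) (g W eta)
  - (g (d X W) eta + g (d X W) eta) - (g X W + g X W)).
  by rewrite (g_sym W X); ring.
rewrite -h1 -act_radial g_energy; ring.
Qed.

(** The connection map inverts [gam], as for the flat fibre connection; this makes the splitting
    into horizontal and vertical parts explicit. *)
Lemma nab_gam_radial X : Dv X eta = X.
Proof.
by have := torsion_eta X; rewrite fibre_eta => /eqP; rewrite subr_eq0 => /eqP.
Qed.

Lemma horizontal_vertical A : A = bet (rho A) + gam (nab A eta).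
Proof.
have [|W E] := @rho_eq0 (A - bet (rho A)); first by rewrite linearB /= rho_bet subrr.
have AE : A = bet (rho A) + gam W by rewrite -E addrC subrK.
by rewrite {3}AE enab_Dl nab_bet_eta add0r nab_gam_radial.
Qed.

Lemma br_gam_nab X Y : br (gam X) (gam Y) = gam (Dv X Y - Dv Y X).
Proof.
rewrite br_gam; congr (gam _).
have := torsionC X Y => /eqP; rewrite subr_eq addrAC eq_sym subr_eq => /eqP E.
by apply/eqP; rewrite subr_eq addrAC -E addrAC subrr add0r.
Qed.

Lemma g_eta_eta : g eta eta = f.
Proof. by apply: add_inj; rewrite -act_radial euler. Qed.

Hypothesis nabD : forall A X Y, nab A (X + Y) = nab A X + nab A Y.
Hypothesis nabZ : forall A p X, nab A (p *: X) = act A p *: X + p *: nab A X.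
Hypothesis rho_br_bet : forall X Y, rho (br (bet X) (bet Y)) = D X Y - D Y X.
Variable cur : T -> T -> V -> V.
Hypothesis curE : forall A B Z,
  cur A B Z = - nab A (nab B Z) + nab B (nab A Z) + nab (br A B) Z.
Variables (kap mu e : F).
Hypothesis eE : e * f = 1.
Local Notation y X := (g eta X).
Local Notation h := (angular g eta e).
Hypothesis hcur : forall X Y Z W, g (cur (bet X) (bet Y) Z) W =
  kap * (g X Z * g Y W - g Y Z * g X W) +
  mu * (h X Z * h Y W - h Y Z * h X W).

(** The three tensors are defined as defects in the bracket formulas assumed by [CartanAlgebra],
    which then hold by construction. *)
Let C X Y := Dv X Y - d X Y.
Let Omega X Y := nab (br (bet X) (bet Y)) eta.
Let Phat X Y := nab (br (bet X) (gam Y)) eta - D X Y.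

Let CE X Y : rho (br (gam X) (bet Y)) = Dv X Y - C X Y.
Proof. by rewrite /C subKr fibreE. Qed.
Let PE X Y : nab (br (bet X) (gam Y)) eta = D X Y + Phat X Y.
Proof. by rewrite /Phat subrKC. Qed.
Let OE X Y : nab (br (bet X) (bet Y)) eta = Omega X Y.
Proof. by []. Qed.
Let eE' : e * g eta eta = 1.
Proof. by rewrite g_eta_eta. Qed.
Let gE := (gD_l, gN_l).
Let gZ_l a X Y : g (a *: X) Y = a * g X Y.
Proof. by rewrite -[_ *: X]addr0 g_lin g_0l addr0. Qed.

Local Ltac cartan := try eassumption; first
  [exact: nab_gam_radial | exact: horizontal_vertical | exact: g_lin
  |exact: g_sym | exact: br_gam_nab | exact: torsionC | exact: torsion_eta].

Lemma cyclic_vertical X Y Z :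
  act (gam X) kap *: (y Y *: Z - y Z *: Y) +
  act (gam Y) kap *: (y Z *: X - y X *: Z) +
  act (gam Z) kap *: (y X *: Y - y Y *: X) = 0.
Proof.
apply: g_ext => W; rewrite !(gE, gZ_l) g_0l.
by apply: (@cyclic_gam F V T act nab br rho gam bet g eta) X Y Z W; cartan.
Qed.

Lemma cyclic_horizontal X Y Z :
  act (bet X) kap *: (y Y *: Z - y Z *: Y) +
  act (bet Y) kap *: (y Z *: X - y X *: Z) +
  act (bet Z) kap *: (y X *: Y - y Y *: X) = 0.
Proof.
apply: g_ext => W; rewrite !(gE, gZ_l) g_0l.
by apply: (@cyclic_bet F V T act nab br rho gam bet g eta) X Y Z W; cartan.
Qed.

Hypothesis dkap : forall A, act A kap = 0.
Hypothesis dmu : forall A, act A mu = 0.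
Hypothesis kap_reg : forall p, kap * p = 0 -> p = 0.

Lemma hv_symmetric X Y Z : cur (bet X) (gam Y) Z = cur (bet Y) (gam X) Z.
Proof.
by apply: (@hv_curvature_sym F V T act nab br rho gam bet g eta) X Y Z; cartan.
Qed.

(** The field [Y - (e * y Y) *: eta] represents the form [h Y]; it is the future [phi Y], and
    pairing with [W] gives back [v_curvature_eq]. *)
Lemma v_curvature_angular X Y Z :
  (kap * f) *: cur (gam X) (gam Y) Z =
  mu *: (h X Z *: (Y - (e * y Y) *: eta) - h Y Z *: (X - (e * y X) *: eta)).
Proof.
have E : forall W, kap * g eta eta * g (cur (gam X) (gam Y) Z) W =
    mu * (h X Z * h Y W - h Y Z * h X W).
  by apply: (@v_curvature_eq F V T act nab br rho gam bet g eta) X Y Z; cartan.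
apply: g_ext => W; rewrite !(gE, gZ_l) -g_eta_eta E /angular; ring.
Qed.

End Energy.

(** * Differential calculus in finite dimension *)

Section Calculus.
Variable R : realType.
Implicit Types V W : normedModType R.

Lemma near_is_diff V W (f g : V -> W) (x : V) :
  {near x, f =1 g} -> differentiable f x -> is_diff x g ('d f x).
Proof.
move=> fg df; have [dfc E] := (diff_locallyP x f).1 df.
suff E' : g \o shift x = cst (g x) + 'd f x +o_ 0 id.
  have dE : 'd g x = 'd f x :> (V -> W) by exact: diff_unique.
  by split; [apply/diff_locallyP; rewrite dE | exact: dE].
apply/eqaddoP => _/posnumP[e].
move/eqaddoP: E => /(_ _ (gt0 e)) E.
have fg0 : \forall y \near 0, f (y + x) = g (y + x).
  have : \forall y \near x, f y = g y by exact: fg.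
  by rewrite (near_shift 0) /= subr0.
have fgx : f x = g x by exact: nbhs_singleton fg.
apply: filterS2 fg0 E => y fgy.
by rewrite !fctE /= /cst fgy fgx.
Qed.

Lemma near_diff V W (f g : V -> W) (x : V) : {near x, f =1 g} ->
  differentiable f x -> differentiable g x /\ 'd g x = 'd f x :> (V -> W).
Proof. by move=> fg df; have [] := near_is_diff fg df. Qed.

Lemma open_near V W (U : set V) (f g : V -> W) x :
  open U -> U x -> (forall y, U y -> f y = g y) -> {near x, f =1 g}.
Proof.
move=> oU Ux fg; have : nbhs x U by exact: open_nbhs_nbhs.
by apply: filterS => y /fg.
Qed.

Lemma Ck_ext V W k (U : set V) (f g : V -> W) :
  open U -> (forall y, U y -> f y = g y) -> Ck k U f -> Ck k U g.
Proof.
move=> oU; elim: k f g => [|k IH] f g fg /=.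
  move=> cf x Ux; have nfg := open_near oU Ux fg.
  have E := fg x Ux; move: (cf x Ux); rewrite /prop_for /continuous_at E.
  by apply: cvg_trans; exact: near_eq_cvg nfg.
move=> [df Cf]; split=> [x Ux|v].
  by have [] := near_diff (open_near oU Ux fg) (df x Ux).
apply: IH (Cf v) => x Ux.
by have [_ ->] := near_diff (open_near oU Ux fg) (df x Ux).
Qed.

Lemma CkS V W k (U : set V) (f : V -> W) : Ck k.+1 U f -> Ck k U f.
Proof.
elim: k f => [|k IH] f [df Cf].
  by move=> x Ux; apply: differentiable_continuous; apply: df.
by split=> // v; apply: IH.
Qed.

Lemma Ck_sub V W k (U U' : set V) (f : V -> W) : U' `<=` U -> Ck k U f -> Ck k U' f.
Proof.
move=> UU; elim: k f => [|k IH] f /=; first by move=> cf x /UU; apply: cf.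
by move=> [df Cf]; split=> [x /UU|v]; [apply: df|apply: IH].
Qed.

Lemma smooth_sub V W (U U' : set V) (f : V -> W) :
  U' `<=` U -> smooth_on U f -> smooth_on U' f.
Proof. by move=> UU sf k; apply: Ck_sub (sf k). Qed.

Lemma smooth_ext V W (U : set V) (f g : V -> W) :
  open U -> (forall y, U y -> f y = g y) -> smooth_on U f -> smooth_on U g.
Proof. by move=> oU fg sf k; apply: Ck_ext (sf k). Qed.

Lemma smooth_differentiable V W (U : set V) (f : V -> W) x :
  smooth_on U f -> U x -> differentiable f x.
Proof. by move=> /(_ 1%N) [df _]; apply: df. Qed.

Lemma smooth_d V W (U : set V) (f : V -> W) v :
  smooth_on U f -> smooth_on U (fun x => 'd f x v).
Proof. by move=> sf k; have [_] := sf k.+1; apply. Qed.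

Lemma Ck_cst V W k (U : set V) (a : W) : Ck k U (cst a : V -> W).
Proof.
elim: k a => [|k IH] a /=; first by move=> x _; apply: cst_continuous.
split=> // v; have -> : (fun x : V => 'd (cst a : V -> W) x v) = cst 0.
  by apply/funext => x; rewrite diff_cst.
exact: IH.
Qed.

Lemma CkD V W k (U : set V) (f g : V -> W) : open U ->
  Ck k U f -> Ck k U g -> Ck k U (fun x => f x + g x).
Proof.
move=> oU; elim: k f g => [|k IH] f g /=.
  by move=> cf cg x Ux; apply: continuousD; [apply: cf|apply: cg].
move=> [df Cf] [dg Cg]; split=> [x Ux|v].
  by apply: differentiableD; [apply: df|apply: dg].
apply: Ck_ext (IH _ _ (Cf v) (Cg v)) => // x Ux /=.
by rewrite [in RHS](diffD (df x Ux) (dg x Ux)).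
Qed.

Lemma is_diffS V W (c : V -> R) (f : V -> W) x :
  differentiable c x -> differentiable f x ->
  is_diff x (fun y => c y *: f y) (fun v => c x *: 'd f x v + 'd c x v *: f x).
Proof.
move=> dc df.
have bil : bilinear_for
    (GRing.Scale.Law.clone _ _ *:%R _) (GRing.Scale.Law.clone _ _ *:%R _)
    (@GRing.scale R W : R -> W -> W).
  split=> [u'|u] a y z /=; first by rewrite scalerDl scalerA.
  by rewrite scalerDr !scalerA mulrC.
pose sM := bilinear_isBilinear.Build R R W W _ _ (@GRing.scale R W) bil.
pose s : {bilinear R -> W -> W} := HB.pack (@GRing.scale R W) sM.
have sc : continuous (fun p : R * W => s p.1 p.2) by move=> p; exact: scale_continuous.
pose p y := (c y, f y).
have dp : differentiable p x by exact: differentiable_pair.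
have ds : differentiable (fun q : R * W => s q.1 q.2) (p x).
  exact: differentiable_bilin.
have -> : (fun y => c y *: f y) = (fun q : R * W => s q.1 q.2) \o p by [].
split; first exact: differentiable_comp.
by rewrite diff_comp // diff_bilin // diff_pair.
Qed.

Lemma diffS V W (c : V -> R) (f : V -> W) x v :
  differentiable c x -> differentiable f x ->
  'd (fun y => c y *: f y) x v = c x *: 'd f x v + 'd c x v *: f x.
Proof. by move=> dc df; have [_ ->] := is_diffS dc df. Qed.

Lemma CkZ V W k (U : set V) (c : V -> R) (f : V -> W) : open U ->
  Ck k U c -> Ck k U f -> Ck k U (fun x => c x *: f x).
Proof.
move=> oU; elim: k c f => [|k IH] c f.
  by move=> cc cf x Ux; apply: continuousZ; [apply: cc|apply: cf].
move=> Sc Sf; have [dc Cc] := Sc; have [df Cf] := Sf; split=> [x Ux|v].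
  by have [] := is_diffS (dc x Ux) (df x Ux).
apply: Ck_ext (CkD oU (IH _ _ (CkS Sc) (Cf v)) (IH _ _ (Cc v) (CkS Sf))) => //.
by move=> x Ux /=; rewrite diffS //; [apply: dc|apply: df].
Qed.

Lemma Ck_lin V W k (U : set V) (f : {linear V -> W}) :
  continuous f -> Ck k U f.
Proof.
move=> cf; case: k => [|k]; first by move=> x _; apply: cf.
split=> [x _|v]; first exact: linear_differentiable.
have -> : (fun x => 'd f x v) = cst (f v) by apply/funext => x; rewrite diff_lin.
exact: Ck_cst.
Qed.

Lemma Ck_lin_comp V V' W k (U : set V) (h : {linear V' -> W}) (f : V -> V') :
  open U -> continuous h -> Ck k U f -> Ck k U (h \o f).
Proof.
move=> oU ch; elim: k f => [|k IH] f.
  by move=> cf x Ux; apply: continuous_comp; [apply: cf|apply: ch].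
move=> [df Cf]; split=> [x Ux|v].
  by apply: differentiable_comp; [apply: df|apply: linear_differentiable].
apply: Ck_ext (IH _ (Cf v)) => // x Ux /=.
rewrite [in RHS]diff_comp; [|exact: df|exact: linear_differentiable].
by rewrite /= diff_lin.
Qed.

Lemma Ck_sum V W k (U : set V) n (f : 'I_n -> V -> W) : open U ->
  (forall i, Ck k U (f i)) -> Ck k U (fun x => \sum_i f i x).
Proof.
move=> oU; elim: n f => [|n IH] f Cf.
  have -> : (fun x => \sum_(i < 0) f i x) = cst 0 by apply/funext=> x; rewrite big_ord0.
  exact: Ck_cst.
have -> : (fun x => \sum_i f i x) = (fun x => \sum_(i < n) f (widen_ord (leqnSn n) i) x + f ord_max x).
  by apply/funext => x; rewrite big_ord_recr.
by apply: CkD => //; apply: IH.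
Qed.

Lemma Ck_pair V W W' k (U : set V) (f : V -> W) (f' : V -> W') : open U ->
  Ck k U f -> Ck k U f' -> Ck k U (fun x => (f x, f' x)).
Proof.
move=> oU; elim: k f f' => [|k IH] f f'.
  by move=> cf cf' x Ux; apply: cvg_pair; [apply: cf|apply: cf'].
move=> [df Cf] [df' Cf']; split=> [x Ux|v].
  by apply: differentiable_pair; [apply: df|apply: df'].
apply: Ck_ext (IH _ _ (Cf v) (Cf' v)) => // x Ux /=.
by rewrite diff_pair //; [apply: df|apply: df'].
Qed.

(* [b] is a basis of [V] with continuous coordinate forms [p]; products of
   matrix spaces have one. *)
Definition findim V := exists (n : nat) (b : 'I_n -> V)
  (p : 'I_n -> {linear V -> R}), (forall i, continuous (p i)) /\
  forall v, v = \sum_i p i v *: b i.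

(** [Ck] speaks only of derivatives in fixed directions; expanding [w x] in a basis reduces a moving
    direction to these. The same device serves in [Ck_comp] and [diff_dapp]. *)
Lemma Ck_dapp V W k (U : set V) (f : V -> W) (w : V -> V) : findim V -> open U ->
  Ck k.+1 U f -> Ck k U w -> Ck k U (fun x => 'd f x (w x)).
Proof.
move=> [n [b [p [cp pb]]]] oU [_ Cf] Cw.
have -> : (fun x => 'd f x (w x)) = (fun x => \sum_i p i (w x) *: 'd f x (b i)).
  apply/funext => x; rewrite {1}(pb (w x)) linear_sum.
  by apply: eq_bigr => i _; rewrite linearZ.
by apply: Ck_sum => // i; apply: CkZ; [|exact: (Ck_lin_comp oU (cp i) Cw)|exact: Cf].
Qed.

Lemma Ck_comp V V' W k (U : set V) (U' : set V') (f : V -> V') (h : V' -> W) :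
  findim V' -> open U -> open U' -> (forall x, U x -> U' (f x)) ->
  Ck k U f -> Ck k U' h -> Ck k U (h \o f).
Proof.
move=> [n [b [p [cp pb]]]] oU oU' UU'; elim: k f h UU' => [|k IH] f h UU'.
  by move=> cf ch x Ux; apply: continuous_comp; [apply: cf|apply/ch/UU'].
move=> Sf Sh; have [df Cf] := Sf; have [dh Ch] := Sh; split=> [x Ux|v].
  by apply: differentiable_comp; [apply: df|apply/dh/UU'].
have C : Ck k U (fun x => \sum_i p i ('d f x v) *: 'd h (f x) (b i)).
  apply: Ck_sum => // i; apply: CkZ => //; first exact: (Ck_lin_comp oU (cp i) (Cf v)).
  by apply: (IH f (fun y => 'd h y (b i))); [exact: UU'|exact: CkS|exact: Ch].
apply: Ck_ext C => // x Ux.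
rewrite [in RHS]diff_comp; [|exact: df|exact/dh/UU'].
rewrite /= {2}(pb ('d f x v)) linear_sum.
by apply: eq_bigr => i _; rewrite linearZ.
Qed.

Lemma CkV V k (U : set V) (f : V -> R) : open U -> (forall x, U x -> f x != 0) ->
  Ck k U f -> Ck k U (fun x => (f x)^-1).
Proof.
move=> oU f0; elim: k => [|k IH] Sf.
  by move=> x Ux; apply: continuousV; [apply: f0|apply: Sf].
have [df Cf] := Sf; split=> [x Ux|v].
  by apply: differentiableV; [apply: df|apply: f0].
have I := IH (CkS Sf).
have N := CkZ oU (Ck_cst k U (-1 : R)) (CkZ oU I (CkZ oU I (Cf v))).
apply: Ck_ext N => // x Ux.
rewrite diffV; [|exact: df|exact: f0].
by rewrite /= scaleN1r scaleNr -exprVn expr2 scalerA.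
Qed.

End Calculus.

Section Calculus.
Variable R : realType.
Implicit Types V W : normedModType R.

Lemma findim_continuous V W (f : {linear V -> W}) : findim V -> continuous f.
Proof.
move=> [n [b [p [cp pb]]]].
have -> : (f : V -> W) = (fun v => \sum_i p i v *: f (b i)).
  apply/funext => v; rewrite {1}(pb v) linear_sum.
  by apply: eq_bigr => i _; rewrite linearZ.
suff C : Ck 0 setT (fun v => \sum_i p i v *: f (b i)) by move=> x; exact: C.
apply: Ck_sum => [|i]; first exact: openT.
by apply: CkZ; [exact: openT|exact: Ck_lin|exact: Ck_cst].
Qed.

Lemma findim_rV n : findim 'rV[R]_n.
Proof.
exists n, (fun i => delta_mx 0 i).
have lin (i : 'I_n) : linear (fun v : 'rV[R]_n => v 0 i).
  by move=> a u v; rewrite !mxE.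
pose pM i := GRing.isLinear.Build _ _ _ _ _ (lin i).
pose p i : {linear 'rV[R]_n -> R} := HB.pack (fun v : 'rV[R]_n => v 0 i) (pM i).
exists p; split; last exact: row_sum_delta.
by move=> i; exact: coord_continuous.
Qed.

Lemma findim_R : findim (R : normedModType R).
Proof.
exists 1%N, (fun=> 1), (fun=> idfun); split; first by move=> _ x; exact: cvg_id.
by move=> v; rewrite big_ord1 /= [RHS]mulr1.
Qed.

Lemma findim_prod V W : findim V -> findim W -> findim (V * W)%type.
Proof.
move=> [n [b [p [cp pb]]]] [n' [b' [p' [cp' pb']]]].
exists (n + n')%N, (fun i => match fintype.split i with
  | inl j => (b j, 0) | inr j => (0, b' j) end).
have lin1 j : linear (fun v : V * W => p j v.1).
  by move=> a u v; rewrite linearP.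
have lin2 j : linear (fun v : V * W => p' j v.2).
  by move=> a u v; rewrite linearP.
pose p1 j : {linear (V * W)%type -> R} :=
  HB.pack (fun v : V * W => p j v.1) (GRing.isLinear.Build _ _ _ _ _ (lin1 j)).
pose p2 j : {linear (V * W)%type -> R} :=
  HB.pack (fun v : V * W => p' j v.2) (GRing.isLinear.Build _ _ _ _ _ (lin2 j)).
exists (fun i => match fintype.split i with inl j => p1 j | inr j => p2 j end).
split=> [i|[v w]].
  case: (fintype.split i) => j x /=.
    by apply: continuous_comp; [exact: cvg_fst|exact: cp].
  by apply: continuous_comp; [exact: cvg_snd|exact: cp'].
rewrite big_split_ord /=.
rewrite (eq_bigr (fun i => (p i v *: b i, 0) : V * W)); last first.
  move=> i _; case: splitP => j /= E; last by have := ltn_ord i; rewrite E ltnNge leq_addr.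
  by rewrite (ord_inj E : i = j); congr pair; rewrite scaler0.
rewrite [X in _ + X](eq_bigr (fun i => (0, p' i w *: b' i) : V * W)); last first.
  move=> i _; case: splitP => j /= E; first by have := ltn_ord j; rewrite -E ltnNge leq_addr.
  by rewrite (ord_inj (addnI E) : i = j); congr pair; rewrite scaler0.
have S1 m (F : 'I_m -> V) : \sum_i ((F i, 0) : V * W) = (\sum_i F i, 0).
  by apply/esym; apply: (big_morph (fun x => (x, 0) : V * W)) => // x y; congr pair; rewrite addr0.
have S2 m (F : 'I_m -> W) : \sum_i ((0, F i) : V * W) = (0, \sum_i F i).
  by apply/esym; apply: (big_morph (fun x => (0, x) : V * W)) => // x y; congr pair; rewrite addr0.
rewrite S1 S2; congr pair => /=; first by rewrite addr0 -pb.
by rewrite add0r -pb'.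
Qed.

Lemma is_diff_sum V W n (f : 'I_n -> V -> W) x :
  (forall i, differentiable (f i) x) ->
  is_diff x (fun y => \sum_i f i y) (fun v => \sum_i 'd (f i) x v).
Proof.
elim: n f => [|n IH] f df.
  have -> : (fun x => \sum_(i < 0) f i x) = cst 0 by apply/funext=> y; rewrite big_ord0.
  have -> : (fun v => \sum_(i < 0) 'd (f i) x v) = 0 by apply/funext=> y; rewrite big_ord0.
  exact: is_diff_cst.
have -> : (fun x => \sum_i f i x) = (fun x => \sum_(i < n) f (widen_ord (leqnSn n) i) x) + f ord_max.
  by apply/funext => y; rewrite big_ord_recr.
have -> : (fun v => \sum_i 'd (f i) x v) =
   (fun v => \sum_(i < n) 'd (f (widen_ord (leqnSn n) i)) x v) + 'd (f ord_max) x.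
  by apply/funext => y; rewrite big_ord_recr.
apply: is_diffD; last by split; [exact: df|].
exact: IH.
Qed.

Lemma diff_dapp V W (f : V -> W) (w : V -> V) x v : findim V ->
  (forall u, differentiable (fun z => 'd f z u) x) -> differentiable w x ->
  'd (fun z => 'd f z (w z)) x v =
    'd (fun z => 'd f z (w x)) x v + 'd f x ('d w x v).
Proof.
move=> [n [b [p [cp pb]]]] df dw.
have E (u : V -> V) : (fun z => 'd f z (u z)) =
    (fun z => \sum_i p i (u z) *: 'd f z (b i)).
  apply/funext => z; rewrite {1}(pb (u z)) linear_sum.
  by apply: eq_bigr => i _; rewrite linearZ.
have dp i : differentiable (fun z => p i (w z)) x.
  by apply: (differentiable_comp dw); exact: linear_differentiable.
have dpf i : differentiable (fun z => p i (w z) *: 'd f z (b i)) x.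
  by have [] := is_diffS (dp i) (df (b i)).
have dpf' i : differentiable (fun z => p i (w x) *: 'd f z (b i)) x.
  by have [] := is_diffS (differentiable_cst (p i (w x)) x) (df (b i)).
have dpi i : differentiable (p i) (w x) by exact: linear_differentiable.
have e1 i : 'd (fun z => p i (w z)) x v = p i ('d w x v).
  apply: etrans (congr1 (fun h => h v) (diff_comp dw (dpi i))) _.
  exact: (congr1 (fun h => h ('d w x v)) (diff_lin (w x) (cp i))).
rewrite (E w) (E (fun=> w x)).
apply: etrans (congr1 (fun h => h v) (diff_val (is_diff_def := is_diff_sum dpf))) _.
apply/esym; apply: etrans (congr1 (fun h => h v + 'd f x ('d w x v))
  (diff_val (is_diff_def := is_diff_sum dpf'))) _.
rewrite {1}(pb ('d w x v)) linear_sum -big_split; apply: eq_bigr => i _.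
apply: etrans (esym (diffS v (dp i) (df (b i)))).
rewrite e1 [RHS]addrC linearZ addrC; congr (_ + _).
apply: etrans (diffS v (differentiable_cst (p i (w x)) x) (df (b i))) _.
have -> : 'd (cst (p i (w x)) : V -> R) x v = 0 by rewrite diff_cst.
by rewrite scale0r addr0.
Qed.

Lemma mvt_line V (f : V -> R) (x v : V) (h : R) : 0 <= h ->
  (forall t, 0 <= t <= h -> differentiable f (x + t *: v)) ->
  exists2 t, 0 <= t <= h & f (x + h *: v) - f x = h * 'd f (x + t *: v) v.
Proof.
move=> h0 df; pose F (t : R) := f (x + t *: v).
have dF t : 0 <= t <= h -> is_diff t F (fun s => 'd f (x + t *: v) (s *: v)).
  move=> th; have -> : F = f \o (cst x + *:%R^~ v) by [].
  have H : is_diff t (cst x + *:%R^~ v) (0 + *:%R^~ v).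
    exact: is_diffD.
  have D : is_diff ((cst x + *:%R^~ v) t) f ('d f (x + t *: v)).
    by split; [exact: df|].
  have := is_diff_comp H D; congr (is_diff_def _ _ _).
  by apply/funext => s /=; rewrite !fctE add0r.
have dF1 t : 0 <= t <= h -> is_derive t 1 F ('d f (x + t *: v) v).
  move=> th; have [dFt dE] := dF t th.
  split; first exact: diff_derivable.
  by rewrite deriveE // dE /= scale1r.
have [] := @MVT_segment R F (fun t => 'd f (x + t *: v) v) 0 h h0.
- by move=> t; rewrite in_itv /= => /andP[t0 th]; apply: dF1; rewrite !ltW.
- apply: continuous_in_subspaceT => t; rewrite inE /= in_itv /= => th.
  by apply: differentiable_continuous; have [] := dF t th.
- move=> t; rewrite in_itv /= => th E; exists t => //.
  by move: E; rewrite /F subr0 scale0r addr0 => ->; rewrite mulrC.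
Qed.

End Calculus.

(** * Symmetry of second derivatives *)

Section Schwarz.
Variable R : realType.
Implicit Types V W : normedModType R.

(** The mean value theorem is used twice: along [v] for [u - f], then along [w] for the derivative
    of [f] in the direction [v]. *)
Lemma second_difference V (U : set V) (f : V -> R) (x v w : V) (h : R) :
  0 <= h -> smooth_on U f ->
  (forall s t : R, 0 <= s <= h -> 0 <= t <= h -> U (x + s *: v + t *: w)) ->
  exists s t : R, [/\ 0 <= s <= h, 0 <= t <= h &
    f (x + h *: v + h *: w) - f (x + h *: w) - (f (x + h *: v) - f x) =
    h * (h * 'd (fun z => 'd f z v) (x + s *: v + t *: w) w)].
Proof.
move=> h0 sf inU; pose u z := f (z + h *: w).
have hh : 0 <= h <= h by rewrite h0 /=.
have h00 : 0 <= (0 : R) <= h by rewrite h0 andbT.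
have df z : U z -> differentiable f z by exact: smooth_differentiable sf.
have tr z : is_diff z (fun y : V => y + h *: w) id.
  have H : is_diff z (id + cst (h *: w)) (id + 0) by exact: is_diffD.
  by move: H; rewrite addr0.
have du (t : R) : 0 <= t <= h -> is_diff (x + t *: v) u ('d f (x + t *: v + h *: w)).
  move=> th; have D : is_diff ((fun y => y + h *: w) (x + t *: v)) f
      ('d f (x + t *: v + h *: w)).
    by split; [apply: df; exact: inU|].
  exact: (is_diff_comp (tr (x + t *: v)) D).
have df' (t : R) : 0 <= t <= h -> is_diff (x + t *: v) f ('d f (x + t *: v)).
  by move=> th; split; [apply: df; have := inU t 0 th h00; rewrite scale0r addr0|].
have dB (t : R) : 0 <= t <= h -> is_diff (x + t *: v) (u - f)
    (('d f (x + t *: v + h *: w) : V -> R) - ('d f (x + t *: v) : V -> R)).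
  by move=> th; exact: is_diffB (du t th) (df' t th).
have [s sh Es] := mvt_line h0 (fun t th => ex_diff (is_diff_def := dB t th)).
have sdf := smooth_d v sf.
have [t th Et] := mvt_line (f := fun z => 'd f z v) (x := x + s *: v) (v := w) h0
  (fun t th => smooth_differentiable sdf (inU s t sh th)).
exists s, t; split => //.
rewrite -Et; have := congr1 (fun k => k v) (diff_val (is_diff_def := dB s sh)) => E.
move: Es; rewrite E /u !fctE => <-; ring.
Qed.

(** The second difference is symmetric in [v] and [w], so the two mixed derivatives take a common
    value at two points close to [x]; continuity carries this to [x]. *)
Lemma schwarz_real V (U : set V) (f : V -> R) (x v w : V) :
  open U -> U x -> smooth_on U f ->
  'd (fun z => 'd f z v) x w = 'd (fun z => 'd f z w) x v.
Proof.
move=> oU Ux sf.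
pose a z := 'd (fun z => 'd f z v) z w; pose b z := 'd (fun z => 'd f z w) z v.
rewrite -/(a x) -/(b x).
have ca : {for x, continuous a}.
  exact: (smooth_d w (smooth_d v sf) 0 x Ux).
have cb : {for x, continuous b}.
  exact: (smooth_d v (smooth_d w sf) 0 x Ux).
apply/eqP; rewrite -subr_eq0 -normr_le0; apply/ler_addgt0Pl => e e0.
rewrite addr0.
have e2 : 0 < e / 2 by rewrite divr_gt0.
have : \forall z \near x, [/\ U z, `|a x - a z| < e / 2 & `|b x - b z| < e / 2].
  have nU : nbhs x U by exact: open_nbhs_nbhs.
  have na := (cvgrPdist_lt _ _).1 ca _ e2; have nb := (cvgrPdist_lt _ _).1 cb _ e2.
  near=> z; split; near: z; [exact: nU|exact: na|exact: nb].
move=> /nbhs_ballP [d /= d0 dB].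
(* The bound [h * m < d] keeps the whole parallelogram in the ball; the summand 1 makes [m] positive
   even if [v = w = 0]. *)
pose m := `|v| + `|w| + 1.
have m0 : 0 < m by rewrite ltr_pwDr // addr_ge0.
pose h := d / (2 * m).
have h0 : 0 < h by rewrite divr_gt0 // mulr_gt0.
have hm : h * m < d.
  by rewrite /h invfM mulrA divfK ?gt_eqF // ltr_pdivrMr // ltr_pMr // ltr1n.
have near s t : 0 <= s <= h -> 0 <= t <= h -> ball x d (x + s *: v + t *: w).
  move=> /andP[s0 sh] /andP[t0 th]; rewrite -ball_normE /= -addrA opprD addNKr normrN.
  apply: le_lt_trans hm; apply: le_trans (ler_normD _ _) _.
  rewrite !normrZ !ger0_norm // /m !mulrDr mulr1.
  by rewrite -[leLHS]addr0; apply: lerD; [apply: lerD; apply: ler_wpM2r|apply: ltW].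
have [s [t [sh th E1]]] := second_difference (w := w) (v := v) (ltW h0) sf
  (fun s t sh th => let: And3 H _ _ := dB _ (near s t sh th) in H).
have near' s' t' : 0 <= s' <= h -> 0 <= t' <= h -> ball x d (x + s' *: w + t' *: v).
  by move=> ??; rewrite addrAC; exact: near.
have [s' [t' [sh' th' E2]]] := second_difference (w := v) (v := w) (ltW h0) sf
  (fun s t sh th => let: And3 H _ _ := dB _ (near' s t sh th) in H).
have [_ A _] := dB _ (near _ _ sh th); have [_ _ B] := dB _ (near' _ _ sh' th').
have E : a (x + s *: v + t *: w) = b (x + s' *: w + t' *: v).
  apply: (mulfI (x := h)); first by rewrite gt_eqF.
  apply: (mulfI (x := h)); first by rewrite gt_eqF.
  rewrite -E1 -E2 (addrAC x (h *: w)) !opprB; ring.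
rewrite -E in B.
have -> : a x - b x = (a x - a (x + s *: v + t *: w)) - (b x - a (x + s *: v + t *: w)).
  by rewrite opprB addrA subrK.
apply: le_trans (ler_normB _ _) _.
by rewrite (splitr e) ltW // ltrD.
Unshelve. all: by end_near. Qed.

Lemma schwarz V W (U : set V) (f : V -> W) (x v w : V) : findim W ->
  open U -> U x -> smooth_on U f ->
  'd (fun z => 'd f z v) x w = 'd (fun z => 'd f z w) x v.
Proof.
move=> [n [b [p [cp pb]]]] oU Ux sf.
rewrite (pb ('d _ x w)) [RHS](pb ('d _ x v)); apply: eq_bigr => i _; congr (_ *: _).
have dp y : differentiable (p i) y by exact: linear_differentiable.
have comp (h : V -> W) z u : differentiable h z -> p i ('d h z u) = 'd (p i \o h) z u.
  move=> dh; apply: esym; apply: etrans (congr1 (fun k => k u) (diff_comp dh (dp (h z)))) _.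
  exact: (congr1 (fun k => k ('d h z u)) (diff_lin (h z) (cp i))).
have spf : smooth_on U (p i \o f) by move=> k; apply: Ck_lin_comp.
have E u u' : p i ('d (fun z => 'd f z u) x u') = 'd (fun z => 'd (p i \o f) z u) x u'.
  have dfu : differentiable (fun z => 'd f z u) x.
    exact: smooth_differentiable (smooth_d u sf) Ux.
  rewrite (comp _ _ _ dfu).
  have N : {near x, p i \o (fun z => 'd f z u) =1 (fun z => 'd (p i \o f) z u)}.
    apply: (open_near oU Ux) => y Uy.
    by apply: comp; exact: smooth_differentiable sf Uy.
  have dpf : differentiable (p i \o (fun z => 'd f z u)) x by exact: differentiable_comp.
  exact: (esym (congr1 (fun k => k u') (near_diff N dpf).2)).
by rewrite !E; exact: schwarz_real spf.
Qed.

End Schwarz.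

(** * Lie brackets in a vector space *)

Section LieBracket.
Variable R : realType.
Implicit Types V W : normedModType R.

Lemma smooth_cst V W (U : set V) (a : W) : smooth_on U (cst a : V -> W).
Proof. by move=> k; exact: Ck_cst. Qed.

Lemma smoothD V W (U : set V) (f g : V -> W) : open U ->
  smooth_on U f -> smooth_on U g -> smooth_on U (fun x => f x + g x).
Proof. by move=> oU sf sg k; exact: CkD. Qed.

Lemma smoothZ V W (U : set V) (c : V -> R) (f : V -> W) : open U ->
  smooth_on U c -> smooth_on U f -> smooth_on U (fun x => c x *: f x).
Proof. by move=> oU sf sg k; exact: CkZ. Qed.

Lemma smoothM V (U : set V) (c f : V -> R) : open U ->
  smooth_on U c -> smooth_on U f -> smooth_on U (fun x => c x * f x).
Proof. exact: smoothZ. Qed.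

Lemma smoothB V W (U : set V) (f g : V -> W) : open U ->
  smooth_on U f -> smooth_on U g -> smooth_on U (fun x => f x - g x).
Proof.
move=> oU sf sg.
apply: smooth_ext (smoothD oU sf (smoothZ oU (smooth_cst U (-1 : R)) sg)) => //.
by move=> x _; rewrite /= scaleN1r.
Qed.

Lemma smooth_lin V W (U : set V) (f : {linear V -> W}) :
  findim V -> smooth_on U f.
Proof. by move=> fV k; apply: Ck_lin; exact: findim_continuous. Qed.

Lemma smooth_fst V W (U : set (V * W)) : smooth_on U (fst : V * W -> V).
Proof.
have lin : linear (fst : V * W -> V) by [].
pose f : {linear (V * W)%type -> V} := HB.pack (fst : V * W -> V) (GRing.isLinear.Build _ _ _ _ _ lin).
by move=> k; apply: (@Ck_lin _ _ _ k U f) => x; exact: cvg_fst.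
Qed.

Lemma smooth_snd V W (U : set (V * W)) : smooth_on U (snd : V * W -> W).
Proof.
have lin : linear (snd : V * W -> W) by [].
pose f : {linear (V * W)%type -> W} := HB.pack (snd : V * W -> W) (GRing.isLinear.Build _ _ _ _ _ lin).
by move=> k; apply: (@Ck_lin _ _ _ k U f) => x; exact: cvg_snd.
Qed.

Lemma smooth_pair V W W' (U : set V) (f : V -> W) (f' : V -> W') : open U ->
  smooth_on U f -> smooth_on U f' -> smooth_on U (fun x => (f x, f' x)).
Proof. by move=> oU sf sg k; exact: Ck_pair. Qed.

Lemma smooth_sum V W (U : set V) n (f : 'I_n -> V -> W) : open U ->
  (forall i, smooth_on U (f i)) -> smooth_on U (fun x => \sum_i f i x).
Proof. by move=> oU sf k; apply: Ck_sum => // i; exact: sf. Qed.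

Lemma smooth_dapp V W (U : set V) (f : V -> W) (w : V -> V) : findim V ->
  open U -> smooth_on U f -> smooth_on U w -> smooth_on U (fun x => 'd f x (w x)).
Proof. by move=> fV oU sf sw k; exact: Ck_dapp. Qed.

Lemma smooth_comp V V' W (U : set V) (U' : set V') (f : V -> V') (h : V' -> W) :
  findim V' -> open U -> open U' -> (forall x, U x -> U' (f x)) ->
  smooth_on U f -> smooth_on U' h -> smooth_on U (h \o f).
Proof. by move=> fV oU oU' UU sf sh k; exact: Ck_comp (sf k) (sh k). Qed.

Lemma smoothV V (U : set V) (f : V -> R) : open U -> (forall x, U x -> f x != 0) ->
  smooth_on U f -> smooth_on U (fun x => (f x)^-1).
Proof. by move=> oU f0 sf k; exact: CkV. Qed.

Lemma diff_line V W (f : V -> W) (x v : V) (w : W) : differentiable f x ->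
  (forall t : R, f (x + t *: v) = f x + t *: w) -> 'd f x v = w.
Proof.
move=> df E; rewrite -(deriveE _ df) /derive.
apply: (cvg_lim (@norm_hausdorff _ _)).
have N : {near (0 : R)^', cst w =1 (fun h : R => h^-1 *: ((f \o shift x) (h *: v) - f x))}.
  near=> h; have h0 : h != 0 by near: h; exact: nbhs_dnbhs_neq.
  by rewrite /= [_ + x]addrC E addrAC subrr add0r scalerA mulVf // scale1r.
by apply: cvg_trans (near_eq_cvg N) _; exact: cvg_cst.
Unshelve. all: by end_near. Qed.

Definition lbr V (a b : V -> V) (z : V) : V := 'd b z (a z) - 'd a z (b z).

Lemma smooth_lbr V (U : set V) (a b : V -> V) : findim V -> open U ->
  smooth_on U a -> smooth_on U b -> smooth_on U (lbr a b).
Proof. by move=> fV oU sa sb; apply: smoothB => //; exact: smooth_dapp. Qed.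

(* The second derivatives cancel because they are symmetric. *)
Lemma diff_lbr V W (U : set V) (f : V -> W) (a b : V -> V) z :
  findim V -> findim W -> open U -> U z ->
  smooth_on U f -> differentiable a z -> differentiable b z ->
  'd f z (lbr a b z) =
  'd (fun y => 'd f y (b y)) z (a z) - 'd (fun y => 'd f y (a y)) z (b z).
Proof.
move=> fV fW oU Uz sf da db.
have df u : differentiable (fun y => 'd f y u) z.
  exact: smooth_differentiable (smooth_d u sf) Uz.
have Ea := diff_dapp (b z) fV df da; have Eb := diff_dapp (a z) fV df db.
apply: esym; apply: etrans (congr2 (fun p q => p - q) Eb Ea) _.
rewrite (schwarz _ _ fW oU Uz sf) opprD addrACA subrr add0r.
by rewrite /lbr linearB.
Qed.

(** Brackets of [f]-related fields are [f]-related: in [diff_lbr] each iterated derivative becomes,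
    by the chain rule, a derivative of the related field. *)
Lemma lbr_natural V W (U : set V) (U' : set W) (f : V -> W) (a b : V -> V) (a' b' : W -> W) z :
  findim V -> findim W -> open U -> open U' -> U z -> U' (f z) ->
  smooth_on U f -> smooth_on U a -> smooth_on U b ->
  smooth_on U' a' -> smooth_on U' b' ->
  (forall y, U y -> a' (f y) = 'd f y (a y)) ->
  (forall y, U y -> b' (f y) = 'd f y (b y)) ->
  lbr a' b' (f z) = 'd f z (lbr a b z).
Proof.
move=> fV fW oU oU' Uz Ufz sf sa sb sa' sb' Ea Eb.
have dif (h : V -> V) : smooth_on U h -> differentiable h z.
  by move=> sh; exact: smooth_differentiable sh Uz.
have dif' (h : W -> W) : smooth_on U' h -> differentiable h (f z).
  by move=> sh; exact: smooth_differentiable sh Ufz.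
have df : differentiable f z by exact: smooth_differentiable sf Uz.
have key (h : V -> V) (h' : W -> W) u : smooth_on U h -> smooth_on U' h' ->
    (forall y, U y -> h' (f y) = 'd f y (h y)) ->
    'd (fun y => 'd f y (h y)) z u = 'd h' (f z) ('d f z u).
  move=> sh sh' E.
  have N : {near z, (fun y => 'd f y (h y)) =1 h' \o f}.
    by apply: (open_near oU Uz) => y Uy; rewrite /= E.
  have D : differentiable (fun y => 'd f y (h y)) z.
    exact: smooth_differentiable (smooth_dapp fV oU sf sh) Uz.
  have [_ X] := near_diff N D.
  apply: etrans (esym (congr1 (fun k => k u) X)) _.
  exact: (congr1 (fun k => k u) (diff_comp df (dif' _ sh'))).
rewrite (diff_lbr fV fW oU Uz sf (dif _ sa) (dif _ sb)).
rewrite (key _ _ _ sa sa' Ea) (key _ _ _ sb sb' Eb).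
by rewrite /lbr Ea // Eb.
Qed.

Lemma lbr_jacobi V (U : set V) (a b c : V -> V) z :
  findim V -> open U -> U z -> smooth_on U a -> smooth_on U b -> smooth_on U c ->
  lbr a (lbr b c) z + lbr b (lbr c a) z + lbr c (lbr a b) z = 0.
Proof.
move=> fV oU Uz sa sb sc.
have dif (h : V -> V) : smooth_on U h -> differentiable h z.
  by move=> sh; exact: smooth_differentiable sh Uz.
pose p (f h u : V -> V) : V := 'd (fun y : V => 'd f y (h y)) z (u z).
have E f h u : smooth_on U f -> smooth_on U h -> smooth_on U u ->
    lbr f (lbr h u) z = p u h f - p h u f - (p f u h - p f h u).
  move=> sf sh su; rewrite {1}/lbr (diff_lbr fV fV oU Uz sf (dif _ sh) (dif _ su)).
  congr (_ - _); rewrite /lbr /p.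
  have du : differentiable (fun y => 'd u y (h y)) z.
    exact: smooth_differentiable (smooth_dapp fV oU su sh) Uz.
  have dh : differentiable (fun y => 'd h y (u y)) z.
    exact: smooth_differentiable (smooth_dapp fV oU sh su) Uz.
  exact: (congr1 (fun k => k (f z)) (diffB du dh)).
rewrite !E //; move: (p c b a) (p b c a) (p a c b) (p a b c) (p c a b) (p b a c).
clear -fV => x1 x2 x3 x4 x5 x6.
(* The six second-order terms cancel in pairs; this is checked on coordinates, where [ring]
   applies. *)
have [n [e [l [_ le]]]] := fV.
rewrite [LHS]le big1 // => i _; rewrite !(linearD, linearN) /=.
by apply: (etrans (congr1 (fun t => t *: e i) _) (scale0r _)); ring.
Qed.

End LieBracket.

(** * Charts of the tangent bundle *)

Section Charts.
Variables (R : realType) (n : nat) (M : manifold R n).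
Local Notation E := 'rV[R]_n.
Implicit Types (i j k : chart_index M) (x : M) (u : tbundle M).

Definition img i : set E := chart M i @` dom M i.
Definition ovl i j : set E := chart M i @` (dom M i `&` dom M j).

Lemma img_chart i x : dom M i x -> img i (chart M i x).
Proof. by exists x. Qed.

Lemma img_param i z : img i z -> dom M i (param M i z) /\ chart M i (param M i z) = z.
Proof. by move=> [x ix <-]; rewrite (chartK ix). Qed.

Lemma ovlE i j z : ovl i j z <-> img i z /\ dom M j (param M i z).
Proof.
split=> [[x [ix jx] <-]|[[x ix <-]]]; rewrite (chartK ix).
  by split; first exact: img_chart.
by move=> jx; exists x.
Qed.

Lemma ovl_chart i j x : dom M i x -> dom M j x -> ovl i j (chart M i x).
Proof. by move=> ix jx; exists x. Qed.

Lemma open_img i : open (img i).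
Proof. exact: open_image_chart. Qed.

Lemma open_ovl i j : open (ovl i j).
Proof.
rewrite openE => z /ovlE[iz jz].
have N1 : nbhs z (img i) by apply: open_nbhs_nbhs; split => //; exact: open_img.
have N2 : nbhs z (param M i @^-1` dom M j).
  apply: (continuous_param iz); apply: open_nbhs_nbhs; split => //; exact: open_dom.
by apply: filterS2 N1 N2 => y iy jy; apply/ovlE.
Qed.

Lemma transition_chart i j x : dom M i x ->
  transition i j (chart M i x) = chart M j x.
Proof. by move=> ix; rewrite /transition /= chartK. Qed.

Lemma smooth_tr i j : smooth_on (ovl i j) (transition i j).
Proof. exact: smooth_transition. Qed.

Lemma diff_tr i j x : dom M i x -> dom M j x ->
  differentiable (transition i j) (chart M i x).
Proof.
by move=> ix jx; apply: smooth_differentiable (@smooth_tr i j) _; exact: ovl_chart.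
Qed.

Lemma dtr_comp i j k x v : dom M i x -> dom M j x -> dom M k x ->
  'd (transition j k) (chart M j x) ('d (transition i j) (chart M i x) v) =
  'd (transition i k) (chart M i x) v.
Proof.
move=> ix jx kx.
have dij := diff_tr ix jx; have dik := diff_tr ix kx.
have djk : differentiable (transition j k) (transition i j (chart M i x)).
  by rewrite (transition_chart _ ix); exact: diff_tr.
have N : {near chart M i x, transition i k =1 transition j k \o transition i j}.
  apply: (open_near (@open_ovl i j) (ovl_chart ix jx)) => y [x' [ix' jx'] <-] /=.
  by rewrite !transition_chart.
apply: etrans _ (congr1 (fun h => h v) (near_diff N dik).2).
apply/esym/(etrans (congr1 (fun h => h v) (diff_comp dij djk))).
by rewrite /= (transition_chart _ ix).
Qed.

Lemma dtr_id i x v : dom M i x -> 'd (transition i i) (chart M i x) v = v.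
Proof.
move=> ix.
have N : {near chart M i x, id =1 transition i i}.
  apply: (open_near (@open_img i) (img_chart ix)) => y [x' ix' <-] /=.
  by rewrite transition_chart.
have [D1 D2] : is_diff (chart M i x) (id : E -> E) id by exact: is_diff_id.
exact: etrans (congr1 (fun h => h v) (near_diff N D1).2) (congr1 (fun h => h v) D2).
Qed.

Lemma here_dom u : dom M (here u) u.1.
Proof. exact: dom_chart_at. Qed.

Lemma tchartK i u : dom M i u.1 -> tparam i (tchart i u) = u.
Proof.
case: u => x y /= ix; rewrite /tparam /tchart /= (chartK ix); congr pair.
rewrite dtr_comp ?dtr_id //; exact: dom_chart_at.
Qed.

Lemma tparamK i z : img i z.1 -> tchart i (tparam i z) = z.
Proof.
case: z => _ y /= [x ix <-]; rewrite /tchart /tparam /= (chartK ix); congr pair.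
rewrite dtr_comp ?dtr_id //; exact: dom_chart_at.
Qed.

Lemma dtr_eq0 i j x v : dom M i x -> dom M j x ->
  ('d (transition i j) (chart M i x) v == 0) = (v == 0).
Proof.
move=> ix jx; apply/eqP/eqP => [E0|->]; last exact: linear0.
apply: (etrans (esym (dtr_id v ix))); apply: (etrans (esym (dtr_comp v ix jx ix))).
exact: (etrans (congr1 (fun w => 'd (transition j i) (chart M j x) w) E0) (linear0 _)).
Qed.

Lemma tparam_dom i z : img i z.1 -> dom M i (tparam i z).1.
Proof. by move=> /img_param[]. Qed.

Lemma tparam_neq0 i z : img i z.1 -> ((tparam i z).2 != 0) = (z.2 != 0).
Proof.
case: z => _ y /= [x ix <-]; rewrite (chartK ix) dtr_eq0 //.
exact: dom_chart_at.
Qed.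

Lemma tchart_neq0 i u : dom M i u.1 -> ((tchart i u).2 != 0) = (u.2 != 0).
Proof. by move=> iu; rewrite dtr_eq0 //; exact: here_dom. Qed.

Lemma slit_img i z : slit_chart i z -> img i z.1.
Proof. by case. Qed.

Lemma slit_tchart i u : dom M i u.1 -> u.2 != 0 -> slit_chart i (tchart i u).
Proof.
move=> iu u0; split; first exact: img_chart.
by rewrite tchart_neq0.
Qed.

Lemma slit_tparam i z : slit_chart i z -> (tparam i z).2 != 0.
Proof. by move=> [iz z0]; rewrite tparam_neq0. Qed.

Lemma open_slit i : open (slit_chart i).
Proof.
have -> : slit_chart i = (fst @^-1` img i) `&` (snd @^-1` [set y : E | y != 0]) by [].
apply: openI.
  by apply: open_comp; [move=> z _; exact: cvg_fst|exact: open_img].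
apply: open_comp; first by move=> z _; exact: cvg_snd.
have -> : [set y : E | y != 0] = ~` [set 0].
  by apply/seteqP; split=> y /= => [/eqP|] H; [exact: H|apply/eqP].
by rewrite openC; apply: accessible_closed_set1; apply: hausdorff_accessible; exact: norm_hausdorff.
Qed.

Definition tovl i j : set (E * E) := fst @^-1` ovl i j.

Lemma open_tovl i j : open (tovl i j).
Proof. by apply: open_comp; [move=> z _; exact: cvg_fst|exact: open_ovl]. Qed.

Definition ttr i j : E * E -> E * E := tchart j \o tparam i.

Lemma ttrE i j z : tovl i j z ->
  ttr i j z = (transition i j z.1, 'd (transition i j) (z.1) z.2).
Proof.
case: z => _ y /= [x [ix jx] /= <-]; rewrite /ttr /tchart /tparam /= (chartK ix).
rewrite (transition_chart _ ix).
exact: (congr1 (fun w => (chart M j x, w)) (dtr_comp y ix (dom_chart_at x) jx)).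
Qed.

Lemma findimE : findim (E : normedModType R). Proof. exact: findim_rV. Qed.
Lemma findimEE : findim ((E * E)%type : normedModType R).
Proof. by apply: findim_prod; exact: findim_rV. Qed.

(** The fibre component is written as the differential of [transition i j \o fst] in the direction
    [(z.2, 0)], so that function and direction live on the same space and [smooth_dapp] applies. *)
Lemma smooth_ttr i j : smooth_on (tovl i j) (ttr i j).
Proof.
have oU := open_tovl (i := i) (j := j).
apply: (smooth_ext (f := fun z : E * E =>
  (transition i j z.1, 'd (transition i j \o fst) z (z.2, 0)))) => //.
  move=> z Uz; rewrite (ttrE Uz); congr pair.
  have dfst : differentiable (fst : E * E -> E) z.
    exact: smooth_differentiable (@smooth_fst R E E setT) I.
  have dtr : differentiable (transition i j) z.1.
    exact: smooth_differentiable (@smooth_tr i j) Uz.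
  apply: etrans (congr1 (fun h => h _) (diff_comp dfst dtr)) _ => /=.
  by congr ('d _ _ _); apply: diff_line => // t.
have st : smooth_on (tovl i j) (transition i j \o fst).
  apply: (smooth_comp findimE oU (@open_ovl i j)) => //; first exact: smooth_fst.
  exact: smooth_tr.
apply: smooth_pair => //; apply: (smooth_dapp findimEE) => //.
by apply: smooth_pair => //; [exact: smooth_snd|exact: smooth_cst].
Qed.

Lemma tovl_tchart i j u : dom M i u.1 -> dom M j u.1 -> tovl i j (tchart i u).
Proof. by move=> iu ju; exact: ovl_chart. Qed.

Lemma ttr_tchart i j u : dom M i u.1 -> ttr i j (tchart i u) = tchart j u.
Proof. by move=> iu; rewrite /ttr /= tchartK. Qed.

Lemma diff_ttr i j u : dom M i u.1 -> dom M j u.1 ->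
  differentiable (ttr i j) (tchart i u).
Proof.
by move=> iu ju; apply: smooth_differentiable (@smooth_ttr i j) _; exact: tovl_tchart.
Qed.

(** Differentials are defined through the chart [here u], which may jump with [u]; this moves them
    to a fixed chart. *)
Lemma chart_change (W : normedModType R) (F : tbundle M -> W) i j u A :
  dom M i u.1 -> dom M j u.1 -> differentiable (F \o tparam i) (tchart i u) ->
  differentiable (F \o tparam j) (tchart j u) /\
  'd (F \o tparam j) (tchart j u) A =
  'd (F \o tparam i) (tchart i u) ('d (ttr j i) (tchart j u) A).
Proof.
move=> iu ju dF.
have dF' : differentiable (F \o tparam i) (ttr j i (tchart j u)) by rewrite ttr_tchart.
have dt := diff_ttr ju iu.
have N : {near tchart j u, (F \o tparam i) \o ttr j i =1 F \o tparam j}.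
  apply: (open_near (@open_tovl j i) (tovl_tchart ju iu)) => z /ovlE[jz iz].
  by rewrite /= tchartK.
have [D X] := near_diff N (differentiable_comp dt dF'); split; first exact: D.
apply: etrans (congr1 (fun h => h A) X) _.
apply: etrans (congr1 (fun h => h A) (diff_comp dt dF')) _ => /=.
by rewrite ttr_tchart.
Qed.

Lemma dttr_comp i j k u A : dom M i u.1 -> dom M j u.1 -> dom M k u.1 ->
  'd (ttr j k) (tchart j u) ('d (ttr i j) (tchart i u) A) = 'd (ttr i k) (tchart i u) A.
Proof.
move=> iu ju ku.
exact: (esym (chart_change A ju iu (diff_ttr ju ku)).2).
Qed.

Lemma dttr_id i u A : dom M i u.1 -> 'd (ttr i i) (tchart i u) A = A.
Proof.
move=> iu.
have N : {near tchart i u, id =1 ttr i i}.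
  apply: (open_near (@open_tovl i i) (tovl_tchart iu iu)) => z /ovlE[iz _].
  by rewrite /ttr /= tparamK.
have [D1 D2] : is_diff (tchart i u) (id : E * E -> E * E) id by exact: is_diff_id.
exact: etrans (congr1 (fun h => h A) (near_diff N D1).2) (congr1 (fun h => h A) D2).
Qed.

End Charts.

(** * Fields on the slit bundle *)

Section Fields.
Variables (R : realType) (n : nat) (M : manifold R n).
Local Notation E := 'rV[R]_n.
Implicit Types (i j k : chart_index M) (x : M) (u : tbundle M).
Implicit Types (f : tbundle M -> R) (X Y Z : tbundle M -> E) (A B : tbundle M -> E * E).

(** Passes from the chart [here u], in which tangent vectors at [u] are given, to the chart [i].
    Smoothness of a field makes sense only after this passage to a chart that does not vary with
    [u]. *)
Definition push i u (a : E * E) : E * E := 'd (ttr (here u) i) (tchart (here u) u) a.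
Definition pi_push i u (v : E) : E :=
  'd (transition (here u) i) (chart M (here u) u.1) v.

Lemma vf_compE i A z : vf_comp i A z = push i (tparam i z) (A (tparam i z)).
Proof. by []. Qed.

Lemma pi_compE i X z : pi_comp i X z = pi_push i (tparam i z) (X (tparam i z)).
Proof. by []. Qed.

Lemma vf_comp_tchart i A u : dom M i u.1 -> vf_comp i A (tchart i u) = push i u (A u).
Proof. by move=> iu; rewrite vf_compE tchartK. Qed.

Lemma pi_comp_tchart i X u : dom M i u.1 -> pi_comp i X (tchart i u) = pi_push i u (X u).
Proof. by move=> iu; rewrite pi_compE tchartK. Qed.

Lemma push_here u a : push (here u) u a = a.
Proof. by apply: dttr_id; exact: here_dom. Qed.

Lemma dttr_push i j u a : dom M i u.1 -> dom M j u.1 ->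
  'd (ttr i j) (tchart i u) (push i u a) = push j u a.
Proof. by move=> iu ju; apply: dttr_comp => //; exact: here_dom. Qed.

Lemma pushD i u a b : push i u (a + b) = push i u a + push i u b.
Proof. exact: linearD. Qed.
Lemma pushZ i u t a : push i u (t *: a) = t *: push i u a.
Proof. exact: linearZ. Qed.
Lemma pi_pushD i u a b : pi_push i u (a + b) = pi_push i u a + pi_push i u b.
Proof. exact: linearD. Qed.
Lemma pi_pushZ i u t a : pi_push i u (t *: a) = t *: pi_push i u a.
Proof. exact: linearZ. Qed.
Lemma pi_push0 i u : pi_push i u 0 = 0.
Proof. exact: linear0. Qed.
Lemma push_neq0 i u v : dom M i u.1 -> (pi_push i u v == 0) = (v == 0).
Proof. by move=> iu; apply: dtr_eq0 => //; exact: here_dom. Qed.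

Lemma slit_cover i z : slit_chart i z ->
  exists u, [/\ dom M i u.1, u.2 != 0 & z = tchart i u].
Proof.
move=> sz; exists (tparam i z); split; first exact/tparam_dom/slit_img.
  exact: slit_tparam.
by rewrite tparamK //; exact: slit_img.
Qed.

Lemma smooth_fun_diff f i u : smooth_fun f -> dom M i u.1 -> u.2 != 0 ->
  differentiable (f \o tparam i) (tchart i u).
Proof. by move=> sf iu u0; exact: smooth_differentiable (sf i) (slit_tchart iu u0). Qed.

Lemma dfun_chart f i u a : smooth_fun f -> dom M i u.1 -> u.2 != 0 ->
  dfun f u a = 'd (f \o tparam i) (tchart i u) (push i u a).
Proof.
move=> sf iu u0.
exact: (chart_change a iu (here_dom u) (smooth_fun_diff sf iu u0)).2.
Qed.

Lemma dfun_vf f A i z : smooth_fun f -> slit_chart i z ->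
  dfun f (tparam i z) (A (tparam i z)) = 'd (f \o tparam i) z (vf_comp i A z).
Proof.
move=> sf /slit_cover[u [iu u0 ->]].
by rewrite (tchartK iu) (vf_comp_tchart _ iu); exact: dfun_chart.
Qed.

Lemma smooth_dfun f A : smooth_fun f -> vfield A -> smooth_fun (fun u => dfun f u (A u)).
Proof.
move=> sf sA i; have oS := @open_slit _ _ M i.
apply: (smooth_ext (f := fun z => 'd (f \o tparam i) z (vf_comp i A z))) => //.
  by move=> z sz; rewrite /= dfun_vf.
exact: (smooth_dapp (@findimEE R n) oS (sf i) (sA i)).
Qed.

Lemma smooth_fun_cst (c : R) : smooth_fun (fun _ : tbundle M => c).
Proof. by move=> i; exact: smooth_cst. Qed.

Lemma smooth_funD f g : smooth_fun f -> smooth_fun g -> smooth_fun (fun u => f u + g u).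
Proof. by move=> sf sg i; apply: smoothD (sf i) (sg i); exact: open_slit. Qed.

Lemma smooth_funM f g : smooth_fun f -> smooth_fun g -> smooth_fun (fun u => f u * g u).
Proof. by move=> sf sg i; apply: smoothM (sf i) (sg i); exact: open_slit. Qed.

Lemma smooth_fun_ext f g : (forall u, u.2 != 0 -> f u = g u) -> smooth_fun f -> smooth_fun g.
Proof.
move=> fg sf i; apply: smooth_ext (sf i); first exact: open_slit.
by move=> z sz /=; apply: fg; exact: slit_tparam.
Qed.

Lemma pi_field_ext X Y : (forall u, u.2 != 0 -> X u = Y u) -> pi_field X -> pi_field Y.
Proof.
move=> XY sX i; apply: smooth_ext (sX i); first exact: open_slit.
by move=> z sz /=; rewrite !pi_compE XY //; exact: slit_tparam.
Qed.

Lemma vfield_ext A B : (forall u, u.2 != 0 -> A u = B u) -> vfield A -> vfield B.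
Proof.
move=> AB sA i; apply: smooth_ext (sA i); first exact: open_slit.
by move=> z sz /=; rewrite !vf_compE AB //; exact: slit_tparam.
Qed.

Lemma pi_field0 : pi_field (fun _ : tbundle M => 0 : E).
Proof.
move=> i; apply: (smooth_ext (f := cst 0)); [exact: open_slit| |exact: smooth_cst].
by move=> z _; rewrite pi_compE pi_push0.
Qed.

Lemma pi_fieldD X Y : pi_field X -> pi_field Y -> pi_field (fun u => X u + Y u).
Proof.
move=> sX sY i; have oS := @open_slit _ _ M i.
apply: smooth_ext (smoothD oS (sX i) (sY i)) => //.
by move=> z _; rewrite !pi_compE pi_pushD.
Qed.

Lemma pi_fieldZ f X : smooth_fun f -> pi_field X -> pi_field (fun u => f u *: X u).
Proof.
move=> sX sY i; have oS := @open_slit _ _ M i.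
apply: smooth_ext (smoothZ oS (sX i) (sY i)) => //.
by move=> z _; rewrite !pi_compE pi_pushZ.
Qed.

Lemma vfieldD A B : vfield A -> vfield B -> vfield (fun u => A u + B u).
Proof.
move=> sX sY i; have oS := @open_slit _ _ M i.
apply: smooth_ext (smoothD oS (sX i) (sY i)) => //.
by move=> z _; rewrite !vf_compE pushD.
Qed.

Lemma vfieldZ f A : smooth_fun f -> vfield A -> vfield (fun u => f u *: A u).
Proof.
move=> sX sY i; have oS := @open_slit _ _ M i.
apply: smooth_ext (smoothZ oS (sX i) (sY i)) => //.
by move=> z _; rewrite !vf_compE pushZ.
Qed.

Lemma pi_field_eta : pi_field (@eta R n M).
Proof.
move=> i; apply: (smooth_ext (f := snd)); [exact: open_slit| |exact: smooth_snd].
move=> _ /slit_cover[u [iu u0 ->]]; rewrite (pi_comp_tchart _ iu) /eta.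
by [].
Qed.

Lemma dttr_fst i j u a : dom M i u.1 -> dom M j u.1 ->
  ('d (ttr i j) (tchart i u) a).1 = 'd (transition i j) (chart M i u.1) a.1.
Proof.
move=> iu ju; have tu := tovl_tchart iu ju.
have dt := diff_ttr iu ju.
have dfst z : differentiable (fst : E * E -> E) z.
  exact: smooth_differentiable (@smooth_fst R E E setT) I.
have dE z : 'd (fst : E * E -> E) z a = a.1 by apply: diff_line.
have dE' z b : 'd (fst : E * E -> E) z b = b.1 by apply: diff_line.
have N : {near tchart i u, fst \o ttr i j =1 transition i j \o fst}.
  apply: (open_near (@open_tovl _ _ M i j) tu) => z tz; exact: (congr1 fst (ttrE tz)).
have dtr : differentiable (transition i j) ((tchart i u).1) by exact: diff_tr.
have X := congr1 (fun h => h a) (diff_comp dt (dfst _)).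
have Y := congr1 (fun h => h a) (diff_comp (dfst (tchart i u)) dtr).
have Z := congr1 (fun h => h a) (near_diff N (differentiable_comp dt (dfst _))).2.
apply: etrans (esym (dE' (ttr i j (tchart i u)) ('d (ttr i j) (tchart i u) a))) _.
apply: etrans (esym X) _; apply: etrans (esym Z) _; apply: etrans Y _.
exact: (congr1 (fun b => 'd (transition i j) (chart M i u.1) b) (dE (tchart i u))).
Qed.

Lemma dttr_vert i j u b : dom M i u.1 -> dom M j u.1 ->
  'd (ttr i j) (tchart i u) (0, b) = (0, 'd (transition i j) (chart M i u.1) b).
Proof.
move=> iu ju; have tu := tovl_tchart iu ju.
apply: diff_line; first exact: diff_ttr.
move=> t; rewrite !ttrE //=; last by rewrite /tovl /= scaler0 addr0.
rewrite scaler0 addr0; congr pair; first by rewrite /= scaler0 addr0.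
exact: etrans (linearD _ _ _) (congr1 (fun w => _ + w) (linearZ _ _)).
Qed.

Lemma push_fst i u a : dom M i u.1 -> (push i u a).1 = pi_push i u a.1.
Proof. by move=> iu; apply: dttr_fst => //; exact: here_dom. Qed.

Lemma push_vert i u b : dom M i u.1 -> push i u (0, b) = (0, pi_push i u b).
Proof. by move=> iu; apply: dttr_vert => //; exact: here_dom. Qed.

Lemma rhoE u a : rho u a = a.1.
Proof.
have hu := here_dom u.
have N : {near tchart (here u) u, fst =1 chart M (here u) \o fst \o tparam (here u)}.
  apply: (open_near (@open_tovl _ _ M (here u) (here u)) (tovl_tchart hu hu)).
  by move=> z /ovlE[iz _] /=; rewrite (img_param iz).2.
have dfst : differentiable (fst : E * E -> E) (tchart (here u) u).
  exact: smooth_differentiable (@smooth_fst R E E setT) I.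
apply: etrans (congr1 (fun h => h a) (near_diff N dfst).2) _.
by apply: diff_line.
Qed.

Lemma gammaE u v : gamma u v = (0, v).
Proof.
rewrite /gamma.
have -> : (fun t : R => tchart (here u) (u.1, u.2 + t *: v)) =
    (fun t => (chart M (here u) u.1, u.2 + t *: v)).
  by apply/funext => t; congr pair; apply: dtr_id; exact: here_dom.
have d2 : differentiable (fun t : R => u.2 + t *: v) 0.
  by have [] : is_diff (0 : R) (cst u.2 + *:%R^~ v) (0 + *:%R^~ v) by exact: is_diffD.
have d : differentiable (fun t : R => (chart M (here u) u.1, u.2 + t *: v)) 0.
  by apply: differentiable_pair; first exact: differentiable_cst.
rewrite (derive1E' d); apply: diff_line => // t.
by congr pair; rewrite /= ?scaler0 ?addr0 // add0r scale0r addr0 [_%:A]mulr1.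
Qed.

Lemma vf_comp_gamma i X z : slit_chart i z -> vf_comp i (gammaf X) z = (0, pi_comp i X z).
Proof.
move=> /slit_cover[u [iu u0 ->]].
by rewrite (vf_comp_tchart _ iu) (pi_comp_tchart _ iu) /gammaf gammaE push_vert.
Qed.

Lemma vfield_gamma X : pi_field X -> vfield (gammaf X).
Proof.
move=> sX i; have oS := @open_slit _ _ M i.
apply: smooth_ext (smooth_pair oS (smooth_cst _ 0) (sX i)) => // z sz.
by rewrite vf_comp_gamma.
Qed.

Lemma pi_comp_rho i A z : slit_chart i z -> pi_comp i (rhof A) z = (vf_comp i A z).1.
Proof.
move=> /slit_cover[u [iu u0 ->]].
by rewrite (vf_comp_tchart _ iu) (pi_comp_tchart _ iu) /rhof rhoE push_fst.
Qed.

Lemma pi_field_rho A : vfield A -> pi_field (rhof A).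
Proof.
move=> sA i; have oS := @open_slit _ _ M i.
apply: (smooth_ext (f := fst \o vf_comp i A)) => // [z sz|].
  by rewrite pi_comp_rho.
by apply: (smooth_comp (U' := setT) (@findimEE R n) oS openT) => //; exact: smooth_fst.
Qed.

Lemma lie_bracketE A B u : lie_bracket A B u =
  lbr (vf_comp (here u) A) (vf_comp (here u) B) (tchart (here u) u).
Proof.
by rewrite /lie_bracket /lbr !(vf_comp_tchart _ (here_dom u)) !push_here.
Qed.

(** [lie_bracket] is computed at each point in that point's own chart; naturality under [ttr] gives
    its components in a fixed chart, hence its smoothness. *)
Lemma vf_comp_lie A B i z : vfield A -> vfield B -> slit_chart i z ->
  vf_comp i (lie_bracket A B) z = lbr (vf_comp i A) (vf_comp i B) z.
Proof.
move=> sA sB /slit_cover[u [iu u0 ->]]; rewrite (vf_comp_tchart _ iu) lie_bracketE.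
have hu := here_dom u; set h := here u.
pose U : set (E * E) := slit_chart h `&` tovl h i.
have oU : open U by apply: openI; [exact: open_slit|exact: open_tovl].
have Uu : U (tchart h u) by split; [exact: slit_tchart|exact: tovl_tchart].
have nat C y : U y -> vf_comp i C (ttr h i y) = 'd (ttr h i) y (vf_comp h C y).
  move=> [/slit_cover[w [hw w0 ->]] [y' [hy iy] Ey]].
  have iw : dom M i w.1 by rewrite -(chartK hw) -[chart _ _ _]/((tchart h w).1) -Ey (chartK hy).
  by rewrite (ttr_tchart _ hw) !vf_comp_tchart // dttr_push.
have E' : tchart i u = ttr h i (tchart h u) by rewrite ttr_tchart.
rewrite E'; apply/esym.
apply: (lbr_natural (@findimEE R n) (@findimEE R n) oU (@open_slit _ _ M i) Uu).
- by rewrite -E'; exact: slit_tchart.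
- by apply: smooth_sub (@smooth_ttr _ _ M h i); exact: subIsetr.
- by apply: smooth_sub (sA h); exact: subIsetl.
- by apply: smooth_sub (sB h); exact: subIsetl.
- exact: sA.
- exact: sB.
- exact: nat.
- exact: nat.
Qed.

Lemma vfield_lie A B : vfield A -> vfield B -> vfield (lie_bracket A B).
Proof.
move=> sA sB i; have oS := @open_slit _ _ M i.
apply: smooth_ext (smooth_lbr (@findimEE R n) oS (sA i) (sB i)) => // z sz.
by rewrite vf_comp_lie.
Qed.

End Fields.

(** * Derivations and brackets on the slit bundle *)

Section Brackets.
Variables (R : realType) (n : nat) (M : manifold R n).
Local Notation E := 'rV[R]_n.
Implicit Types (i j k : chart_index M) (x : M) (u : tbundle M).
Implicit Types (f : tbundle M -> R) (X Y Z : tbundle M -> E) (A B C : tbundle M -> E * E).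

Lemma near_diffE (V W : normedModType R) (U : set V) (p q : V -> W) z v :
  open U -> U z -> (forall y, U y -> p y = q y) -> differentiable p z -> 'd q z v = 'd p z v.
Proof.
move=> oU Uz pq dp.
exact: (congr1 (fun h => h v) (near_diff (open_near oU Uz pq) dp).2).
Qed.

Lemma slit_here u : u.2 != 0 -> slit_chart (here u) (tchart (here u) u).
Proof. by move=> u0; apply: slit_tchart => //; exact: here_dom. Qed.

Lemma vf_comp_here A u : vf_comp (here u) A (tchart (here u) u) = A u.
Proof. by rewrite vf_comp_tchart ?push_here //; exact: here_dom. Qed.

Lemma vf_diff i A z : vfield A -> slit_chart i z -> differentiable (vf_comp i A) z.
Proof. by move=> sA sz; exact: smooth_differentiable (sA i) sz. Qed.

Lemma pi_diff i X z : pi_field X -> slit_chart i z -> differentiable (pi_comp i X) z.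
Proof. by move=> sA sz; exact: smooth_differentiable (sA i) sz. Qed.

Lemma dfunM f g u a : smooth_fun f -> smooth_fun g -> u.2 != 0 ->
  dfun (fun u => f u * g u) u a = dfun f u a * g u + f u * dfun g u a.
Proof.
move=> sf sg u0; have hu := here_dom u.
have df := smooth_fun_diff sf hu u0; have dg := smooth_fun_diff sg hu u0.
apply: etrans (diffS a df dg) _; rewrite /= tchartK // addrC; congr (_ + _).
Qed.

Lemma dfunD f g u a : smooth_fun f -> smooth_fun g -> u.2 != 0 ->
  dfun (fun u => f u + g u) u a = dfun f u a + dfun g u a.
Proof.
move=> sf sg u0; have hu := here_dom u.
have df := smooth_fun_diff sf hu u0; have dg := smooth_fun_diff sg hu u0.
exact: (congr1 (fun h => h a) (diffD df dg)).
Qed.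

Lemma dfun_cst (c : R) u a : dfun (fun _ : tbundle M => c) u a = 0.
Proof. exact: (congr1 (fun h => h a) (diff_cst c _)). Qed.

Lemma dfun_ext f g u a : smooth_fun f -> u.2 != 0 ->
  (forall u', u'.2 != 0 -> f u' = g u') -> dfun g u a = dfun f u a.
Proof.
move=> sf u0 fg; apply: (near_diffE _ (@open_slit _ _ M _) (slit_here u0)).
  by move=> z sz; apply: fg; exact: slit_tparam.
by apply: smooth_fun_diff => //; exact: here_dom.
Qed.

Lemma dfun_act f A u a : smooth_fun f -> vfield A -> u.2 != 0 ->
  dfun (fun u' => dfun f u' (A u')) u a =
  'd (fun z => 'd (f \o tparam (here u)) z (vf_comp (here u) A z)) (tchart (here u) u) a.
Proof.
move=> sf sA u0; have sz := slit_here u0.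
apply: (near_diffE _ (@open_slit _ _ M (here u)) sz).
  by move=> z sz'; rewrite /= dfun_vf.
apply: smooth_differentiable sz.
exact: (smooth_dapp (@findimEE R n) (@open_slit _ _ M _) (sf _) (sA _)).
Qed.

Lemma lie_act f A B u : smooth_fun f -> vfield A -> vfield B -> u.2 != 0 ->
  dfun f u (lie_bracket A B u) = dfun (fun u' => dfun f u' (B u')) u (A u)
    - dfun (fun u' => dfun f u' (A u')) u (B u).
Proof.
move=> sf sA sB u0; have sz := slit_here u0.
rewrite !dfun_act // lie_bracketE /dfun.
apply: etrans (diff_lbr (@findimEE R n) (@findim_R R) (@open_slit _ _ M (here u))
  sz (sf _) (vf_diff sA sz) (vf_diff sB sz)) _.
by rewrite !vf_comp_here.
Qed.

Lemma lieC A B u : lie_bracket A B u = - lie_bracket B A u.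
Proof. by rewrite /lie_bracket opprB. Qed.

Lemma subr_add4 (V : zmodType) (a b c d : V) : (a + b) - (c + d) = (a - c) + (b - d).
Proof. by rewrite opprD addrACA. Qed.

Lemma subr_scale (V : lmodType R) (t : R) (p q r : V) :
  t *: p + q - t *: r = q + t *: (p - r).
Proof. by rewrite scalerBr addrAC addrC. Qed.

Lemma lieD A B C u : vfield B -> vfield C -> u.2 != 0 ->
  lie_bracket A (fun u => B u + C u) u = lie_bracket A B u + lie_bracket A C u.
Proof.
move=> sB sC u0; have sz := slit_here u0.
have E : vf_comp (here u) (fun u => B u + C u) =
    vf_comp (here u) B + vf_comp (here u) C.
  by apply/funext => z; rewrite vf_compE pushD.
have dd := congr1 (fun h => h (A u)) (diffD (vf_diff sB sz) (vf_diff sC sz)).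
have da : 'd (vf_comp (here u) A) (tchart (here u) u) (B u + C u) = _ := linearD _ _ _.
rewrite /lie_bracket E.
exact: etrans (congr2 (fun p q => p - q) dd da) (subr_add4 _ _ _ _).
Qed.

Lemma lieZ A f B u : smooth_fun f -> vfield B -> u.2 != 0 ->
  lie_bracket A (fun u => f u *: B u) u = dfun f u (A u) *: B u + f u *: lie_bracket A B u.
Proof.
move=> sf sB u0; have sz := slit_here u0; have hu := here_dom u.
have E : vf_comp (here u) (fun u => f u *: B u) =
    (fun z => (f \o tparam (here u)) z *: vf_comp (here u) B z).
  by apply/funext => z; rewrite vf_compE pushZ.
rewrite /lie_bracket E.
have da : 'd (vf_comp (here u) A) (tchart (here u) u) (f u *: B u) = _ := linearZ _ _.
have ds := diffS (A u) (smooth_fun_diff sf hu u0) (vf_diff sB sz).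
have e : (f \o tparam (here u)) (tchart (here u) u) = f u by rewrite /= tchartK.
rewrite vf_comp_here e in ds.
exact: etrans (congr2 (fun p q => p - q) ds da) (subr_scale _ _ _ _).
Qed.

Lemma lie_ext A B A' B' u : vfield A -> vfield B -> u.2 != 0 ->
  (forall u', u'.2 != 0 -> A u' = A' u') -> (forall u', u'.2 != 0 -> B u' = B' u') ->
  lie_bracket A' B' u = lie_bracket A B u.
Proof.
move=> sA sB u0 EA EB; have sz := slit_here u0.
have H (D D' : tbundle M -> E * E) a : vfield D -> (forall u', u'.2 != 0 -> D u' = D' u') ->
    'd (vf_comp (here u) D') (tchart (here u) u) a = 'd (vf_comp (here u) D) (tchart (here u) u) a.
  move=> sD ED; apply: (near_diffE _ (@open_slit _ _ M (here u)) sz); last exact: vf_diff.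
  by move=> z sz'; rewrite !vf_compE ED //; exact: slit_tparam.
rewrite /lie_bracket -(EA u u0) -(EB u u0).
exact: (congr2 (fun p q => p - q) (H _ _ _ sB EB) (H _ _ _ sA EA)).
Qed.

Lemma lie_jacobi A B C u : vfield A -> vfield B -> vfield C -> u.2 != 0 ->
  lie_bracket A (lie_bracket B C) u + lie_bracket B (lie_bracket C A) u
  + lie_bracket C (lie_bracket A B) u = 0.
Proof.
move=> sA sB sC u0; have sz := slit_here u0; set h := here u in sz *.
have oS := @open_slit _ _ M h.
have H (P Q S : tbundle M -> E * E) : vfield P -> vfield Q -> vfield S ->
   lie_bracket P (lie_bracket Q S) u =
   lbr (vf_comp h P) (lbr (vf_comp h Q) (vf_comp h S)) (tchart h u).
  move=> sP sQ sS; set l := lbr (vf_comp h Q) _.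
  have sl : smooth_on _ l := smooth_lbr (@findimEE R n) oS (sQ h) (sS h).
  have eq z : slit_chart h z -> l z = vf_comp h (lie_bracket Q S) z.
    by move=> sz'; rewrite vf_comp_lie.
  have e1 := near_diffE (P u) oS sz eq (smooth_differentiable sl sz).
  have e2 : lbr (vf_comp h P) l (tchart h u) =
      'd l (tchart h u) (P u) - 'd (vf_comp h P) (tchart h u) (l (tchart h u)).
    by rewrite {1}/lbr [vf_comp h P (tchart h u)]vf_comp_here.
  apply: etrans _ (esym e2).
  exact: (congr2 (fun p q => p - q) e1
    (congr1 (fun b => 'd (vf_comp h P) (tchart h u) b) (lie_bracketE Q S u))).
by rewrite !H //; exact: (lbr_jacobi (@findimEE R n) oS sz).
Qed.

(** The flat derivative along the fibres, later the abstract [d]. Chart changes act on components by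
    matrices depending only on the base point, so differentiating along a fibre does not see
    them. *)
Definition fib X Y u : E := 'd (pi_comp (here u) Y) (tchart (here u) u) (0, X u).

Lemma diff_fst_vf A u a : vfield A -> u.2 != 0 ->
  ('d (vf_comp (here u) A) (tchart (here u) u) a).1 =
  'd (pi_comp (here u) (rhof A)) (tchart (here u) u) a.
Proof.
move=> sA u0; have sz := slit_here u0; have dA := vf_diff sA sz.
have dfst z : differentiable (fst : E * E -> E) z.
  exact: smooth_differentiable (@smooth_fst R E E setT) I.
have dE z b : 'd (fst : E * E -> E) z b = b.1 by apply: diff_line.
have X := congr1 (fun h => h a) (diff_comp dA (dfst _)).
apply: etrans (esym (dE (vf_comp (here u) A (tchart (here u) u)) _)) _.
apply: etrans (esym X) _; apply: esym.
apply: (near_diffE _ (@open_slit _ _ M (here u)) sz).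
  by move=> z sz'; rewrite pi_comp_rho.
exact: differentiable_comp.
Qed.

Lemma rhof_gamma X u : rhof (gammaf X) u = 0.
Proof. by rewrite /rhof /gammaf gammaE rhoE. Qed.

(** The base component of a vertical field is identically 0, so only the derivative of [A] along
    [gammaf X] contributes. *)
Lemma rho_lie_gamma X A u : pi_field X -> vfield A -> u.2 != 0 ->
  rho u (lie_bracket (gammaf X) A u) = fib X (rhof A) u.
Proof.
move=> sX sA u0; have sz := slit_here u0.
rewrite rhoE /lie_bracket.
rewrite -[LHS]/(('d (vf_comp (here u) A) (tchart (here u) u) (gammaf X u)).1
  - ('d (vf_comp (here u) (gammaf X)) (tchart (here u) u) (A u)).1).
rewrite !diff_fst_vf //; last exact: vfield_gamma.
rewrite /fib /gammaf gammaE.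
have -> : rhof (gammaf X) = (fun=> 0) by apply/funext => v; exact: rhof_gamma.
have -> : pi_comp (here u) (fun _ : tbundle M => 0 : E) = cst 0.
  by apply/funext => z; rewrite pi_compE pi_push0.
exact: etrans (congr1 (fun w => _ - w) (congr1 (fun h => h (A u)) (diff_cst _ _))) (subr0 _).
Qed.

Lemma diff_snd_gamma X u a : pi_field X -> u.2 != 0 ->
  'd (vf_comp (here u) (gammaf X)) (tchart (here u) u) a =
  (0, 'd (pi_comp (here u) X) (tchart (here u) u) a).
Proof.
move=> sX u0; have sz := slit_here u0.
have d0 : differentiable (cst 0 : E * E -> E) (tchart (here u) u) by exact: differentiable_cst.
have dX := pi_diff sX sz.
apply: (etrans (y := 'd (fun z => (cst 0 z, pi_comp (here u) X z)) (tchart (here u) u) a)).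
  apply: (near_diffE _ (@open_slit _ _ M (here u)) sz); last exact: differentiable_pair.
  by move=> z sz'; rewrite vf_comp_gamma.
apply: etrans (congr1 (fun h => h a) (diff_pair d0 dX)) _.
exact: (congr1 (fun w => (w, 'd (pi_comp (here u) X) (tchart (here u) u) a))
  (congr1 (fun h => h a) (diff_cst _ _))).
Qed.

Lemma lie_gamma X Y u : pi_field X -> pi_field Y -> u.2 != 0 ->
  lie_bracket (gammaf X) (gammaf Y) u = gamma u (fib X Y u - fib Y X u).
Proof.
move=> sX sY u0.
have e1 := diff_snd_gamma (0, X u) sY u0; have e2 := diff_snd_gamma (0, Y u) sX u0.
have gX : gammaf X u = (0, X u) := gammaE u (X u).
have gY : gammaf Y u = (0, Y u) := gammaE u (Y u).
rewrite gammaE /lie_bracket gX gY.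
apply: etrans (congr2 (fun p q => p - q) e1 e2) _.
exact: (congr1 (fun w => (w, fib X Y u - fib Y X u)) (subr0 0)).
Qed.

Lemma fib_eta X u : u.2 != 0 -> fib X (@eta R n M) u = X u.
Proof.
move=> u0; have sz := slit_here u0; rewrite /fib.
have dsnd z : differentiable (snd : E * E -> E) z.
  exact: smooth_differentiable (@smooth_snd R E E setT) I.
apply: (etrans (y := 'd snd (tchart (here u) u) (0, X u))).
  apply: (near_diffE _ (@open_slit _ _ M (here u)) sz) => //.
  by move=> _ /slit_cover[w [hw w0 ->]]; rewrite pi_comp_tchart.
by apply: diff_line.
Qed.

End Brackets.

(** * The Finsler metric and its energy *)

Section Metric.
Variables (R : realType) (n : nat) (M : manifold R n).
Local Notation E := 'rV[R]_n.
Implicit Types (i j k : chart_index M) (x : M) (u : tbundle M).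
Implicit Types (f : tbundle M -> R) (X Y Z : tbundle M -> E) (A B C : tbundle M -> E * E).

Lemma diff_curve (V : normedModType R) (f : V -> R) (x v : V) (p : R -> R) p' :
  differentiable f x -> (\forall t \near (0 : R), p t = f (x + t *: v)) ->
  is_derive (0 : R) 1 p p' -> 'd f x v = p'.
Proof.
move=> df pf dp; pose q (t : R) := f (x + t *: v).
have x0 : x + (0 : R) *: v = x by rewrite scale0r addr0.
have dq : is_diff (0 : R) q (fun t => 'd f x (t *: v)).
  have H : is_diff (0 : R) (cst x + *:%R^~ v) (0 + *:%R^~ v) by exact: is_diffD.
  have D : is_diff ((cst x + *:%R^~ v) 0) f ('d f x).
    by rewrite -[(cst x + _) 0]/(x + (0 : R) *: v) x0; split.
  have := is_diff_comp H D; congr (is_diff_def _ _ _).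
  by apply/funext => s /=; rewrite !fctE add0r.
have [dq1 dq2] := dq.
have [_ E'] : is_derive (0 : R) 1 q p' by exact: near_eq_is_derive pf dp.
rewrite -E' (deriveE _ dq1).
by apply: esym; apply: etrans (congr1 (fun h => h 1) dq2) _; rewrite scale1r.
Qed.

Lemma tchart_fibre u y : tchart (here u) (u.1, y) = (chart M (here u) u.1, y).
Proof. by congr pair; apply: dtr_id; exact: here_dom. Qed.

Lemma tchart_hereE u : tchart (here u) u = (chart M (here u) u.1, u.2).
Proof. by case: u => x y; exact: tchart_fibre. Qed.

Lemma fibre_param f u y :
  f (u.1, y) = (f \o tparam (here u)) (chart M (here u) u.1, y).
Proof. by rewrite -tchart_fibre /= tchartK //; exact: (here_dom u). Qed.

Variable L : tbundle M -> R.
Hypothesis FL : finsler L.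
(** Without a factor 1/2, so that its fibre Hessian is twice [fmetric]. *)
Definition energy u : R := L u * L u.

Lemma smooth_energy : smooth_fun energy.
Proof. by apply: smooth_funM; exact: finsler_smooth. Qed.

Lemma is_diff_affine (c y : E) : is_diff y (fun y : E => (c, y)) (fun v => (0, v)).
Proof.
have := @is_diff_pair R E E E (cst c) 0 id id y (is_diff_cst c y) (is_diff_id y).
by [].
Qed.

(** In the chart [here u] the fibre coordinates are those of the identification of the tangent space
    with [E], so derivatives along the fibre are derivatives in directions [(0, v)]. *)
Lemma fmetricE u v w : u.2 != 0 -> fmetric L u v w =
  2^-1 * 'd (fun z => 'd (energy \o tparam (here u)) z (0, w)) (tchart (here u) u) (0, v).
Proof.
move=> u0; rewrite /fmetric; congr (_ * _).
set F := energy \o tparam (here u); set c := chart M (here u) u.1.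
have sF : smooth_on (slit_chart (here u)) F by exact: smooth_energy.
have -> : (fun y => L (u.1, y) ^+ 2) = F \o pair c.
  by apply/funext => y; rewrite /= /F -fibre_param /energy expr2.
have slit_c y : y != 0 -> slit_chart (here u) (c, y).
  by move=> y0; split => //=; exact/img_chart/here_dom.
have D (G : E * E -> R) y w' : differentiable G (c, y) -> 'D_w' (G \o pair c) y = 'd G (c, y) (0, w').
  move=> dG; have [da1 da2] := is_diff_affine c y.
  rewrite deriveE; last exact: differentiable_comp.
  apply: etrans (congr1 (fun h => h w') (diff_comp da1 dG)) _.
  exact: (congr1 (fun b => 'd G (c, y) b) (congr1 (fun h => h w') da2)).
rewrite tchart_hereE -/c.
have N : \forall y \near u.2, 'D_w (F \o pair c) y = ((fun z => 'd F z (0, w)) \o pair c) y.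
  have o0 : open [set y : E | y != 0].
    have -> : [set y : E | y != 0] = ~` [set 0].
      by apply/seteqP; split=> y /= => [/eqP|] H; [exact: H|apply/eqP].
    by rewrite openC; apply: accessible_closed_set1; apply: hausdorff_accessible; exact: norm_hausdorff.
  have : \forall y \near u.2, y != 0 by apply: open_nbhs_nbhs.
  apply: filterS => y y0; rewrite D //.
  by apply: smooth_differentiable sF _; exact: slit_c.
rewrite (near_eq_derive _ N) D //.
by apply: smooth_differentiable (smooth_d (0, w) sF) _; exact: slit_c.
Qed.

Lemma fmetric_linear u a v v' w : u.2 != 0 ->
  fmetric L u (a *: v + v') w = a * fmetric L u v w + fmetric L u v' w.
Proof.
move=> u0; rewrite !fmetricE //.
have -> : (0, a *: v + v') = a *: ((0, v) : E * E) + (0, v').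
  by congr pair; rewrite /= scaler0 addr0.
have half (c p q : R) : c * (a * p + q) = a * (c * p) + c * q by ring.
exact: etrans (congr1 (fun t => 2^-1 * t) (linearP _ _ _ _)) (half _ _ _).
Qed.

(** Differentiating the derivative along [gammaf Y] also differentiates [Y]; [diff_dapp] isolates
    this contribution, which is the term in [fib X Y]. *)
Lemma fmetric_energy X Y u : pi_field X -> pi_field Y -> u.2 != 0 ->
  fmetric L u (X u) (Y u) + fmetric L u (X u) (Y u) =
  dfun (fun u' => dfun energy u' (gammaf Y u')) u (gammaf X u)
  - dfun energy u (gamma u (fib X Y u)).
Proof.
move=> sX sY u0; have sz := slit_here u0.
rewrite fmetricE // -mulrDl -div1r -splitr mul1r.
rewrite dfun_act //; [|exact: smooth_energy|exact: vfield_gamma].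
rewrite /gammaf !gammaE /dfun.
have sF : smooth_on (slit_chart (here u)) (energy \o tparam (here u)) by exact: smooth_energy.
have dF w : differentiable (fun z => 'd (energy \o tparam (here u)) z w) (tchart (here u) u).
  exact: smooth_differentiable (smooth_d w sF) sz.
have dY := vf_diff (vfield_gamma sY) sz.
have E1 := diff_dapp (0, X u) (@findimEE R n) dF dY.
have E2 := diff_snd_gamma (0, X u) sY u0.
have E3 : vf_comp (here u) (gammaf Y) (tchart (here u) u) = (0, Y u).
  by rewrite vf_comp_here /gammaf gammaE.
rewrite E3 in E1.
apply: esym; apply: etrans (congr1 (fun t => t - _) E1) _.
apply: etrans (congr1 (fun b => _ + 'd _ _ b - _) E2) _.
by rewrite addrK.
Qed.

Lemma near_radial : \forall t \near (0 : R), 0 < 1 + t.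
Proof.
near=> t; have : `|t| < 1 by near: t; exact: (@pseudometric_normed_Zmodule.nbhs0_lt R R 1 ltr01).
by rewrite ltr_norml => /andP[h _]; rewrite addrC -ltrBlDr sub0r.
Unshelve. all: by end_near. Qed.

(** The vector [gamma u (eta u)] is the velocity at 0 of [(1 + t) u], and for small [t] the factor
    is positive, as homogeneity requires. *)
Lemma dfun_radial f (p : R -> R) p' u : smooth_fun f -> u.2 != 0 ->
  (forall t, 0 < 1 + t -> f (u.1, (1 + t) *: u.2) = p t) -> is_derive (0 : R) 1 p p' ->
  dfun f u (gamma u (eta u)) = p'.
Proof.
move=> sf u0 E' dp; rewrite gammaE /dfun.
apply: (diff_curve _ _ dp); first by apply: smooth_fun_diff => //; exact: here_dom.
have := near_radial; apply: filterS => t t0; rewrite -E' // fibre_param tchart_hereE.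
by congr (_ _); congr pair; rewrite /= ?scaler0 ?addr0 // scalerDl scale1r.
Qed.

Lemma euler_energy u : u.2 != 0 ->
  dfun energy u (gamma u (eta u)) = energy u + energy u.
Proof.
move=> u0; apply: (dfun_radial (p := fun t => (1 + t) * (1 + t) * energy u)) => //.
- exact: smooth_energy.
- by move=> t t0; rewrite /energy (finsler_homogeneous FL) //; ring.
- have -> : (fun t => (1 + t) * (1 + t) * energy u) = (cst 1 + id) * (cst 1 + id) * cst (energy u).
    by [].
  apply: is_derive_eq.
  rewrite !fctE /cst /=; rewrite /GRing.scale /=; ring.
Qed.

Lemma euler0 f u : smooth_fun f -> u.2 != 0 ->
  (forall (u : tbundle M) (t : R), u.2 != 0 -> 0 < t -> f (u.1, t *: u.2) = f u) ->
  dfun f u (gamma u (eta u)) = 0.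
Proof.
move=> sf u0 hf; apply: (dfun_radial (p := cst (f u))) => //.
by move=> t t0; rewrite hf.
Qed.

End Metric.

(** * Cut-off functions *)

Section Flat.
Variable R : realType.
Implicit Types m : nat.

(* [exp(-1/t)] and its successive derivatives are combinations of these. *)
Definition flat m (t : R) : R := if 0 < t then t^-1 ^+ m * expR (- t^-1) else 0.

Lemma flat_ge0 m t : 0 <= flat m t.
Proof.
by rewrite /flat; case: ifP => // t0; rewrite mulr_ge0 ?expR_ge0 // exprn_ge0 // invr_ge0 ltW.
Qed.

(** From [s^(m+2) / (m+2)! <= exp s] at [s = 1/t]. The quadratic bound is what makes the difference
    quotient at 0 tend to 0. *)
Lemma flat_le m t : flat m t <= (m.+2)`!%:R * t ^+ 2.
Proof.
rewrite /flat; case: ifP => [t0|_]; last by rewrite mulr_ge0 // sqr_ge0.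
have s0 : 0 <= t^-1 by rewrite invr_ge0 ltW.
have h := expR_ge1Dxn m.+1 s0.
have h' : t^-1 ^+ m.+2 <= (m.+2)`!%:R * expR t^-1.
  rewrite mulrC -ler_pdivrMr ?ltr0n ?fact_gt0 //; apply: le_trans h.
  by rewrite lerDr.
rewrite expRN ler_pdivrMr ?expR_gt0 // mulrAC -ler_pdivrMr ?exprn_gt0 //.
by rewrite -exprVn -exprD addn2.
Qed.

Lemma is_derive_invX m (t : R) : t != 0 ->
  is_derive t 1 (fun s : R => s^-1 ^+ m) (- m%:R * t^-1 ^+ m.+1).
Proof.
move=> t0; elim: m => [|m IH].
  by rewrite oppr0 mul0r; apply: is_derive_cst.
have dV : is_derive t 1 (fun s : R => s^-1) (- t^-1 ^+ 2).
  have D : derivable (fun s : R => s^-1) t 1.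
    by apply/derivable1_diffP; apply: differentiable_Rinv.
  apply: DeriveDef => //; rewrite deriveE; last exact/derivable1_diffP.
  by rewrite diff_Rinv // exprVn /GRing.scale /= mulr1.
have -> : (fun s : R => s^-1 ^+ m.+1) = (fun s : R => s^-1) * (fun s => s^-1 ^+ m).
  by apply/funext => s; rewrite exprS.
apply: is_derive_eq.
by rewrite /GRing.scale /= -natr1 !exprS; ring.
Qed.

(** Differentiation stays within the family, so [Ck_flat] is an induction on the order. *)
Lemma is_derive_flat m (t : R) : is_derive t 1 (flat m) (flat m.+2 t - m%:R * flat m.+1 t).
Proof.
have [t0|t0|<-] := ltgtP 0 t.
- have tn0 : t != 0 by rewrite gt_eqF.
  have N : \near t, t^-1 ^+ m * expR (- t^-1) = flat m t.
    have : \forall s \near t, 0 < s by apply: open_nbhs_nbhs; split => //; exact: open_gt.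
    by apply: filterS => s s0; rewrite /flat s0.
  apply: (near_eq_is_derive N).
  have d1 := is_derive_invX m tn0; have d2 := is_derive_invX 1 tn0.
  have d3 : is_derive t 1 (fun s : R => - s^-1 ^+ 1) (t^-1 ^+ 2).
    by apply: is_derive_eq; rewrite mulN1r opprK.
  have d4 := @is_derive1_comp R expR (fun s : R => - s^-1 ^+ 1) t _ _ (is_derive_expR _) d3.
  have -> : (fun s : R => s^-1 ^+ m * expR (- s^-1)) =
    (fun s : R => s^-1 ^+ m) * (expR \o (fun s : R => - s^-1 ^+ 1)) by [].
  apply: is_derive_eq.
  by rewrite /flat t0 /GRing.scale /= expr1 !exprS; ring.
- have N : \near t, (cst 0 : R -> R) t = flat m t.
    have : \forall s \near t, s < 0 by apply: open_nbhs_nbhs; split => //; exact: open_lt.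
    by apply: filterS => s s0; rewrite /flat ltNge ltW.
  apply: (near_eq_is_derive N); apply: is_derive_eq.
  by rewrite /flat !ltNge !ltW //= mulr0 subr0.
have E0 k : flat k 0 = 0 by rewrite /flat ltxx.
rewrite !E0 mulr0 subr0.
have C : (fun h : R => h^-1 *: ((flat m \o shift 0) (h *: 1) - flat m 0)) @ 0^' --> (0 : R).
  apply/cvgr0Pnorm_le => e e0; near=> h.
  have h0 : h != 0 by near: h; exact: nbhs_dnbhs_neq.
  rewrite /= E0 subr0 addr0 [_%:A]mulr1 normrZ normfV (ger0_norm (flat_ge0 _ _)).
  rewrite ler_pdivrMl ?normr_gt0 //; apply: le_trans (flat_le _ _) _.
  rewrite -(real_normK (num_real h)) expr2 mulrCA ler_pM2l ?normr_gt0 //.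
  rewrite -ler_pdivlMl ?ltr0n ?fact_gt0 //; near: h.
  apply: dnbhs0_le; rewrite mulr_gt0 // invr_gt0 ltr0n fact_gt0 //.
by apply: DeriveDef; [apply/cvg_ex; exists 0|exact: cvg_lim].
Unshelve. all: by end_near. Qed.

Lemma Ck_flat k m (U : set R) : Ck k U (flat m).
Proof.
apply: (@Ck_sub R R R k setT) => //.
elim: k m => [|k IH] m.
  by move=> t _; apply: differentiable_continuous; apply/derivable1_diffP; have [] := is_derive_flat m t.
split=> [t _|v]; first by apply/derivable1_diffP; have [] := is_derive_flat m t.
have C := CkZ openT (Ck_cst k setT v)
  (CkD openT (IH m.+2) (CkZ openT (Ck_cst k setT (- m%:R : R)) (IH m.+1))).
apply: Ck_ext C; first exact: openT.
move=> t _; have [d1 d2] := is_derive_flat m t.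
have df : differentiable (flat m) t by apply/derivable1_diffP.
rewrite -[v in RHS]mulr1 [RHS]linearZ -(deriveE _ df) d2.
by rewrite /cst /GRing.scale /= mulNr.
Qed.

Lemma Ck_local (V W : normedModType R) k (U : set V) (f : V -> W) :
  (forall x, U x -> Ck k [set x] f) -> Ck k U f.
Proof.
elim: k f => [|k IH] f H; first by move=> x Ux; exact: (H x Ux).
split=> [x Ux|v]; first by have [D _] := H x Ux; exact: D.
by apply: IH => x Ux; have [_ ] := H x Ux; exact.
Qed.

Lemma smooth_local (V W : normedModType R) (U : set V) (f : V -> W) :
  (forall x, U x -> exists U', [/\ open U', U' x & smooth_on U' f]) -> smooth_on U f.
Proof.
move=> H k; apply: Ck_local => x /H[U' [_ Ux sf]].
by apply: Ck_sub (sf k) => _ ->.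
Qed.

Lemma smooth_coord n (i : 'I_n) (U : set 'rV[R]_n) : smooth_on U (fun z : 'rV[R]_n => z 0 i).
Proof.
have lin : linear (fun v : 'rV[R]_n => v 0 i) by move=> a u v; rewrite !mxE.
pose p : {linear 'rV[R]_n -> R} := HB.pack (fun v : 'rV[R]_n => v 0 i)
  (GRing.isLinear.Build _ _ _ _ _ lin).
exact: (@smooth_lin _ _ _ U p (findim_rV R n)).
Qed.

(** A bump in the chart, extended by 0. It is nonzero only inside the image of a closed ball, which
    is compact and therefore closed since the manifold is Hausdorff; this is why the extension
    vanishes near every point outside the domain of the chart. *)
Lemma cutoff n (M : manifold R n) i (x0 : M) : dom M i x0 ->
  exists chi : M -> R, [/\ chi x0 != 0,
    forall j, smooth_on (img (M := M) j) (chi \o param M j) &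
    forall x, ~ dom M i x -> \forall y \near x, chi y = 0].
Proof.
move=> ix0; pose c := chart M i x0.
have /nbhs_ballP [e /= e0 eI] : nbhs c (img (M := M) i).
  by apply: open_nbhs_nbhs; split; [exact: open_img|exact: img_chart].
pose r := e / 2; have r0 : 0 < r by rewrite divr_gt0.
(* The Euclidean distance is used for its smooth square; where [s] is positive the sup norm is also
   at most [r], and [r = e / 2] keeps the closed ball inside the chart. *)
pose s (z : 'rV[R]_n) : R := r ^+ 2 - \sum_a (z 0 a - c 0 a) * (z 0 a - c 0 a).
pose K' : set 'rV[R]_n := [set z | `|c - z| <= r].
have sK z : 0 < s z -> K' z.
  move=> sz; rewrite /K' /= [`|_|]mx_normrE; apply: bigmax_le; first exact: ltW.
  move=> [i0 a] _ /=; rewrite !mxE (ord1 i0) distrC.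
  rewrite -(@ler_pXn2r _ 2) ?nnegrE ?(ltW r0) ?normr_ge0 // real_normK ?num_real //.
  move: sz; rewrite /s subr_gt0 => /ltW; apply: le_trans.
  rewrite (bigD1 a) //= expr2 lerDl; apply: sumr_ge0 => b _.
  by rewrite -expr2 sqr_ge0.
have KI z : K' z -> img (M := M) i z.
  move=> zK; apply: eI; rewrite -ball_normE /=; apply: le_lt_trans zK _.
  by rewrite /r ltr_pdivrMr // ltr_pMr // ltr1n.
have cK : compact K'.
  apply: bounded_closed_compact.
    exists (`|c| + r); split; first exact: num_real.
    move=> y /ltW ry z zK; apply: le_trans ry.
    rewrite -[z](subKr c); apply: le_trans (ler_normB _ _) _.
    by rewrite lerD2l.
  have -> : K' = closed_ball c r by rewrite closed_ballE.
  exact: closed_ball_closed.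
pose K := param M i @` K'.
have clK : closed K.
  apply: compact_closed; first exact: manifold_hausdorff.
  apply: continuous_compact => //.
  apply: continuous_in_subspaceT => z; rewrite inE => /KI; exact: continuous_param.
have Kd x : K x -> dom M i x by move=> [z /KI iz <-]; exact: (img_param iz).1.
pose chi (x : M) : R := if `[< dom M i x >] then flat 0 (s (chart M i x)) else 0.
have chiK x : chi x != 0 -> K x.
  rewrite /chi; case: asboolP => [ix|]; last by rewrite eqxx.
  rewrite /flat; case: ifP => [sx _|]; last by rewrite eqxx.
  by exists (chart M i x); [exact: sK|exact: chartK].
have off x : ~ dom M i x -> \forall y \near x, chi y = 0.
  move=> nix; have : nbhs x (~` K).
    by apply: open_nbhs_nbhs; split; [rewrite openC|move=> /Kd].
  apply: filterS => y nKy; apply/eqP; apply: contrapT => /negP c0.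
  by apply: nKy; apply: chiK.
exists chi; split => //.
  rewrite /chi asboolT // /flat -/c /s big1; last by move=> a _; rewrite subrr mul0r.
  by rewrite subr0 exprn_gt0 // expr0 mul1r gt_eqF // expR_gt0.
move=> j; apply: smooth_local => z jz.
have [ix|nix] := pselect (dom M i (param M j z)).
  exists (ovl j i); split; [exact: open_ovl|exact/ovlE|].
  apply: (smooth_ext (f := flat 0 \o (s \o transition j i))); first exact: open_ovl.
    by move=> y /ovlE[jy iy]; rewrite /= /chi asboolT.
  have oT := @openT (R : topologicalType).
  have oV := @openT ('rV[R]_n : topologicalType).
  have ss : smooth_on setT s.
    apply: smoothB => //; first exact: smooth_cst.
    apply: smooth_sum => // a.
    by apply: smoothM => //; apply: smoothB => //; [exact: smooth_coord|exact: smooth_cst|exact: smooth_coord|exact: smooth_cst].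
  apply: (smooth_comp (U' := setT) (@findim_R R) (@open_ovl _ _ M j i) oT) => //.
    by apply: (smooth_comp (U' := setT) (findim_rV R n) (@open_ovl _ _ M j i) oV) => //; exact: smooth_tr.
  by move=> k; exact: Ck_flat.
have N : nbhs z [set y | chi (param M j y) = 0] by exact: (continuous_param jz (off _ nix)).
exists ([set y | chi (param M j y) = 0]^°); split; [exact: open_interior|exact: N|].
apply: (smooth_ext (f := cst 0)); [exact: open_interior| |exact: smooth_cst].
by move=> y /interior_subset /= ->.
Qed.

End Flat.

(** * Existence of fields and horizontal lifts *)

Section SmoothMatrix.
Variables (R : realType) (V : normedModType R) (U : set V).
Hypothesis oU : open U.

Lemma smooth_bigsum (I : Type) (r : seq I) (P : pred I) (f : I -> V -> R) :
  (forall i, smooth_on U (f i)) -> smooth_on U (fun x => \sum_(i <- r | P i) f i x).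
Proof.
move=> sf; elim: r => [|i r IH].
  have -> : (fun x => \sum_(i <- [::] | P i) f i x) = cst 0 by apply/funext=> x; rewrite big_nil.
  exact: smooth_cst.
have -> : (fun x => \sum_(j <- i :: r | P j) f j x) =
    (fun x => (if P i then f i x else 0) + \sum_(j <- r | P j) f j x).
  by apply/funext => x; rewrite big_cons; case: ifP; rewrite ?add0r.
apply: smoothD => //; case: (P i); [exact: sf|exact: smooth_cst].
Qed.

Lemma smooth_bigprod (I : Type) (r : seq I) (P : pred I) (f : I -> V -> R) :
  (forall i, smooth_on U (f i)) -> smooth_on U (fun x => \prod_(i <- r | P i) f i x).
Proof.
move=> sf; elim: r => [|i r IH].
  have -> : (fun x => \prod_(i <- [::] | P i) f i x) = cst 1 by apply/funext=> x; rewrite big_nil.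
  exact: smooth_cst.
have -> : (fun x => \prod_(j <- i :: r | P j) f j x) =
    (fun x => (if P i then f i x else 1) * \prod_(j <- r | P j) f j x).
  by apply/funext => x; rewrite big_cons; case: ifP; rewrite ?mul1r.
apply: smoothM => //; case: (P i); [exact: sf|exact: smooth_cst].
Qed.

Lemma smooth_det n (A : V -> 'M[R]_n) :
  (forall i j, smooth_on U (fun x => A x i j)) -> smooth_on U (fun x => \det (A x)).
Proof.
move=> sA; apply: smooth_bigsum => s; apply: smoothM => //; first exact: smooth_cst.
by apply: smooth_bigprod => i.
Qed.

Lemma smooth_invmx n (A : V -> 'M[R]_n) (i j : 'I_n) : (forall x, U x -> A x \in unitmx) ->
  (forall i j, smooth_on U (fun x => A x i j)) -> smooth_on U (fun x => invmx (A x) i j).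
Proof.
move=> uA sA; apply: (smooth_ext (f := fun x => (\det (A x))^-1 * cofactor (A x) j i)) => //.
  by move=> x Ux; rewrite /invmx uA // mxE [in RHS]mxE.
apply: smoothM => //.
  apply: smoothV => //; last exact: smooth_det.
  by move=> x Ux; rewrite -unitfE; exact: uA.
rewrite /cofactor; apply: smoothM => //; first exact: smooth_cst.
apply: smooth_det => a b.
have -> : (fun x => row' j (col' i (A x)) a b) = (fun x => A x (lift j a) (lift i b)).
  by apply/funext => x; rewrite !mxE.
exact: sA.
Qed.

Lemma smooth_row n (w : V -> 'rV[R]_n) :
  (forall b, smooth_on U (fun x => w x 0 b)) -> smooth_on U w.
Proof.
move=> sw; apply: (smooth_ext (f := fun x => \sum_b w x 0 b *: delta_mx 0 b)) => //.
  by move=> x _; rewrite -row_sum_delta.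
by apply: smooth_sum => // b; apply: smoothZ => //; exact: smooth_cst.
Qed.

Lemma smooth_entry n (w : V -> 'rV[R]_n) b :
  smooth_on U w -> smooth_on U (fun x => w x 0 b).
Proof.
move=> sw; apply: (smooth_comp (U' := setT) (findim_rV R n) oU openT (f := w)
  (h := fun v : 'rV[R]_n => v 0 b)) => //; exact: smooth_coord.
Qed.

End SmoothMatrix.

Section Frames.
Variables (R : realType) (n : nat) (M : manifold R n).
Local Notation E := 'rV[R]_n.
Implicit Types (i j k : chart_index M) (x : M) (u : tbundle M).
Implicit Types (f : tbundle M -> R) (X Y Z : tbundle M -> E) (A B C : tbundle M -> E * E).

Definition pull i u (a : E * E) : E * E := 'd (ttr i (here u)) (tchart i u) a.

Lemma push_pull i u a : dom M i u.1 -> push i u (pull i u a) = a.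
Proof.
move=> iu; apply: etrans (dttr_comp a iu (here_dom u) iu) _; exact: dttr_id.
Qed.

Lemma push_pull2 i j u a : dom M i u.1 -> dom M j u.1 ->
  push j u (pull i u a) = 'd (ttr i j) (tchart i u) a.
Proof. by move=> iu ju; apply: dttr_comp => //; exact: here_dom. Qed.

(** The field with constant components [a] in the chart [i], made global by a cut-off. *)
Definition bumpv (chi : M -> R) i (a : E * E) u : E * E := chi u.1 *: pull i u a.

Lemma bumpv_linear chi i t a b u :
  bumpv chi i (t *: a + b) u = t *: bumpv chi i a u + bumpv chi i b u.
Proof.
have e : pull i u (t *: a + b) = t *: pull i u a + pull i u b := linearP _ _ _ _.
by rewrite /bumpv e scalerDr !scalerA mulrC.
Qed.

Lemma smooth_chi chi j : (forall j, smooth_on (img (M := M) j) (chi \o param M j)) ->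
  smooth_on (slit_chart j) (fun z : E * E => chi (param M j z.1) : R).
Proof.
move=> sc; apply: (smooth_comp (findim_rV R n) (@open_slit _ _ M j) (@open_img _ _ M j)
   (f := fst) (h := chi \o param M j)) => //; [by move=> z [] | exact: smooth_fst].
Qed.

Lemma vfield_bumpv chi i a : (forall j, smooth_on (img (M := M) j) (chi \o param M j)) ->
  (forall x, ~ dom M i x -> \forall y \near x, chi y = 0) ->
  vfield (bumpv chi i a).
Proof.
move=> sc off j; apply: smooth_local => z sz; have oS := @open_slit _ _ M j.
have [iz|niz] := pselect (dom M i (param M j z.1)).
  pose U : set (E * E) := slit_chart j `&` tovl j i.
  have oU : open U by apply: openI => //; exact: open_tovl.
  exists U; split => //.
    by split => //; apply/ovlE; split => //; case: sz.
  apply: (smooth_ext (f := fun z => chi (param M j z.1) *: 'd (ttr i j) (ttr j i z) a)) => //.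
    move=> _ [/slit_cover[u [ju u0 ->]] [x [jx ix] Ex]].
    have iu : dom M i u.1 by rewrite -(chartK ju) -[chart _ _ _]/((tchart j u).1) -Ex (chartK jx).
    rewrite (ttr_tchart _ ju) vf_comp_tchart // /bumpv pushZ push_pull2 //=.
    by rewrite (chartK ju).
  apply: smoothZ => //; first by apply: smooth_sub (@smooth_chi chi j sc); exact: subIsetl.
  apply: (smooth_comp (@findimEE R n) oU (@open_tovl _ _ M i j) (f := ttr j i)
     (h := fun z => 'd (ttr i j) z a)).
  - move=> y [_ ty]; change (ovl i j (ttr j i y).1); rewrite (congr1 fst (ttrE ty)).
    case: ty => x [jx ix] <-; rewrite /= transition_chart //; exact: ovl_chart.
  - by apply: smooth_sub (@smooth_ttr _ _ M j i); exact: subIsetr.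
  - by apply: smooth_d; exact: smooth_ttr.
have N : nbhs z ((fun z : E * E => param M j z.1) @^-1` [set y | chi y = 0]).
  have c1 : {for z, continuous (fun z : E * E => param M j z.1)}.
    apply: (continuous_comp (f := fst) (g := param M j)); first exact: cvg_fst.
    by apply: continuous_param; case: sz.
  exact: (c1 _ (off _ niz)).
exists (((fun z : E * E => param M j z.1) @^-1` [set y | chi y = 0])^°).
split; [exact: open_interior|exact: N|].
apply: (smooth_ext (f := cst 0)); [exact: open_interior| |exact: smooth_cst].
move=> y /interior_subset /= cy; rewrite vf_compE /bumpv /= cy scale0r.
by have e : push j (tparam j y) 0 = 0 := linear0 _.
Qed.

(** Lets identities between global fields be read at one point on arbitrary vectors. The cut-off is
    only known to be nonzero at the point, whence the factor [(chi u.1)^-1]. *)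
Lemma pi_field_at u v : u.2 != 0 -> exists X : tbundle M -> E, pi_field X /\ X u = v.
Proof.
move=> u0; have [chi [c0 sc off]] := cutoff (here_dom u).
pose A := bumpv chi (here u) ((chi u.1)^-1 *: (v, 0)).
have sA : vfield A by exact: vfield_bumpv.
exists (rhof A); split; first exact: pi_field_rho.
have e : pull (here u) u ((chi u.1)^-1 *: (v, 0)) = _ := dttr_id _ (here_dom u).
by rewrite /rhof rhoE /A /bumpv e scalerA mulfV // scale1r.
Qed.

Variable nabla : tbundle M -> E * E -> (tbundle M -> E) -> E.
Hypothesis cn : connection nabla.
Hypothesis rn : regular nabla.

Lemma K_linear u t a b : u.2 != 0 ->
  connection_map nabla u (t *: a + b) = t *: connection_map nabla u a + connection_map nabla u b.
Proof. by move=> u0; apply: nabla_linear => //; exact: pi_field_eta. Qed.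

Lemma K0 u : u.2 != 0 -> connection_map nabla u 0 = 0.
Proof.
move=> u0; have := K_linear (-1) 0 0 u0.
by rewrite scaler0 addr0 scaleN1r addNr.
Qed.

Lemma KZ u t a : u.2 != 0 -> connection_map nabla u (t *: a) = t *: connection_map nabla u a.
Proof. by move=> u0; rewrite -[t *: a]addr0 K_linear // K0 // addr0. Qed.

Lemma vertical_horizontal_eq0 u a : u.2 != 0 -> a.1 = 0 -> connection_map nabla u a = 0 -> a = 0.
Proof.
move=> u0 a1 Ka; have [_ VH] := rn u0.
have : (vertical u `&` horizontal nabla u) a by split=> //; rewrite /vertical /= rhoE.
by rewrite VH.
Qed.

Lemma betaP u v a : u.2 != 0 -> connection_map nabla u a = 0 -> a.1 = v -> beta nabla u v = a.
Proof.
move=> u0 Ka a1.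
have ex : [set A | horizontal nabla u A /\ rho u A = v] a by split; [|rewrite rhoE].
have [Kb b1] := xgetPex 0 (ex_intro _ a ex); rewrite -/(beta nabla u v) in Kb b1 *.
rewrite rhoE in b1.
apply/eqP; rewrite -subr_eq0; apply/eqP; apply: (vertical_horizontal_eq0 u0).
  by rewrite /= b1 -a1 subrr.
by rewrite addrC -scaleN1r K_linear // Ka Kb scaler0 addr0.
Qed.

Lemma beta_spec u v : u.2 != 0 ->
  connection_map nabla u (beta nabla u v) = 0 /\ (beta nabla u v).1 = v.
Proof.
move=> u0; have [sp _] := rn u0; have [B [C [vB hC E']]] := sp (v, 0).
have C1 : C.1 = v.
  move: vB; rewrite /vertical /= rhoE => B1.
  by have := congr1 fst E'; rewrite /= B1 add0r.
by rewrite (betaP u0 hC C1).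
Qed.

(* Cramer's rule: the vertical part of a horizontal lift solves a linear system
   whose matrix, that of [K] on vertical vectors, is smooth and invertible. *)
Lemma vfield_beta X : pi_field X -> vfield (betaf nabla X).
Proof.
move=> sX j; apply: smooth_local => z0 sz0; have oS := @open_slit _ _ M j.
have jx0 : dom M j (param M j z0.1) by exact: (img_param (slit_img sz0)).1.
have [chi [c0 sc off]] := cutoff jx0.
have schi := @smooth_chi chi j sc.
pose G : set (E * E) := [set z | chi (param M j z.1) != 0].
have G0 : nbhs z0 G.
  have cc : {for z0, continuous (fun z : E * E => chi (param M j z.1) : R)}.
    exact: (schi 0%N _ sz0).
  have oR : open [set t : R | t != 0].
    have -> : [set t : R | t != 0] = ~` [set 0].
      by apply/seteqP; split=> y /= => [/eqP|] H; [exact: H|apply/eqP].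
    by rewrite openC; apply: accessible_closed_set1; apply: hausdorff_accessible; exact: norm_hausdorff.
  by apply: (cc [set t : R | t != 0]); apply: open_nbhs_nbhs.
pose U : set (E * E) := slit_chart j `&` G^°.
have oU : open U by apply: openI => //; exact: open_interior.
have US : U `<=` slit_chart j by exact: subIsetl.
exists U; split => //.
(* [nabla_smooth] accepts only global fields, so the coordinate fields of the chart [j] are cut off,
   and the system is solved where [chi] is nonzero. *)
pose kk a (z : E * E) : E := pi_comp j (fun u => connection_map nabla u (bumpv chi j a u)) z.
have skk a : smooth_on U (kk a).
  apply: smooth_sub US _; apply: (nabla_smooth cn) => //; last exact: pi_field_eta.
  exact: vfield_bumpv.
have kk_linear t a b z : slit_chart j z -> kk (t *: a + b) z = t *: kk a z + kk b z.
  move=> sz; rewrite /kk !pi_compE bumpv_linear K_linear ?pi_pushD ?pi_pushZ //.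
  exact: slit_tparam.
have lin z : slit_chart j z -> linear (fun w : E => kk (0, w) z).
  move=> sz t v w; rewrite -kk_linear //; congr (kk _ _).
  by congr pair; rewrite /= scaler0 addr0.
have lin' z : slit_chart j z -> linear (fun w : E => kk (w, 0) z).
  move=> sz t v w; rewrite -kk_linear //; congr (kk _ _).
  by congr pair; rewrite /= scaler0 addr0.
pose Mx z : 'M[R]_n := \matrix_(a, b) kk (0, delta_mx 0 a) z 0 b.
have MxE z w : slit_chart j z -> w *m Mx z = kk (0, w) z.
  move=> sz; pose f : {linear E -> E} := HB.pack (fun w : E => kk (0, w) z)
    (GRing.isLinear.Build _ _ _ _ _ (lin z sz)).
  have -> : Mx z = lin1_mx f by apply/matrixP => a b; rewrite !mxE.
  exact: mul_rV_lin1.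
pose r z : E := \sum_a pi_comp j X z 0 a *: kk (delta_mx 0 a, 0) z.
have rE z : slit_chart j z -> r z = kk (pi_comp j X z, 0) z.
  move=> sz; pose f : {linear E -> E} := HB.pack (fun w : E => kk (w, 0) z)
    (GRing.isLinear.Build _ _ _ _ _ (lin' z sz)).
  rewrite /r -[RHS]/(f _) [in RHS](row_sum_delta (pi_comp j X z)) linear_sum.
  by apply: eq_bigr => a _; rewrite linearZ.
have unit z : U z -> Mx z \in unitmx.
  move=> [/slit_cover[u [ju u0 ->]] /interior_subset]; rewrite /G /= (chartK ju) => cu.
  (* A kernel vector would be both vertical and horizontal. *)
  rewrite -row_free_unit; apply: inj_row_free => w.
  rewrite MxE; last exact: slit_tchart.
  rewrite /kk pi_comp_tchart // => /eqP; rewrite push_neq0 // /bumpv KZ //.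
  rewrite scaler_eq0 (negPf cu) /= => /eqP Kw.
  have p1 : (pull j u (0, w)).1 = 0.
    by rewrite (congr1 fst (dttr_vert w ju (here_dom u))).
  have := congr1 (push j u) (vertical_horizontal_eq0 u0 p1 Kw).
  rewrite push_pull // => /(congr1 snd) /= ->.
  by have e : push j u 0 = 0 := linear0 _; rewrite e.
have sXc : smooth_on U (pi_comp j X) by exact: smooth_sub US (sX j).
have sr : smooth_on U r.
  by apply: smooth_sum => // a; apply: smoothZ => //; exact: smooth_entry.
(* The vertical correction: it solves [kk (X, 0) + kk (0, w) = 0]. *)
pose w z : E := - (r z *m invmx (Mx z)).
have sw : smooth_on U w.
  apply: smooth_row => // b.
  apply: (smooth_ext (f := fun z => (-1) * \sum_a r z 0 a * invmx (Mx z) a b)) => //.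
    by move=> z _; rewrite !mxE mulN1r.
  apply: smoothM => //; first exact: smooth_cst.
  apply: smooth_sum => // a; apply: smoothM => //; first exact: smooth_entry.
  apply: smooth_invmx => // c d.
  apply: (smooth_ext (f := fun z => kk (0, delta_mx 0 c) z 0 d)) => //.
    by move=> z _; rewrite mxE.
  exact: smooth_entry.
apply: smooth_ext (smooth_pair oU sXc sw) => // z Uz.
have uz := unit _ Uz; have sz := US _ Uz; case: Uz => _ /interior_subset Gz.
have [u [ju u0 Ez]] := slit_cover sz.
have cu : chi u.1 != 0 by move: Gz; rewrite Ez /G /= (chartK ju).
rewrite vf_compE /betaf; set a := (_, _).
have Eu : tparam j z = u by rewrite Ez tchartK.
rewrite Eu; suff -> : beta nabla u (X u) = pull j u a by rewrite push_pull.
apply: betaP => //.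
  have : kk a z = 0.
    have -> : a = 1 *: (pi_comp j X z, 0) + (0, w z).
      by rewrite scale1r /a; congr pair; rewrite /= ?addr0 ?add0r.
    by rewrite kk_linear // scale1r -rE // -MxE // /w mulNmx mulmxKV // subrr.
  rewrite /kk pi_compE Eu => /eqP; rewrite push_neq0 // /bumpv KZ //.
  by rewrite scaler_eq0 (negPf cu) => /eqP.
have e : pi_push j u (pull j u a).1 = pi_push j u (X u).
  by rewrite -push_fst // push_pull // /a /= Ez pi_comp_tchart.
apply/eqP; rewrite -subr_eq0 -(push_neq0 _ ju).
have -> : pi_push j u ((pull j u a).1 - X u) = pi_push j u (pull j u a).1 - pi_push j u (X u).
  exact: linearB.
by rewrite e subrr.
Qed.

End Frames.

(** * The ring of functions and its modules of fields *)

Section Slit.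
Variables (R : realType) (n : nat) (M : manifold R n).
Local Notation E := 'rV[R]_n.

(** Equalities such as [s_rho (s_bet X) = X] hold only off the zero section, so ring and module
    elements are functions on [slit]. They return to total functions through [ext], which puts 0 on
    the zero section. *)
Definition slit := {u : tbundle M | u.2 != 0}.

Definition ext (W : zmodType) (f : slit -> W) (u : tbundle M) : W :=
  oapp f 0 (insub u).

Lemma extE (W : zmodType) (f : tbundle M -> W) u : u.2 != 0 ->
  ext (fun t => f (val t)) u = f u.
Proof. by move=> u0; rewrite /ext insubT. Qed.

Lemma ext_val (W : zmodType) (f : slit -> W) t : ext f (val t) = f t.
Proof. by rewrite /ext valK. Qed.

Lemma extD (W : zmodType) (f g : slit -> W) : ext (f + g) = fun u => ext f u + ext g u.
Proof. by apply/funext => u; rewrite /ext; case: insub => //=; rewrite addr0. Qed.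

Lemma extN (W : zmodType) (f : slit -> W) : ext (- f) = fun u => - ext f u.
Proof. by apply/funext => u; rewrite /ext; case: insub => //=; rewrite oppr0. Qed.

Lemma ext0 (W : zmodType) : ext (0 : slit -> W) = fun=> 0.
Proof. by apply/funext => u; rewrite /ext; case: insub. Qed.

Lemma extM (f g : slit -> R) : ext (f * g) = fun u => ext f u * ext g u.
Proof. by apply/funext => u; rewrite /ext; case: insub => //=; rewrite mulr0. Qed.

Definition slitfun_pred : {pred slit -> R} := fun f => `[< smooth_fun (ext f) >].
Definition slitpi_pred : {pred slit -> E} := fun X => `[< pi_field (ext X) >].
Definition slitvf_pred : {pred slit -> E * E} := fun A => `[< vfield (ext A) >].

Lemma slitfun_closed : subring_closed slitfun_pred.
Proof.
have smN (f : slit -> R) : smooth_fun (ext f) -> smooth_fun (ext (- f)).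
  move=> sf; apply: smooth_fun_ext (smooth_funM (@smooth_fun_cst R n M (-1)) sf) => u _.
  by rewrite extN mulN1r.
split=> [|f g /asboolP sf /asboolP sg|f g /asboolP sf /asboolP sg]; apply/asboolP.
- apply: smooth_fun_ext (@smooth_fun_cst R n M 1) => u u0.
  exact: (esym (extE (cst (1 : R)) u0)).
- rewrite extD; apply: smooth_funD => //; exact: smN.
- by rewrite extM; exact: smooth_funM.
Qed.

Record slitfun := Sfun { slitfun_val :> slit -> R ; _ : slitfun_val \in slitfun_pred }.
HB.instance Definition _ := [isSub for slitfun_val].
HB.instance Definition _ := [Choice of slitfun by <:].
HB.instance Definition _ := GRing.SubChoice_isSubComPzRing.Build _ _ slitfun slitfun_closed.

Lemma slitpi_closed : zmod_closed slitpi_pred.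
Proof.
split=> [|X Y /asboolP sX /asboolP sY]; apply/asboolP.
  by rewrite ext0; exact: pi_field0.
rewrite extD extN; apply: pi_fieldD => //.
apply: pi_field_ext (pi_fieldZ (@smooth_fun_cst R n M (-1)) sY) => u _.
by rewrite scaleN1r.
Qed.

Record slitpi := Spi { slitpi_val :> slit -> E ; _ : slitpi_val \in slitpi_pred }.
HB.instance Definition _ := [isSub for slitpi_val].
HB.instance Definition _ := [Choice of slitpi by <:].
HB.instance Definition _ := GRing.SubChoice_isSubZmodule.Build _ _ slitpi slitpi_closed.

Lemma slitvf_closed : zmod_closed slitvf_pred.
Proof.
split=> [|A B /asboolP sA /asboolP sB]; apply/asboolP.
  rewrite ext0; apply: (vfield_ext (A := gammaf (fun _ : tbundle M => 0))).
    by move=> u _; rewrite /gammaf gammaE.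
  by apply: vfield_gamma; exact: pi_field0.
rewrite extD extN; apply: vfieldD => //.
apply: vfield_ext (vfieldZ (@smooth_fun_cst R n M (-1)) sB) => u _.
by rewrite scaleN1r.
Qed.

Record slitvf := Svf { slitvf_val :> slit -> E * E ; _ : slitvf_val \in slitvf_pred }.
HB.instance Definition _ := [isSub for slitvf_val].
HB.instance Definition _ := [Choice of slitvf by <:].
HB.instance Definition _ := GRing.SubChoice_isSubZmodule.Build _ _ slitvf slitvf_closed.

Definition ff (f : slitfun) : tbundle M -> R := ext f.
Definition xx (X : slitpi) : tbundle M -> E := ext X.
Definition aa (A : slitvf) : tbundle M -> E * E := ext A.

Lemma ffP f : smooth_fun (ff f).
Proof. by case: f => p sp; exact: (asboolW sp). Qed.
Lemma xxP X : pi_field (xx X).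
Proof. by case: X => p sp; exact: (asboolW sp). Qed.
Lemma aaP A : vfield (aa A).
Proof. by case: A => p sp; exact: (asboolW sp). Qed.

Lemma mkf_subproof f : smooth_fun f -> (fun t : slit => f (val t)) \in slitfun_pred.
Proof. by move=> sf; apply/asboolP; apply: smooth_fun_ext sf => u u0; rewrite extE. Qed.
Lemma mkx_subproof X : pi_field X -> (fun t : slit => X (val t)) \in slitpi_pred.
Proof. by move=> sf; apply/asboolP; apply: pi_field_ext sf => u u0; rewrite extE. Qed.
Lemma mka_subproof A : vfield A -> (fun t : slit => A (val t)) \in slitvf_pred.
Proof. by move=> sf; apply/asboolP; apply: vfield_ext sf => u u0; rewrite extE. Qed.
Definition mkf f (sf : smooth_fun f) : slitfun := Sfun (mkf_subproof sf).
Definition mkx X (sX : pi_field X) : slitpi := Spi (mkx_subproof sX).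
Definition mka A (sA : vfield A) : slitvf := Svf (mka_subproof sA).

Lemma mkfE f (sf : smooth_fun f) u : u.2 != 0 -> ff (mkf sf) u = f u.
Proof. exact: extE. Qed.
Lemma mkxE X (sX : pi_field X) u : u.2 != 0 -> xx (mkx sX) u = X u.
Proof. exact: extE. Qed.
Lemma mkaE A (sA : vfield A) u : u.2 != 0 -> aa (mka sA) u = A u.
Proof. exact: extE. Qed.

Lemma ff_inj f g : (forall u, u.2 != 0 -> ff f u = ff g u) -> f = g.
Proof.
move=> h; apply: val_inj; apply/funext => t /=.
by have := h (val t) (valP t); rewrite /ff !ext_val.
Qed.
Lemma xx_inj X Y : (forall u, u.2 != 0 -> xx X u = xx Y u) -> X = Y.
Proof.
move=> h; apply: val_inj; apply/funext => t /=.
by have := h (val t) (valP t); rewrite /xx !ext_val.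
Qed.
Lemma aa_inj A B : (forall u, u.2 != 0 -> aa A u = aa B u) -> A = B.
Proof.
move=> h; apply: val_inj; apply/funext => t /=.
by have := h (val t) (valP t); rewrite /aa !ext_val.
Qed.

Lemma ffD f g : ff (f + g) = fun u => ff f u + ff g u. Proof. exact: extD. Qed.
Lemma ffN f : ff (- f) = fun u => - ff f u. Proof. exact: extN. Qed.
Lemma ff0 : ff 0 = fun=> 0. Proof. exact: ext0. Qed.
Lemma ffM f g : ff (f * g) = fun u => ff f u * ff g u. Proof. exact: extM. Qed.
Lemma ff1 u : u.2 != 0 -> ff 1 u = 1.
Proof. by move=> u0; exact: (extE (cst (1 : R)) u0). Qed.
Lemma xxD X Y : xx (X + Y) = fun u => xx X u + xx Y u. Proof. exact: extD. Qed.
Lemma xxN X : xx (- X) = fun u => - xx X u. Proof. exact: extN. Qed.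
Lemma xx0 : xx 0 = fun=> 0. Proof. exact: ext0. Qed.
Lemma aaD A B : aa (A + B) = fun u => aa A u + aa B u. Proof. exact: extD. Qed.
Lemma aaN A : aa (- A) = fun u => - aa A u. Proof. exact: extN. Qed.
Lemma aa0 : aa 0 = fun=> 0. Proof. exact: ext0. Qed.

Definition slitpi_scale (f : slitfun) (X : slitpi) : slitpi := mkx (pi_fieldZ (ffP f) (xxP X)).
Definition slitvf_scale (f : slitfun) (A : slitvf) : slitvf := mka (vfieldZ (ffP f) (aaP A)).

Lemma slitpi_scaleA (f g : slitfun) X : slitpi_scale f (slitpi_scale g X) = slitpi_scale (f * g) X.
Proof. by apply: xx_inj => u u0; rewrite !mkxE // ffM scalerA. Qed.
Lemma slitpi_scale1 : left_id 1 slitpi_scale.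
Proof. by move=> X; apply: xx_inj => u u0; rewrite mkxE // ff1 // scale1r. Qed.
Lemma slitpi_scaleDr : right_distributive slitpi_scale +%R.
Proof. by move=> f X Y; apply: xx_inj => u u0; rewrite xxD !mkxE // xxD scalerDr. Qed.
Lemma slitpi_scaleDl X : {morph slitpi_scale^~ X : f g / f + g}.
Proof. by move=> f g; apply: xx_inj => u u0; rewrite xxD !mkxE // ffD scalerDl. Qed.
HB.instance Definition _ := GRing.Zmodule_isLmodule.Build slitfun slitpi
  slitpi_scaleA slitpi_scale1 slitpi_scaleDr slitpi_scaleDl.

Lemma slitvf_scaleA (f g : slitfun) A : slitvf_scale f (slitvf_scale g A) = slitvf_scale (f * g) A.
Proof. by apply: aa_inj => u u0; rewrite !mkaE // ffM scalerA. Qed.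
Lemma slitvf_scale1 : left_id 1 slitvf_scale.
Proof. by move=> X; apply: aa_inj => u u0; rewrite mkaE // ff1 // scale1r. Qed.
Lemma slitvf_scaleDr : right_distributive slitvf_scale +%R.
Proof. by move=> f X Y; apply: aa_inj => u u0; rewrite aaD !mkaE // aaD scalerDr. Qed.
Lemma slitvf_scaleDl X : {morph slitvf_scale^~ X : f g / f + g}.
Proof. by move=> f g; apply: aa_inj => u u0; rewrite aaD !mkaE // ffD scalerDl. Qed.
HB.instance Definition _ := GRing.Zmodule_isLmodule.Build slitfun slitvf
  slitvf_scaleA slitvf_scale1 slitvf_scaleDr slitvf_scaleDl.

(** No condition on [u]: both sides are 0 on the zero section. Hence this is an equality of
    functions, usable under [nabla]. *)
Lemma xxZ (f : slitfun) (X : slitpi) u : xx (f *: X) u = ff f u *: xx X u.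
Proof.
have [u0|u0] := boolP (u.2 != 0); first exact: mkxE.
by rewrite /xx /ff /ext insubF ?scaler0 //; exact: negbTE.
Qed.
Lemma aaZ (f : slitfun) (A : slitvf) u : aa (f *: A) u = ff f u *: aa A u.
Proof.
have [u0|u0] := boolP (u.2 != 0); first exact: mkaE.
by rewrite /aa /ff /ext insubF ?scaler0 //; exact: negbTE.
Qed.

End Slit.

(** * The Cartan connection of a Finsler manifold *)

Section Instance.
Variables (R : realType) (n : nat) (M : manifold R n).
Local Notation E := 'rV[R]_n.
Variables (L : tbundle M -> R) (nabla : tbundle M -> E * E -> (tbundle M -> E) -> E).
Hypothesis FL : finsler L.
Hypothesis CC : cartan_connection nabla L.

Local Notation sfun := (slitfun M).
Local Notation spi := (slitpi M).
Local Notation svf := (slitvf M).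
Implicit Types (f h : sfun) (X Y Z : spi) (A B C : svf) (u : tbundle M).

Let cn : connection nabla := cartan_is_connection CC.
Let rn : regular nabla := cartan_regular CC.

Lemma smooth_zero_indicator : smooth_fun (fun u : tbundle M => if u.2 == 0 then 1 else 0 : R).
Proof.
apply: smooth_fun_ext (@smooth_fun_cst R n M 0) => u /negbTE u0.
by rewrite u0.
Qed.

Lemma nabla0 u a : u.2 != 0 -> nabla u a (fun=> 0) = 0.
Proof.
move=> u0; have := nabla_leibniz cn a u0 (@smooth_fun_cst R n M 0) (@pi_field0 R n M).
have -> : (fun u' : tbundle M => (0 : R) *: (0 : E)) = (fun=> 0).
  by apply/funext => v; rewrite scale0r.
by move=> ->; rewrite scaler0 scale0r addr0.
Qed.

(* A field vanishing off the zero section equals its product with the indicator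
   of the zero section, which is smooth and identically 0 off that section. *)
Lemma nabla_ext u a (X Y : tbundle M -> E) : u.2 != 0 -> pi_field X -> pi_field Y ->
  (forall v, v.2 != 0 -> X v = Y v) -> nabla u a Y = nabla u a X.
Proof.
move=> u0 sX sY XY; pose W v := Y v - X v.
have W0 v : v.2 != 0 -> W v = 0 by move=> v0; rewrite /W XY // subrr.
have sW : pi_field W.
  by apply: pi_field_ext (@pi_field0 R n M) => v v0; rewrite W0.
have -> : Y = (fun v => X v + W v) by apply/funext => v; rewrite /W subrKC.
rewrite (nabla_add cn) //.
have -> : W = (fun v => (if v.2 == 0 then 1 else 0 : R) *: W v).
  apply/funext => v; case: eqVneq => [_|v0]; first by rewrite scale1r.
  by rewrite W0 // scaler0.
rewrite (nabla_leibniz cn) //; last exact: smooth_zero_indicator.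
by rewrite W0 // (negbTE u0) scaler0 scale0r !addr0.
Qed.

Definition s_act A f : slitfun M := mkf (smooth_dfun (ffP f) (aaP A)).
Definition s_nab A X : slitpi M := mkx (nabla_smooth cn (aaP A) (xxP X)).
Definition s_br A B : slitvf M := mka (vfield_lie (aaP A) (aaP B)).
Definition s_rho A : slitpi M := mkx (pi_field_rho (aaP A)).
Definition s_gam X : slitvf M := mka (vfield_gamma (xxP X)).
Definition s_bet X : slitvf M := mka (vfield_beta cn rn (xxP X)).
Definition s_eta : slitpi M := mkx (@pi_field_eta R n M).
Definition s_energy : slitfun M := mkf (smooth_energy FL).

Lemma ff_act A f u : u.2 != 0 -> ff (s_act A f) u = dfun (ff f) u (aa A u).
Proof. exact: mkfE. Qed.
Lemma xx_nab A X u : u.2 != 0 -> xx (s_nab A X) u = nabla u (aa A u) (xx X).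
Proof. exact: mkxE. Qed.
Lemma aa_br A B u : u.2 != 0 -> aa (s_br A B) u = lie_bracket (aa A) (aa B) u.
Proof. exact: mkaE. Qed.
Lemma xx_rho A u : u.2 != 0 -> xx (s_rho A) u = (aa A u).1.
Proof. by move=> u0; rewrite mkxE // /rhof rhoE. Qed.
Lemma aa_gam X u : u.2 != 0 -> aa (s_gam X) u = (0, xx X u).
Proof. by move=> u0; rewrite mkaE // /gammaf gammaE. Qed.
Lemma aa_bet X u : u.2 != 0 -> aa (s_bet X) u = beta nabla u (xx X u).
Proof. exact: mkaE. Qed.
Lemma xx_eta : xx s_eta = @eta R n M.
Proof.
apply/funext => u; have [u0|u0] := boolP (u.2 != 0); first exact: mkxE.
rewrite /xx /ext insubF; last exact: negbTE.
by move: u0; rewrite negbK /eta => /eqP.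
Qed.
Lemma ff_energy u : u.2 != 0 -> ff s_energy u = L u * L u.
Proof. exact: mkfE. Qed.

Lemma s_rho_linear : linear s_rho.
Proof.
move=> f A B; apply: xx_inj => u u0.
by rewrite xxD xxZ !xx_rho // aaD aaZ.
Qed.
Lemma s_gam_linear : linear s_gam.
Proof.
move=> f A B; apply: aa_inj => u u0; rewrite aaD aaZ !aa_gam // xxD xxZ.
by congr pair; rewrite /= scaler0 addr0.
Qed.
Lemma s_bet_linear : linear s_bet.
Proof.
move=> f A B; apply: aa_inj => u u0; rewrite aaD aaZ !aa_bet // xxD xxZ.
have [K1 r1] := beta_spec cn rn (xx A u) u0; have [K2 r2] := beta_spec cn rn (xx B u) u0.
apply: (betaP cn rn) => //; first by rewrite (K_linear cn) // K1 K2 scaler0 addr0.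
by rewrite /= r1 r2.
Qed.
HB.instance Definition _ := GRing.isLinear.Build _ _ _ _ s_rho s_rho_linear.
HB.instance Definition _ := GRing.isLinear.Build _ _ _ _ s_gam s_gam_linear.
HB.instance Definition _ := GRing.isLinear.Build _ _ _ _ s_bet s_bet_linear.

Definition s_d X Y : slitpi M := s_rho (s_br (s_gam X) (s_bet Y)).

Lemma s_rho_bet X : s_rho (s_bet X) = X.
Proof.
apply: xx_inj => u u0; rewrite xx_rho // aa_bet //.
by have [_] := beta_spec cn rn (xx X u) u0.
Qed.
Lemma s_rho_gam X : s_rho (s_gam X) = 0.
Proof. by apply: xx_inj => u u0; rewrite xx_rho // aa_gam // xx0. Qed.

Lemma xx_rho_br_gam X A u : u.2 != 0 ->
  xx (s_rho (s_br (s_gam X) A)) u = fib (xx X) (xx (s_rho A)) u.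
Proof.
move=> u0; rewrite xx_rho // aa_br // -(rhoE u).
have sg : vfield (gammaf (xx X)) by apply: vfield_gamma; exact: xxP.
have EG v : v.2 != 0 -> gammaf (xx X) v = aa (s_gam X) v.
  by move=> v0; rewrite aa_gam // /gammaf gammaE.
have -> := lie_ext sg (aaP A) u0 EG (fun _ _ => erefl).
apply: etrans (rho_lie_gamma (xxP X) (aaP A) u0) _.
have sr : pi_field (rhof (aa A)) by apply: pi_field_rho; exact: aaP.
apply: esym; apply: (near_diffE _ (@open_slit _ _ M (here u)) (slit_here u0)).
  move=> z sz; rewrite !pi_compE; congr (pi_push _ _ _).
  by rewrite [RHS]mkxE //; exact: slit_tparam sz.
exact: pi_diff sr (slit_here u0).
Qed.

Lemma xx_d X Y u : u.2 != 0 -> xx (s_d X Y) u = fib (xx X) (xx Y) u.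
Proof.
by move=> u0; rewrite /s_d; apply: etrans (xx_rho_br_gam X (s_bet Y) u0) _; rewrite s_rho_bet.
Qed.

(** By [fmetric_energy] the metric is a combination of derivatives of the energy along global
    fields; the field [fib X Y] is smooth since it comes from the module element [s_d X Y]. *)
Lemma smooth_fmetric X Y : smooth_fun (fun u => fmetric L u (xx X u) (xx Y u)).
Proof.
have sd : smooth_fun (fun u => dfun (energy L) u (gamma u (xx (s_d X Y) u))).
  by apply: (smooth_dfun (smooth_energy FL)); apply: vfield_gamma; exact: xxP.
have sdd : smooth_fun (fun u => dfun (fun u' => dfun (energy L) u' (gammaf (xx Y) u')) u (gammaf (xx X) u)).
  apply: smooth_dfun; last by apply: vfield_gamma; exact: xxP.
  apply: (smooth_dfun (smooth_energy FL)); apply: vfield_gamma; exact: xxP.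
apply: smooth_fun_ext (smooth_funM (@smooth_fun_cst R n M (2^-1))
  (smooth_funD sdd (smooth_funM (@smooth_fun_cst R n M (-1)) sd))) => u u0.
rewrite mulN1r xx_d // -fmetric_energy //; [|exact: xxP|exact: xxP].
by rewrite mulrDr -mulrDl -div1r -splitr mul1r.
Qed.

Definition s_g X Y : slitfun M := mkf (smooth_fmetric X Y).
Lemma ff_g X Y u : u.2 != 0 -> ff (s_g X Y) u = fmetric L u (xx X u) (xx Y u).
Proof. exact: mkfE. Qed.

Lemma s_add_eq0 f : f + f = 0 -> f = 0.
Proof.
move=> E'; apply: ff_inj => u u0; have := congr1 (fun p => ff p u) E'.
rewrite ffD ff0 => /eqP; rewrite -mulr2n mulrn_eq0 /= => /eqP -> //.
Qed.

Lemma dfun_linear (p : tbundle M -> R) u t (a b : E * E) :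
  dfun p u (t *: a + b) = t * dfun p u a + dfun p u b.
Proof. by rewrite /dfun linearD linearZ. Qed.

Lemma s_act_linear h f A B : s_act (f *: A + B) h = f * s_act A h + s_act B h.
Proof.
apply: ff_inj => u u0; rewrite ffD ffM !ff_act // aaD aaZ.
exact: (dfun_linear (ff h) u (ff f u) (aa A u) (aa B u)).
Qed.

Lemma s_actD A f h : s_act A (f + h) = s_act A f + s_act A h.
Proof.
apply: ff_inj => u u0; rewrite ffD !ff_act // ffD dfunD //; exact: ffP.
Qed.

Lemma s_actM A f h : s_act A (f * h) = s_act A f * h + f * s_act A h.
Proof.
apply: ff_inj => u u0; rewrite ffD !ffM !ff_act // ffM dfunM //; exact: ffP.
Qed.

Lemma s_act_br A B f : s_act (s_br A B) f = s_act A (s_act B f) - s_act B (s_act A f).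
Proof.
apply: ff_inj => u u0; rewrite ffD ffN !ff_act // aa_br //.
apply: etrans (lie_act (ffP f) (aaP A) (aaP B) u0) _.
have E' C a : dfun (fun u' => dfun (ff f) u' (aa C u')) u a = dfun (ff (s_act C f)) u a.
  by apply: (dfun_ext a (ffP (s_act C f)) u0) => v v0; rewrite ff_act.
by rewrite (E' A) (E' B).
Qed.

Lemma s_brC A B : s_br A B = - s_br B A.
Proof. apply: aa_inj => u u0; rewrite aaN !aa_br //; exact: lieC (aa A) (aa B) u. Qed.

Lemma s_brD A B C : s_br A (B + C) = s_br A B + s_br A C.
Proof.
apply: aa_inj => u u0; rewrite aaD !aa_br // aaD.
exact: (lieD (aa A) (aaP B) (aaP C) u0).
Qed.

Lemma s_brZ A f B : s_br A (f *: B) = s_act A f *: B + f *: s_br A B.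
Proof.
apply: aa_inj => u u0; rewrite aaD !aaZ ff_act // !aa_br //.
have -> : aa (f *: B) = (fun u => ff f u *: aa B u) by apply/funext => v; rewrite aaZ.
exact: (lieZ (aa A) (ffP f) (aaP B) u0).
Qed.

Lemma s_jacobi A B C :
  s_br A (s_br B C) + s_br B (s_br C A) + s_br C (s_br A B) = 0.
Proof.
apply: aa_inj => u u0; rewrite !aaD aa0 !(aa_br _ (s_br _ _)) //.
have E' P Q S : lie_bracket (aa P) (aa (s_br Q S)) u = lie_bracket (aa P) (lie_bracket (aa Q) (aa S)) u.
  apply: (lie_ext (aaP P) (vfield_lie (aaP Q) (aaP S)) u0) => v v0 //.
  by rewrite aa_br.
rewrite (E' A B C) (E' B C A) (E' C A B); exact: (lie_jacobi (aaP A) (aaP B) (aaP C) u0).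
Qed.

Lemma s_nab_linear X f A B : s_nab (f *: A + B) X = f *: s_nab A X + s_nab B X.
Proof.
apply: xx_inj => u u0; rewrite xxD xxZ !xx_nab // aaD aaZ.
exact: (nabla_linear cn (ff f u) (aa A u) (aa B u) u0 (xxP X)).
Qed.

Lemma s_nabD A X Y : s_nab A (X + Y) = s_nab A X + s_nab A Y.
Proof.
apply: xx_inj => u u0; rewrite xxD !xx_nab // xxD.
exact: (nabla_add cn (aa A u) u0 (xxP X) (xxP Y)).
Qed.

Lemma s_nabZ A f X : s_nab A (f *: X) = s_act A f *: X + f *: s_nab A X.
Proof.
apply: xx_inj => u u0; rewrite xxD !xxZ ff_act // !xx_nab //.
have -> : xx (f *: X) = (fun u => ff f u *: xx X u) by apply/funext => v; rewrite xxZ.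
exact: (nabla_leibniz cn (aa A u) u0 (ffP f) (xxP X)).
Qed.

Lemma s_nab_bet_eta X : s_nab (s_bet X) s_eta = 0.
Proof.
apply: xx_inj => u u0; rewrite xx_nab // aa_bet // xx_eta xx0.
by have [] := beta_spec cn rn (xx X u) u0.
Qed.

Lemma s_rho_eq0 A : s_rho A = 0 -> exists X, A = s_gam X.
Proof.
move=> rA; have A1 u : u.2 != 0 -> (aa A u).1 = 0.
  by move=> u0; rewrite -xx_rho // rA xx0.
have AE u : u.2 != 0 -> aa A u = (0, (aa A u).2).
  by move=> u0; rewrite -(A1 u u0); case: (aa A u).
have s2 : pi_field (fun u => (aa A u).2).
  move=> i; have oS := @open_slit _ _ M i.
  apply: (smooth_ext (f := snd \o vf_comp i (aa A))) => //.
    move=> z sz; rewrite /= vf_compE pi_compE AE //; last exact: slit_tparam.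
    by rewrite push_vert //; apply: tparam_dom; exact: slit_img.
  apply: (smooth_comp (U' := setT) (@findimEE R n) oS openT) => //; first exact: aaP.
  exact: smooth_snd.
by exists (mkx s2); apply: aa_inj => u u0; rewrite aa_gam // mkxE // AE.
Qed.

Lemma s_g_def X : s_g X X = 0 -> X = 0.
Proof.
move=> gX; apply: xx_inj => u u0; rewrite xx0; apply/eqP/negPn/negP => X0.
have := finsler_definite FL u0 X0.
by rewrite -ff_g // gX ff0 ltxx.
Qed.

Lemma s_metric A X Y : s_act A (s_g X Y) = s_g (s_nab A X) Y + s_g X (s_nab A Y).
Proof.
apply: ff_inj => u u0; rewrite ffD ff_act // !ff_g // !xx_nab //.
apply: etrans _ (cartan_metric CC (aa A u) u0 (xxP X) (xxP Y)).
by apply: (dfun_ext (aa A u) (smooth_fmetric X Y) u0) => v v0; rewrite ff_g.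
Qed.

Lemma s_br_gam X Y : s_br (s_gam X) (s_gam Y) = s_gam (s_d X Y - s_d Y X).
Proof.
apply: aa_inj => u u0; rewrite aa_br // aa_gam // xxD xxN !xx_d //.
have EG Z v : v.2 != 0 -> gammaf (xx Z) v = aa (s_gam Z) v.
  by move=> v0; rewrite aa_gam // /gammaf gammaE.
have sg Z : vfield (gammaf (xx Z)) by apply: vfield_gamma; exact: xxP.
apply: etrans (lie_ext (sg X) (sg Y) u0 (EG X) (EG Y)) _.
by apply: etrans (lie_gamma (xxP X) (xxP Y) u0) _; rewrite gammaE.
Qed.

Lemma s_fibre_eta X : s_d X s_eta = X.
Proof. by apply: xx_inj => u u0; rewrite xx_d // xx_eta fib_eta. Qed.

Lemma s_g_energy X Y : s_g X Y + s_g X Y =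
  s_act (s_gam X) (s_act (s_gam Y) s_energy) - s_act (s_gam (s_d X Y)) s_energy.
Proof.
have fe u a : u.2 != 0 -> dfun (ff s_energy) u a = dfun (energy L) u a.
  by move=> u0; apply: (dfun_ext a (smooth_energy FL) u0) => v v0; rewrite ff_energy.
apply: ff_inj => u u0; rewrite !ffD ffN !ff_act // !ff_g // fe //.
apply: etrans (fmetric_energy FL (xxP X) (xxP Y) u0) _.
rewrite (aa_gam (s_d X Y) u0) (xx_d X Y u0) (aa_gam X u0) gammaE.
have -> : gammaf (xx X) u = (0, xx X u) := gammaE u (xx X u).
have sy : smooth_fun (fun u' => dfun (energy L) u' (gammaf (xx Y) u')).
  by apply: (smooth_dfun (smooth_energy FL)); apply: vfield_gamma; exact: xxP.
apply: (congr2 (fun p q : R => p - q) _ erefl).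
apply: esym; apply: (dfun_ext (0, xx X u) sy u0) => v v0.
by rewrite ff_act // fe // aa_gam // /gammaf gammaE.
Qed.

Lemma s_euler : s_act (s_gam s_eta) s_energy = s_energy + s_energy.
Proof.
apply: ff_inj => u u0; rewrite ffD ff_act // aa_gam // xx_eta !ff_energy //.
apply: etrans (euler_energy FL u0); rewrite gammaE.
by apply: (dfun_ext (0, eta u) (smooth_energy FL) u0) => v v0; rewrite ff_energy.
Qed.

(** On the zero section [beta] is a junk value, so the two fields agree only off it and [nabla_ext]
    is needed. *)
Lemma nabla_rhof_bet u a X : u.2 != 0 -> nabla u a (rhof (betaf nabla (xx X))) = nabla u a (xx X).
Proof.
move=> u0; apply: nabla_ext => //; first exact: xxP.
  by apply: pi_field_rho; apply: (vfield_beta cn rn); exact: xxP.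
move=> v v0; rewrite /rhof /betaf rhoE.
by have [_ ->] := beta_spec cn rn (xx X v) v0.
Qed.

Lemma nabla_rhof_gam u a (X : tbundle M -> E) : u.2 != 0 -> nabla u a (rhof (gammaf X)) = 0.
Proof.
move=> u0; have -> : rhof (gammaf X) = (fun=> 0) by apply/funext => v; exact: rhof_gamma.
exact: nabla0.
Qed.

Lemma s_torsion X Y u : u.2 != 0 ->
  Ttorsion nabla (xx X) (xx Y) u = xx (s_nab (s_gam X) Y - s_d X Y) u.
Proof.
move=> u0; rewrite /Ttorsion /torsion nabla_rhof_bet // nabla_rhof_gam // subr0.
rewrite xxD xxN xx_nab // aa_gam // /gammaf gammaE; congr (_ - _).
rewrite xx_rho // aa_br // rhoE; congr fst.
apply: (lie_ext (aaP (s_gam X)) (aaP (s_bet Y)) u0) => v v0.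
  by rewrite aa_gam // /gammaf gammaE.
by rewrite aa_bet.
Qed.

Lemma s_torsion_sym X Y Z : s_g (s_nab (s_gam X) Y - s_d X Y) Z =
  s_g (s_nab (s_gam X) Z - s_d X Z) Y.
Proof.
apply: ff_inj => u u0.
have e (P Q S : spi) : ff (s_g (s_nab (s_gam P) Q - s_d P Q) S) u =
    fmetric L u (Ttorsion nabla (xx P) (xx Q) u) (xx S u).
  apply: etrans (ff_g _ _ u0) _.
  exact: (congr1 (fun v => fmetric L u v (xx S u)) (esym (s_torsion P Q u0))).
apply: etrans (e X Y Z) _; apply: etrans _ (esym (e X Z Y)).
exact: (cartan_T CC (xxP X) (xxP Y) (xxP Z) u0).
Qed.

Lemma s_rho_br_bet X Y : s_rho (s_br (s_bet X) (s_bet Y)) =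
  s_nab (s_bet X) Y - s_nab (s_bet Y) X.
Proof.
apply: xx_inj => u u0; rewrite xxD xxN !xx_nab // xx_rho // aa_br // !aa_bet //.
have := cartan_Q CC (xxP X) (xxP Y) u0.
rewrite /Qtorsion /torsion !nabla_rhof_bet // rhoE => /eqP; rewrite subr_eq0 => /eqP ->.
congr fst; apply: (lie_ext (vfield_beta cn rn (xxP X)) (vfield_beta cn rn (xxP Y)) u0) => v v0.
  by rewrite aa_bet.
by rewrite aa_bet.
Qed.

Definition s_cur A B X : slitpi M :=
  - s_nab A (s_nab B X) + s_nab B (s_nab A X) + s_nab (s_br A B) X.

(** The inner covariant derivatives are total functions; [nabla_ext] replaces each by the module
    element with which it agrees off the zero section. *)
Lemma s_curE (P Q : tbundle M -> E * E) (Z : tbundle M -> E) A B X u :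
  vfield P -> vfield Q -> pi_field Z ->
  (forall v, v.2 != 0 -> aa A v = P v) -> (forall v, v.2 != 0 -> aa B v = Q v) ->
  (forall v, v.2 != 0 -> xx X v = Z v) -> u.2 != 0 ->
  curvature nabla P Q Z u = xx (s_cur A B X) u.
Proof.
move=> sP sQ sZ EP EQ EZ u0; rewrite /s_cur !xxD xxN !xx_nab // /curvature -EP // -EQ //.
have e (C : slitvf M) (S : tbundle M -> E * E) a : vfield S -> (forall v, v.2 != 0 -> aa C v = S v) ->
    nabla u a (fun u' => nabla u' (S u') Z) = nabla u a (xx (s_nab C X)).
  move=> sS ES; apply: nabla_ext => //; first exact: xxP.
    exact: (nabla_smooth cn).
  move=> v v0; rewrite xx_nab // ES //; apply: esym.
  by apply: nabla_ext => //; exact: xxP.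
rewrite (e A P) // (e B Q) //; congr (_ + _).
have -> := lie_ext (aaP A) (aaP B) u0 EP EQ.
by rewrite aa_br //; apply: (nabla_ext _ u0 (xxP X) sZ).
Qed.

End Instance.

(** * Isotropic curvature *)

Section IsotropicCurvature.
Variables (R : realType) (n : nat) (M : manifold R n).
Local Notation E := 'rV[R]_n.
Variables (L : tbundle M -> R) (nabla : tbundle M -> E * E -> (tbundle M -> E) -> E).
Hypothesis FL : finsler L.
Hypothesis CC : cartan_connection nabla L.
Variables (q : R) (k : tbundle M -> R).
Hypothesis sk : smooth_fun k.
Hypothesis hR : forall X Y Z : tbundle M -> E,
  pi_field X -> pi_field Y -> pi_field Z ->
  forall u : tbundle M, u.2 != 0 ->
  h_curvature nabla X Y Z u =
    k u *: alternate (fun x y : E =>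
      q *: (fmetric L u x (Z u) *: y)
      + (q - 2) *: (((L u)^-1 * fmetric L u x (Z u) * ell L u y) *: eta u
                    - (ell L u y * ell L u (Z u)) *: x)) (X u) (Y u).

Lemma smooth_funV (f : tbundle M -> R) : smooth_fun f -> (forall u, u.2 != 0 -> f u != 0) ->
  smooth_fun (fun u => (f u)^-1).
Proof.
move=> sf f0 i; apply: smoothV (sf i); first exact: open_slit.
by move=> z sz; apply: f0; exact: slit_tparam.
Qed.

Lemma energy_gt0 u : u.2 != 0 -> 0 < L u * L u.
Proof. by move=> u0; apply: mulr_gt0; exact: finsler_gt0. Qed.

Lemma smooth_inv_energy : smooth_fun (fun u => (L u * L u)^-1).
Proof.
by apply: (smooth_funV (smooth_energy FL)) => u u0; rewrite /energy gt_eqF // energy_gt0.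
Qed.

Let kap : slitfun M := mkf (smooth_funM (@smooth_fun_cst R n M (2 * (q - 1))) sk).
Let mu : slitfun M := mkf (smooth_funM (@smooth_fun_cst R n M (2 - q)) sk).
Let e : slitfun M := mkf smooth_inv_energy.

Local Notation sg := (s_g FL CC).
Local Notation sbet := (s_bet CC).
Local Notation scur := (s_cur CC).
Local Notation seta := (s_eta M).

Lemma s_eE : e * s_energy FL = 1.
Proof.
apply: ff_inj => u u0; rewrite ffM ff1 // mkfE // ff_energy //.
by rewrite mulVf // gt_eqF // energy_gt0.
Qed.

Lemma fmetricDl u (v w z : E) : u.2 != 0 -> fmetric L u (v + w) z = fmetric L u v z + fmetric L u w z.
Proof. by move=> u0; have := fmetric_linear FL 1 v w z u0; rewrite scale1r mul1r. Qed.
Lemma fmetricZl u (t : R) (v z : E) : u.2 != 0 -> fmetric L u (t *: v) z = t * fmetric L u v z.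
Proof.
move=> u0; have E0 : fmetric L u 0 z = 0.
  by have := fmetric_linear FL (-1) 0 0 z u0; rewrite scaler0 addr0 mulN1r addNr.
by have := fmetric_linear FL t v 0 z u0; rewrite addr0 E0 addr0.
Qed.
Lemma fmetricNl u (v z : E) : u.2 != 0 -> fmetric L u (- v) z = - fmetric L u v z.
Proof. by move=> u0; rewrite -scaleN1r fmetricZl // mulN1r. Qed.

(** The right-hand side satisfies the equation defining [phi], and definiteness of the metric makes
    the solution unique. *)
Lemma phiE u (v : E) : u.2 != 0 ->
  phi L u v = v - ((L u * L u)^-1 * fmetric L u (eta u) v) *: eta u.
Proof.
move=> u0; set z' := v - _.
have Hz' w : fmetric L u z' w = hbar L u v w.
  rewrite /z' fmetricDl // fmetricNl // fmetricZl // /hbar /ell invfM; congr (_ - _).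
  by rewrite -mulrA mulrACA.
apply: xget_unique => // z Hz; apply/eqP; rewrite -subr_eq0; apply/negPn/negP => d0.
have := finsler_definite FL u0 d0.
have e0 w : fmetric L u (z - z') w = 0.
  by rewrite fmetricDl // fmetricNl // Hz' (Hz w) subrr.
by rewrite e0 ltxx.
Qed.

(** In the alternated product of angular metrics the terms with four factors [ell] cancel. The part
    of the hypothesis multiplied by [q - 2] is thus the metric product minus the angular one, whence
    the coefficients [q + (q - 2)] and [2 - q]. *)
Lemma s_hcur X Y Z W : sg (scur (sbet X) (sbet Y) Z) W =
  kap * (sg X Z * sg Y W - sg Y Z * sg X W) +
  mu * (angular sg seta e X Z * angular sg seta e Y W -
        angular sg seta e Y Z * angular sg seta e X W).
Proof.
apply: ff_inj => u u0.
have eC : xx (scur (sbet X) (sbet Y) Z) u = h_curvature nabla (xx X) (xx Y) (xx Z) u.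
  have cn := cartan_is_connection CC; have rn := cartan_regular CC.
  apply: esym; apply: (s_curE CC (vfield_beta cn rn (xxP X)) (vfield_beta cn rn (xxP Y)) (xxP Z) _ _ _ u0) => v v0 //.
  - by rewrite aa_bet.
  - by rewrite aa_bet.
apply: etrans (ff_g FL CC (scur (sbet X) (sbet Y) Z) W u0) _; rewrite eC (hR (xxP X) (xxP Y) (xxP Z) u0).
rewrite /alternate /angular.
rewrite !(fmetricDl,fmetricZl,fmetricNl) //.
rewrite !(ffD, ffN, ffM) !mkfE // xx_eta /ell.
rewrite invfM; move: (L u)^-1 (k u) (fmetric L u (xx X u) (xx Z u)) (fmetric L u (xx Y u) (xx Z u))
  (fmetric L u (xx X u) (xx W u)) (fmetric L u (xx Y u) (xx W u)) (fmetric L u (eta u) (xx X u))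
  (fmetric L u (eta u) (xx Y u)) (fmetric L u (eta u) (xx Z u)) (fmetric L u (eta u) (xx W u)).
move=> *; ring.
Qed.

(** The hypotheses of [Energy] up to [hcur], in order; [fibreE] and [curE] hold by definition of
    [s_d] and [s_cur]. *)
Local Notation cartan_instance thm := (thm (slitfun M) (slitpi M) (slitvf M)
  (@s_act R n M) (s_nab CC) (@s_br R n M) (@s_rho R n M) (@s_gam R n M) (s_bet CC) sg seta (s_energy FL)
  (@s_add_eq0 R n M) (@s_act_linear R n M) (@s_actD R n M) (@s_actM R n M) (@s_act_br R n M)
  (@s_brC R n M) (@s_brD R n M) (@s_brZ R n M) (@s_jacobi R n M) (s_nab_linear CC)
  (s_rho_bet CC) (s_nab_bet_eta CC) (@s_rho_gam R n M) (@s_rho_eq0 R n M) (s_g_def (FL:=FL) (CC:=CC))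
  (s_metric FL CC) (s_d CC) (fun _ _ => erefl) (s_br_gam CC) (s_fibre_eta CC) (s_g_energy FL CC)
  (s_euler FL) (s_torsion_sym FL CC) (s_nabD CC) (s_nabZ CC) (s_rho_br_bet CC)
  scur (fun _ _ _ => erefl) kap mu e s_eE s_hcur).

Lemma s_cyclic_vertical X Y Z :
  s_act (s_gam X) kap *: (sg seta Y *: Z - sg seta Z *: Y) +
  s_act (s_gam Y) kap *: (sg seta Z *: X - sg seta X *: Z) +
  s_act (s_gam Z) kap *: (sg seta X *: Y - sg seta Y *: X) = 0.
Proof. exact: (cartan_instance (@cyclic_vertical)). Qed.

Lemma s_cyclic_horizontal X Y Z :
  s_act (sbet X) kap *: (sg seta Y *: Z - sg seta Z *: Y) +
  s_act (sbet Y) kap *: (sg seta Z *: X - sg seta X *: Z) +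
  s_act (sbet Z) kap *: (sg seta X *: Y - sg seta Y *: X) = 0.
Proof. exact: (cartan_instance (@cyclic_horizontal)). Qed.

Lemma s_act_cstM (c : R) A u : u.2 != 0 ->
  ff (s_act A (mkf (smooth_funM (@smooth_fun_cst R n M c) sk))) u = c * dfun k u (aa A u).
Proof.
move=> u0; rewrite ff_act //.
have e1 := dfun_ext (aa A u) (smooth_funM (@smooth_fun_cst R n M c) sk) u0
  (fun v v0 => esym (mkfE (smooth_funM (@smooth_fun_cst R n M c) sk) v0)).
by rewrite e1 dfunM // ?dfun_cst ?mul0r ?add0r //; exact: smooth_fun_cst.
Qed.

Hypothesis q1 : q != 1.

Let q10 : 2 * (q - 1) != 0.
Proof. by rewrite mulf_neq0 // subr_eq0. Qed.

(** Serves both lifts. The vectors are extended to fields, and the factor [2 (q - 1)] between [kap]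
    and [k] is cancelled, which is where [q != 1] enters. *)
Lemma cyclic_point u (D : E -> E * E) (sD : slitpi M -> slitvf M) (x y z : E) : u.2 != 0 ->
  (forall X, aa (sD X) u = D (xx X u)) ->
  (forall X Y Z, s_act (sD X) kap *: (sg seta Y *: Z - sg seta Z *: Y) +
    s_act (sD Y) kap *: (sg seta Z *: X - sg seta X *: Z) +
    s_act (sD Z) kap *: (sg seta X *: Y - sg seta Y *: X) = 0) ->
  dfun k u (D x) *: (fmetric L u (eta u) y *: z - fmetric L u (eta u) z *: y) +
  dfun k u (D y) *: (fmetric L u (eta u) z *: x - fmetric L u (eta u) x *: z) +
  dfun k u (D z) *: (fmetric L u (eta u) x *: y - fmetric L u (eta u) y *: x) = 0.
Proof.
move=> u0 DE H.
have [X [sX Xu]] := pi_field_at x u0; have [Y [sY Yu]] := pi_field_at y u0.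
have [Z [sZ Zu]] := pi_field_at z u0.
have := congr1 (fun W => xx W u) (H (mkx sX) (mkx sY) (mkx sZ)).
rewrite xx0 !(xxD, xxN, xxZ) !s_act_cstM // !DE !(ff_g FL CC) // xx_eta !mkxE // Xu Yu Zu.
have alg (c a1 a2 a3 : R) (v1 v2 v3 : E) : c != 0 ->
    (c * a1) *: v1 + (c * a2) *: v2 + (c * a3) *: v3 = 0 -> a1 *: v1 + a2 *: v2 + a3 *: v3 = 0.
  move=> c0 /eqP; rewrite -!scalerA -!scalerDr scaler_eq0 (negbTE c0) => /eqP //.
exact: alg q10.
Qed.

Section Constant.
Variable c : R.
Hypothesis kc : forall u : tbundle M, u.2 != 0 -> k u = c.
Hypothesis c0 : c != 0.

Lemma s_act_cst_eq0 (a : R) A : s_act A (mkf (smooth_funM (@smooth_fun_cst R n M a) sk)) = 0.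
Proof.
apply: ff_inj => u u0; rewrite s_act_cstM // ff0.
have -> := dfun_ext (aa A u) (@smooth_fun_cst R n M c) u0 (fun v v0 => esym (kc v0)).
by rewrite dfun_cst mulr0.
Qed.

Lemma kap_regular (p : slitfun M) : kap * p = 0 -> p = 0.
Proof.
move=> kp; apply: ff_inj => u u0; have := congr1 (fun f => ff f u) kp.
rewrite ffM ff0 mkfE // kc // => /eqP; rewrite mulf_eq0 mulf_eq0 (negbTE q10) (negbTE c0) /=.
by move/eqP.
Qed.

Lemma hv_curvature_symmetric X Y Z u : pi_field X -> pi_field Y -> pi_field Z -> u.2 != 0 ->
  hv_curvature nabla X Y Z u = hv_curvature nabla Y X Z u.
Proof.
move=> sX sY sZ u0; have cn := cartan_is_connection CC; have rn := cartan_regular CC.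
have E' P Q (sP : pi_field P) (sQ : pi_field Q) : hv_curvature nabla P Q Z u =
    xx (scur (sbet (mkx sP)) (s_gam (mkx sQ)) (mkx sZ)) u.
  apply: (s_curE CC (vfield_beta cn rn sP) (vfield_gamma sQ) sZ _ _ _ u0) => v v0.
  - by rewrite aa_bet // mkxE.
  - by rewrite aa_gam // mkxE // /gammaf gammaE.
  - by rewrite mkxE.
rewrite (E' X Y sX sY) (E' Y X sY sX); congr (xx _ u).
exact: (cartan_instance (@hv_symmetric) (s_act_cst_eq0 _) (s_act_cst_eq0 _) kap_regular).
Qed.

Lemma v_curvatureE X Y Z u : pi_field X -> pi_field Y -> pi_field Z -> u.2 != 0 ->
  v_curvature nabla X Y Z u =
   ((2 - q) / (2 * (q - 1) * L u ^+ 2)) *: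
     (hbar L u (X u) (Z u) *: phi L u (Y u) - hbar L u (Y u) (Z u) *: phi L u (X u)).
Proof.
move=> sX sY sZ u0.
have -> : v_curvature nabla X Y Z u =
    xx (scur (s_gam (mkx sX)) (s_gam (mkx sY)) (mkx sZ)) u.
  apply: (s_curE CC (vfield_gamma sX) (vfield_gamma sY) sZ _ _ _ u0) => v v0.
  - by rewrite aa_gam // mkxE // /gammaf gammaE.
  - by rewrite aa_gam // mkxE // /gammaf gammaE.
  - by rewrite mkxE.
have := cartan_instance (@v_curvature_angular)
  (s_act_cst_eq0 _) (s_act_cst_eq0 _) kap_regular (mkx sX) (mkx sY) (mkx sZ).
move: (scur _ _ _) => S /(congr1 (fun W => xx W u)).
rewrite /angular !(xxD, xxN, xxZ) !(ffM, ffD, ffN) !(ff_g FL CC) // xx_eta !mkxE // !mkfE // kc //.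
have hE v w : hbar L u v w =
    fmetric L u v w - (L u * L u)^-1 * fmetric L u (eta u) v * fmetric L u (eta u) w.
  by rewrite /hbar /ell invfM -mulrA mulrACA.
rewrite !(hE (X u)) !(hE (Y u)) (phiE (X u) u0) (phiE (Y u) u0).
move: (_ *: _ - _ *: _) (xx S u) => V w.
have L0 : L u != 0 by rewrite gt_eqF // finsler_gt0.
have a0 : 2 * (q - 1) * c * (L u * L u) != 0 by rewrite !mulf_neq0 // subr_eq0.
(* The inverse of [kap f] at [u]; its [c] cancels against the one in [mu]. *)
move=> /(congr1 (fun v => (2 * (q - 1) * c * (L u * L u))^-1 *: v)).
rewrite scalerK // => ->; rewrite scalerA; congr (_ *: _).
have q1' : q - 1 != 0 by rewrite subr_eq0.
by field; rewrite q1' c0 L0.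
Qed.
End Constant.

End IsotropicCurvature.

(** * Functions with vanishing differential *)

Section LinearForms.
Variables (R : fieldType) (n : nat).
Local Notation E := 'rV[R]_n.

Lemma exists_row_notin m (A : 'M[R]_(m, n)) : (m < n)%N -> exists v : E, ~~ (v <= A)%MS.
Proof.
move=> mn; apply: contrapT => /forallNP H.
have : (1%:M <= A)%MS by apply/row_subP => i; apply/negPn/negP; exact: H.
move/mxrankS; rewrite mxrank1 => /leq_trans /(_ (rank_leq_row A)).
by rewrite leqNgt mn.
Qed.

Lemma cyclic_forms (a b : E -> R) : (3 <= n)%N ->
  (forall x y z, a x *: (b y *: z - b z *: y) + a y *: (b z *: x - b x *: z) +
    a z *: (b x *: y - b y *: x) = 0) ->
  forall x z, a z * b x = a x * b z.
Proof.
move=> n3 H x z; apply/eqP; rewrite -subr_eq0; apply/negPn/negP => d0.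
have [y /negP] := @exists_row_notin (1 + 1) (col_mx x z) n3; apply.
pose w : E := (a z * b y - a y * b z) *: x + (a y * b x - a x * b y) *: z.
have dy : (a z * b x - a x * b z) *: y = w.
  apply/eqP; rewrite -subr_eq0 -(H x y z) /w; apply/eqP/rowP => j; rewrite !mxE; ring.
rewrite -[y](scalerK d0) dy scalemx_sub // addmx_sub // scalemx_sub //.
  by rewrite -addsmxE addsmxSl.
by rewrite -addsmxE addsmxSr.
Qed.

End LinearForms.

(** * From vanishing derivatives to a constant function *)

Section Constancy.
Variables (R : realType) (n : nat) (M : manifold R n).
Local Notation E := 'rV[R]_n.
Variable k : tbundle M -> R.
Hypothesis sk : smooth_fun k.

Lemma slit_fibre (x : M) (y : E) : y != 0 -> slit_chart (chart_at M x) (chart M (chart_at M x) x, y).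
Proof. by move=> y0; split => //; exact: img_chart (dom_chart_at x). Qed.

Lemma fibre_tparam (x : M) (y : E) :
  (k \o tparam (chart_at M x)) (chart M (chart_at M x) x, y) = k (x, y).
Proof. exact: esym (fibre_param k (x, y) y). Qed.

Lemma fibre_dfun (x : M) (y : E) a :
  'd (k \o tparam (chart_at M x)) (chart M (chart_at M x) x, y) a = dfun k (x, y) a.
Proof. by rewrite /dfun tchart_hereE. Qed.

Section Vertical.
Hypothesis kv : forall (u : tbundle M) (v : E), u.2 != 0 -> dfun k u (0, v) = 0.

Lemma fibre_segment (x : M) (y w : E) : (forall t : R, 0 <= t <= 1 -> y + t *: w != 0) ->
  k (x, y + w) = k (x, y).
Proof.
move=> yw0; set i := chart_at M x; set z := chart M i x.
have pE (t : R) : ((z, y) : E * E) + t *: ((0, w) : E * E) = (z, y + t *: w).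
  by congr pair; rewrite /= scaler0 addr0.
have dk (t : R) : 0 <= t <= 1 -> differentiable (k \o tparam i) (((z, y) : E * E) + t *: ((0, w) : E * E)).
  by move=> t01; rewrite pE; exact: smooth_differentiable (sk i) (slit_fibre x (yw0 t t01)).
have [t t01] := mvt_line ler01 dk.
rewrite !pE scale1r !fibre_tparam fibre_dfun kv; last exact: yw0.
by rewrite mulr0 => /eqP; rewrite subr_eq0 => /eqP.
Qed.

(** The segment between independent vectors misses 0. Dependent vectors are joined through a third
    one off their line. *)
Lemma fibre_const (x : M) (y y' : E) : (2 <= n)%N -> y != 0 -> y' != 0 -> k (x, y) = k (x, y').
Proof.
move=> n2 y0 y0'.
have indep (a b : E) : a != 0 -> ~~ (b <= a)%MS -> k (x, a) = k (x, b).
  move=> a0 ba; have -> : b = a + (b - a) by rewrite subrKC.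
  apply: esym; apply: fibre_segment => t _; apply: contra ba => /eqP.
  have [->|t0] := eqVneq t 0; first by rewrite scale0r addr0 => a0'; rewrite a0' eqxx in a0.
  move=> e; have -> : b = (1 - t^-1) *: a.
    apply: (scalerI t0); rewrite scalerA mulrBr mulr1 mulfV //.
    have -> : t *: b = (t - 1) *: a + (a + t *: (b - a)).
      by apply/rowP => j; rewrite !mxE; ring.
    by rewrite e addr0.
  exact: scalemx_sub.
have [w wy] := exists_row_notin y n2.
have [yy'|yy'] := boolP (y' <= y)%MS; last exact: indep.
rewrite (indep y w) // (indep y' w) //; apply: contra wy => wy'.
exact: submx_trans wy' yy'.
Qed.

Lemma is_diff_pairl (y z : E) : is_diff z (fun z : E => (z, y)) (fun v => (v, 0)).
Proof.
have := @is_diff_pair R E E E id id (cst y) 0 z (is_diff_id z) (is_diff_cst y z).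
by [].
Qed.

Lemma base_dfunE (x : M) (y v : E) : y != 0 ->
  let i := chart_at M x in let z := chart M i x in
  differentiable (fun z' : E => (k \o tparam i) (z', y)) z /\
  'd (fun z' : E => (k \o tparam i) (z', y)) z v = dfun k (x, y) (v, 0).
Proof.
move=> y0 /=; have [d1 d2] := is_diff_pairl y (chart M (chart_at M x) x).
have dF := smooth_differentiable (sk (chart_at M x)) (slit_fibre x y0).
split; first exact: (differentiable_comp d1 dF).
apply: etrans (congr1 (fun h => h v) (diff_comp d1 dF)) _.
apply: etrans (congr1 (fun b => 'd _ (_, y) b) (congr1 (fun h => h v) d2)) _.
exact: fibre_dfun.
Qed.

(** In a chart [k] does not depend on the fibre coordinate, so neither do its derivatives in base
    directions. *)
Lemma base_dfun_indep (x : M) (y y' v : E) : (2 <= n)%N -> y != 0 -> y' != 0 ->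
  dfun k (x, y') (v, 0) = dfun k (x, y) (v, 0).
Proof.
move=> n2 y0 y0'; have [d1 <-] := base_dfunE x v y0; have [d2 <-] := base_dfunE x v y0'.
apply: (near_diffE _ (@open_img _ _ M _) (img_chart (dom_chart_at x)) _ d1) => z iz.
have p0 w : w != 0 -> (tparam (chart_at M x) (z, w)).2 != 0.
  by move=> w0; rewrite tparam_neq0.
exact: (fibre_const (param M (chart_at M x) z) n2 (p0 y y0) (p0 y' y0')).
Qed.

Lemma dfun_split u (a : E * E) : dfun k u a = dfun k u (a.1, 0) + dfun k u (0, a.2).
Proof.
have -> : dfun k u a = dfun k u (1 *: (a.1, 0) + (0, a.2)).
  by congr (dfun k u _); case: a => a1 a2; congr pair; rewrite /= ?scaler0 ?add0r // scale1r addr0.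
by rewrite dfun_linear mul1r.
Qed.

Lemma dfun_eq0 (f : tbundle M -> E -> R) : (2 <= n)%N ->
  (forall u, u.2 != 0 -> f u u.2 != 0) ->
  (forall u (z : E), u.2 != 0 ->
    dfun k u (z, 0) * f u u.2 = dfun k u (u.2, 0) * f u z) ->
  forall u a, u.2 != 0 -> dfun k u a = 0.
Proof.
move=> n2 f0 H [x y1] a y10; rewrite dfun_split kv // addr0.
pose c v := dfun k (x, y1) (v, 0).
have cZ t v : c (t *: v) = t * c v.
  rewrite /c -[((t *: v), 0)]/(t *: v, (0 : E)).
  have -> : (t *: v, 0) = t *: ((v, 0) : E * E) + 0 by congr pair; rewrite /= ?scaler0 addr0.
  rewrite dfun_linear; have := dfun_linear k (x, y1) (-1) 0 0.
  by rewrite scaler0 addr0 mulN1r addNr => ->; rewrite addr0.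
have cD v w : c (v + w) = c v + c w.
  rewrite /c; have -> : (v + w, 0) = 1 *: ((v, 0) : E * E) + ((w, 0) : E * E).
    by rewrite scale1r; congr pair; rewrite /= addr0.
  by rewrite dfun_linear mul1r.
(* A nonzero kernel vector of the form [c]: [y1] itself, or a combination of [y1] and some [w] that
   is not a multiple of it. At this vector the right-hand side of [H] vanishes. *)
have [y [y0 cy]] : exists y, y != 0 /\ c y = 0.
  have [c1|c1] := eqVneq (c y1) 0; first by exists y1.
  have [w wy] := exists_row_notin y1 n2.
  exists (c y1 *: w + (- c w) *: y1); split; last by rewrite cD !cZ; ring.
  apply: contra wy; rewrite addr_eq0 => /eqP e.
  have -> : w = ((c y1)^-1 * c w) *: y1.
    by rewrite -scalerA; move: e; rewrite scaleNr opprK => <-; rewrite scalerK.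
  exact: scalemx_sub.
have := H (x, y) a.1 y0; rewrite (base_dfun_indep x _ n2 y10 y0) (base_dfun_indep x y n2 y10 y0).
rewrite -/(c y) cy mul0r => /eqP; rewrite mulf_eq0 (negbTE (f0 (x, y) y0)) orbF.
by move/eqP.
Qed.
End Vertical.

Lemma diff_eq0 i z a : (forall u b, u.2 != 0 -> dfun k u b = 0) -> slit_chart i z ->
  'd (k \o tparam i) z a = 0.
Proof.
move=> dk0 sz; have [u [iu u0 ->]] := slit_cover sz.
by rewrite -(push_pull a iu) -dfun_chart // dk0.
Qed.

Lemma dfun0_const : (2 <= n)%N -> connected [set: M] ->
  (forall u a, u.2 != 0 -> dfun k u a = 0) -> exists c, forall u, u.2 != 0 -> k u = c.
Proof.
move=> n2 cM dk0; have [w0 w00] : exists w : E, w != 0.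
  have [w w0] := exists_row_notin (0 : E) n2; exists w.
  by apply: contra w0 => /eqP ->; exact: sub0mx.
(* The fixed [w0] stands for tangent vectors that may jump with [x], as [chart_at] does; constancy
   on fibres makes this harmless. *)
have fc (x : M) (y : E) : y != 0 -> k (x, y) = k (x, w0).
  by move=> y0; apply: fibre_const => // u v u0; exact: dk0.
pose A x0 := [set x : M | k (x, w0) = k (x0, w0)].
have near_const x0 : \forall x \near x0, k (x, w0) = k (x0, w0).
  set i := chart_at M x0; set z0 := chart M i x0.
  have iz0 : img i z0 by exact: img_chart (dom_chart_at x0).
  have /nbhs_ballP[r r0 br] : nbhs z0 (img i) by apply: open_nbhs_nbhs; split => //; exact: open_img.
  have near_i : \forall x \near x0, dom M i x.
    by apply: open_nbhs_nbhs; split; [exact: open_dom|exact: dom_chart_at].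
  have near_b : \forall x \near x0, ball z0 r (chart M i x).
    exact: (continuous_chart (dom_chart_at x0)) (nbhsx_ballx z0 r r0).
  near=> x; have ix : dom M i x by near: x.
  have bx : ball z0 r (chart M i x) by near: x.
  have kE (y : M) : dom M i y -> (k \o tparam i) (chart M i y, w0) = k (y, w0).
    move=> iy; have p0 : (tparam i (chart M i y, w0)).2 != 0.
      by rewrite tparam_neq0 //; exact: img_chart.
    apply: etrans (fc (param M i (chart M i y)) _ p0) _.
    by rewrite (chartK iy).
  set v : E := chart M i x - z0.
  have st (t : R) : 0 <= t <= 1 -> slit_chart i (((z0, w0) : E * E) + t *: ((v, 0) : E * E)).
    move=> /andP[t0 t1]; split; last by rewrite /= scaler0 addr0.
    apply: br; move: bx; rewrite -ball_normE /= => bx.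
    rewrite opprD addrA subrr add0r normrN normrZ (ger0_norm t0).
    apply: le_lt_trans bx; rewrite distrC ler_piMl //.
  have dk t : 0 <= t <= 1 -> differentiable (k \o tparam i) (((z0, w0) : E * E) + t *: ((v, 0) : E * E)).
    by move=> t01; exact: smooth_differentiable (sk i) (st t t01).
  have [t t01] := mvt_line ler01 dk.
  rewrite (diff_eq0 _ dk0 (st t t01)) mulr0 => /eqP; rewrite subr_eq0 => /eqP.
  rewrite -(kE x ix) -(kE x0 (dom_chart_at x0)) => <-; congr ((k \o tparam i) _).
  by congr pair; rewrite /= !scale1r ?addr0 // /v subrKC.
(* The empty manifold is connected in this sense; any constant will do. *)
have [[x0 _]|nM] := pselect (exists x : M, True); last first.
  by exists 0 => -[x y]; case: nM; exists x.
exists (k (x0, w0)) => -[x y] /= y0; rewrite fc //.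
have oA x1 : open (A x1).
  rewrite openE => x2 Ax2; rewrite /interior /=.
  by have := near_const x2; apply: filterS => x3 /= E3; rewrite /A /= E3.
suff AT : A x0 = [set: M] by have : [set: M] x by []; rewrite -AT.
apply: cM; first by exists x0.
  by exists (A x0) => //; rewrite setTI.
exists (A x0); last by rewrite setTI.
rewrite -[A x0]setCK; apply: open_closedC; rewrite openE => x2 Ax2; rewrite /interior /=.
by have := near_const x2; apply: filterS => x3 /= E3; rewrite /A /= E3.
Unshelve. all: by end_near. Qed.

End Constancy.

Unset Implicit Arguments.

Theorem theorem2p4 (R : realType) (n : nat) (M : manifold R n)
  (L : tbundle M -> R)
  (nabla : tbundle M -> 'rV[R]_n * 'rV[R]_n -> (tbundle M -> 'rV[R]_n) ->
           'rV[R]_n)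
  (q : R) (k : tbundle M -> R) :
  (3 <= n)%N ->
  connected [set: M] ->
  finsler L ->
  cartan_connection nabla L ->
  q != 1 ->
  smooth_fun k ->
  (forall (u : tbundle M) (t : R), u.2 != 0 -> 0 < t ->
     k (u.1, t *: u.2) = k u) ->
  (forall X Y Z : tbundle M -> 'rV[R]_n,
     pi_field X -> pi_field Y -> pi_field Z ->
     forall u : tbundle M, u.2 != 0 ->
     h_curvature nabla X Y Z u =
       k u *: alternate (fun x y : 'rV[R]_n =>
         q *: (fmetric L u x (Z u) *: y)
         + (q - 2) *: (((L u)^-1 * fmetric L u x (Z u) * ell L u y) *: eta u
                       - (ell L u y * ell L u (Z u)) *: x)) (X u) (Y u)) ->
  exists c : R,
    (forall u : tbundle M, u.2 != 0 -> k u = c) /\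
    (c != 0 ->
     forall X Y Z : tbundle M -> 'rV[R]_n,
     pi_field X -> pi_field Y -> pi_field Z ->
     forall u : tbundle M, u.2 != 0 ->
       hv_curvature nabla X Y Z u = hv_curvature nabla Y X Z u /\
       v_curvature nabla X Y Z u =
         ((2 - q) / (2 * (q - 1) * L u ^+ 2)) *:
           (hbar L u (X u) (Z u) *: phi L u (Y u)
            - hbar L u (Y u) (Z u) *: phi L u (X u))).
Proof.
move=> n3 cM FL CC q1 sk hk hR.
have n2 : (2 <= n)%N := ltnW n3.
have y0 (u : tbundle M) : u.2 != 0 -> fmetric L u (eta u) u.2 != 0.
  by move=> u0; have := finsler_definite FL u0 u0; rewrite /eta; case: ltgtP.
have kv (u : tbundle M) (v : 'rV[R]_n) : u.2 != 0 -> dfun k u (0, v) = 0.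
  move=> u0.
  have H x y z := cyclic_point q1 (D := fun v => (0, v)) x y z u0
    (fun X => aa_gam X u0) (s_cyclic_vertical FL CC sk hR).
  have := cyclic_forms n3 H (eta u) v.
  have -> : dfun k u (0, eta u) = 0 by rewrite -(gammaE u); exact: euler0 sk u0 hk.
  by rewrite mul0r => /eqP; rewrite mulf_eq0 (negbTE (y0 u u0)) orbF => /eqP.
have kh (u : tbundle M) (z : 'rV[R]_n) : u.2 != 0 ->
    dfun k u (z, 0) * fmetric L u (eta u) u.2 = dfun k u (u.2, 0) * fmetric L u (eta u) z.
  move=> u0.
  have H x y z := cyclic_point q1 (D := beta nabla u) x y z u0
    (fun X => aa_bet CC X u0) (s_cyclic_horizontal FL CC sk hR).
  (* The horizontal lift differs from [(v, 0)] by a vertical vector, on which the differential of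
     [k] vanishes by [kv]. *)
  have bE v : dfun k u (beta nabla u v) = dfun k u (v, 0).
    have [_ b1] := beta_spec (cartan_is_connection CC) (cartan_regular CC) v u0.
    by rewrite dfun_split kv // addr0 b1.
  by have := cyclic_forms n3 H (eta u) z; rewrite !bE.
have [c kc] := dfun0_const sk n2 cM (fun u a => dfun_eq0 sk kv n2 y0 kh (u := u) a).
exists c; split; first exact: kc.
move=> c0 X Y Z sX sY sZ u u0; split.
  exact: (hv_curvature_symmetric FL CC sk hR q1 kc c0 sX sY sZ u0).
exact: (v_curvatureE FL CC sk hR q1 kc c0 sX sY sZ u0).
Qed.
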